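(* Let $n \geq 1$, let $T$ be a consistent c.e. extension of $\mathsf{PA}$, and let $U$ be any subtheory of $T$ (with $T \vdash U \vdash \mathsf{PA}$). The following are equivalent: 1. $T$ is $\Sigma_{n+1}$-consistent over $U$. 2. $T$ is $\Pi_n$-consistent over $U$. 3. $\Delta_{n+1}(U) \cap \mathrm{DCons}(\Sigma_n, \Sigma_n; T) = \emptyset$. 4. $\Delta_{n+1}(U) \cap \mathrm{DCons}(\mathcal{B}(\Sigma_n), \mathcal{B}(\Sigma_n); T) = \emptyset$.
   Context: All theories are in the language of first-order arithmetic; $\mathsf{PA}$ is Peano Arithmetic. A subtheory of $T$ always means a theory $U$ with $T \vdash U \vdash \mathsf{PA}$. A sentence is $\mathcal{B}(\Sigma_n)$ iff it is a Boolean combination of $\Sigma_n$ sentences. A formula is $\Delta_m(U)$ iff it is $U$-provably equivalent both to some $\Sigma_m$ formula and to some $\Pi_m$ formula. A class symbol also denotes the set of all sentences in the class. For a class $\Gamma$ of formulas, $T$ is $\Gamma$-consistent over $U$ iff there is no $\Gamma$ formula $\varphi(x)$ such that $U \vdash \exists x\, \varphi(x)$ and $T \vdash \neg \varphi(\overline{k})$ for all $k \in \omega$ (where $\overline{k}$ is the numeral of $k$). For $\Gamma \in \{\Sigma_n, \mathcal{B}(\Sigma_n)\}$, a sentence $\varphi$ is $\Gamma$-conservative over $T$ iff every $\Gamma$ sentence provable in $T + \varphi$ is provable in $T$. $\mathrm{DCons}(\Gamma, \Lambda; T)$ is the set of all sentences $\varphi$ such that $\varphi$ is $\Gamma$-conservative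 over $T$ and $\neg\varphi$ is $\Lambda$-conservative over $T$. *)

(* Defs.v *)
From Stdlib Require Import List PeanoNat Cantor.

(** * Syntax of first-order arithmetic

    The language is [0, S, +, *, <] with equality.  Variables are de Bruijn
    indices: [All] and [Ex] bind index [0] of their body. *)

Inductive term : Type :=
| Var (i : nat)
| Zero
| Succ (t : term)
| Plus (s t : term)
| Mult (s t : term).

Inductive form : Type :=
| Eq (s t : term)
| Lt (s t : term)
| Bot
| Imp (a b : form)
| And (a b : form)
| Or (a b : form)
| All (a : form)
| Ex (a : form).

Definition Neg (a : form) : form := Imp a Bot.
Definition Iff (a b : form) : form := And (Imp a b) (Imp b a).

(** Simultaneous capture-avoiding substitution. *)

Fixpoint subst_term (sigma : nat -> term) (t : term) : term :=
  match t with
  | Var i => sigma i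
  | Zero => Zero
  | Succ s => Succ (subst_term sigma s)
  | Plus s1 s2 => Plus (subst_term sigma s1) (subst_term sigma s2)
  | Mult s1 s2 => Mult (subst_term sigma s1) (subst_term sigma s2)
  end.

Definition shift_term : term -> term := subst_term (fun i => Var (S i)).

Definition up (sigma : nat -> term) (i : nat) : term :=
  match i with
  | 0 => Var 0
  | S j => shift_term (sigma j)
  end.

Fixpoint subst (sigma : nat -> term) (a : form) : form :=
  match a with
  | Eq s t => Eq (subst_term sigma s) (subst_term sigma t)
  | Lt s t => Lt (subst_term sigma s) (subst_term sigma t)
  | Bot => Bot
  | Imp b c => Imp (subst sigma b) (subst sigma c)
  | And b c => And (subst sigma b) (subst sigma c)
  | Or b c => Or (subst sigma b) (subst sigma c)
  | All b => All (subst (up sigma) b)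
  | Ex b => Ex (subst (up sigma) b)
  end.

Definition shift : form -> form := subst (fun i => Var (S i)).

(** [inst t a] is the instance [a(t)] of the body [a] of a quantifier. *)
Definition inst (t : term) : form -> form :=
  subst (fun i => match i with 0 => t | S j => Var j end).

(** All free variables have index [< k]. *)

Fixpoint bounded_term (k : nat) (t : term) : Prop :=
  match t with
  | Var i => i < k
  | Zero => True
  | Succ s => bounded_term k s
  | Plus s1 s2 => bounded_term k s1 /\ bounded_term k s2
  | Mult s1 s2 => bounded_term k s1 /\ bounded_term k s2
  end.

Fixpoint bounded (k : nat) (a : form) : Prop :=
  match a with
  | Eq s t | Lt s t => bounded_term k s /\ bounded_term k t
  | Bot => True
  | Imp b c | And b c | Or b c => bounded k b /\ bounded k c
  | All b | Ex b => bounded (S k) b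
  end.

Definition sentence (a : form) : Prop := bounded 0 a.

Definition numeral (k : nat) : term := Nat.iter k Succ Zero.

(** * Provability: classical natural deduction with equality *)

Inductive deriv : list form -> form -> Prop :=
| D_ax G a : In a G -> deriv G a
| D_raa G a : deriv (Neg a :: G) Bot -> deriv G a
| D_imp_i G a b : deriv (a :: G) b -> deriv G (Imp a b)
| D_imp_e G a b : deriv G (Imp a b) -> deriv G a -> deriv G b
| D_and_i G a b : deriv G a -> deriv G b -> deriv G (And a b)
| D_and_e1 G a b : deriv G (And a b) -> deriv G a
| D_and_e2 G a b : deriv G (And a b) -> deriv G b
| D_or_i1 G a b : deriv G a -> deriv G (Or a b)
| D_or_i2 G a b : deriv G b -> deriv G (Or a b)
| D_or_e G a b c :
    deriv G (Or a b) -> deriv (a :: G) c -> deriv (b :: G) c -> deriv G c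
| D_all_i G a : deriv (map shift G) a -> deriv G (All a)
| D_all_e G a t : deriv G (All a) -> deriv G (inst t a)
| D_ex_i G a t : deriv G (inst t a) -> deriv G (Ex a)
| D_ex_e G a c :
    deriv G (Ex a) -> deriv (a :: map shift G) (shift c) -> deriv G c
| D_eq_refl G t : deriv G (Eq t t)
| D_eq_subst G a s t : deriv G (Eq s t) -> deriv G (inst s a) -> deriv G (inst t a).

(** A theory is given by its set of axioms, which are required to be
    sentences by [is_theory]. *)
Definition theory : Type := form -> Prop.

Definition is_theory (T : theory) : Prop := forall a, T a -> sentence a.

Definition proves (T : theory) (a : form) : Prop :=
  exists G : list form, (forall b, In b G -> T b) /\ deriv G a.

Definition extends (T U : theory) : Prop := forall a, U a -> proves T a.

Definition consistent (T : theory) : Prop := ~ proves T Bot.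

Definition add_axiom (T : theory) (a : form) : theory := fun b => T b \/ b = a.

(** * Peano arithmetic *)

(** [a(0) -> (forall x, a(x) -> a(S x)) -> forall x, a(x)], where [x] is the
    variable [0] of [a] and the other variables of [a] are parameters. *)
Definition induction (a : form) : form :=
  Imp (inst Zero a)
    (Imp (All (Imp a
           (subst (fun i => match i with 0 => Succ (Var 0) | S j => Var (S j) end) a)))
         (All a)).

Inductive PA : theory :=
| PA_succ_0 : PA (All (Neg (Eq (Succ (Var 0)) Zero)))
| PA_succ_inj :
    PA (All (All (Imp (Eq (Succ (Var 1)) (Succ (Var 0))) (Eq (Var 1) (Var 0)))))
| PA_plus_0 : PA (All (Eq (Plus (Var 0) Zero) (Var 0)))
| PA_plus_succ :
    PA (All (All (Eq (Plus (Var 1) (Succ (Var 0))) (Succ (Plus (Var 1) (Var 0))))))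
| PA_mult_0 : PA (All (Eq (Mult (Var 0) Zero) Zero))
| PA_mult_succ :
    PA (All (All (Eq (Mult (Var 1) (Succ (Var 0)))
                     (Plus (Mult (Var 1) (Var 0)) (Var 1)))))
| PA_lt :
    PA (All (All (Iff (Lt (Var 1) (Var 0))
                      (Ex (Eq (Plus (Var 2) (Succ (Var 0))) (Var 1))))))
| PA_induction (a : form) (k : nat) :
    sentence (Nat.iter k All (induction a)) -> PA (Nat.iter k All (induction a)).

(** * Computably enumerable theories

    Programs for the partial recursive functions of one argument; several
    arguments are packed with the Cantor pairing function.  [eval p x y] means
    that [p] halts on [x] with output [y]. *)

Inductive prog : Type :=
| P_zero
| P_succ
| P_fst
| P_snd
| P_pair (p q : prog)
| P_comp (p q : prog)
| P_rec (p q : prog)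
| P_min (p : prog).

Fixpoint eval_rec (P Q : nat -> nat -> Prop) (x n : nat) : nat -> Prop :=
  match n with
  | 0 => P x
  | S m => fun y =>
      exists z, eval_rec P Q x m z /\ Q (to_nat (x, to_nat (m, z))) y
  end.

Fixpoint eval (p : prog) (x : nat) : nat -> Prop :=
  match p with
  | P_zero => fun y => y = 0
  | P_succ => fun y => y = S x
  | P_fst => fun y => y = fst (of_nat x)
  | P_snd => fun y => y = snd (of_nat x)
  | P_pair p q => fun y =>
      exists u v, eval p x u /\ eval q x v /\ y = to_nat (u, v)
  | P_comp p q => fun y => exists z, eval q x z /\ eval p z y
  | P_rec p q => eval_rec (eval p) (eval q) (fst (of_nat x)) (snd (of_nat x))
  | P_min p => fun y =>
      eval p (to_nat (x, y)) 0 /\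
      forall m, m < y -> exists v, eval p (to_nat (x, m)) (S v)
  end.

(** A set of numbers is c.e. iff it is the domain of a partial recursive
    function. *)
Definition ce_set (A : nat -> Prop) : Prop :=
  exists p : prog, forall x, A x <-> exists y, eval p x y.

(** Goedel numbers *)

Fixpoint code_term (t : term) : nat :=
  match t with
  | Var i => to_nat (0, i)
  | Zero => to_nat (1, 0)
  | Succ s => to_nat (2, code_term s)
  | Plus s1 s2 => to_nat (3, to_nat (code_term s1, code_term s2))
  | Mult s1 s2 => to_nat (4, to_nat (code_term s1, code_term s2))
  end.

Fixpoint code (a : form) : nat :=
  match a with
  | Eq s t => to_nat (0, to_nat (code_term s, code_term t))
  | Lt s t => to_nat (1, to_nat (code_term s, code_term t))
  | Bot => to_nat (2, 0)
  | Imp b c => to_nat (3, to_nat (code b, code c))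
  | And b c => to_nat (4, to_nat (code b, code c))
  | Or b c => to_nat (5, to_nat (code b, code c))
  | All b => to_nat (6, code b)
  | Ex b => to_nat (7, code b)
  end.

Definition ce_theory (T : theory) : Prop :=
  ce_set (fun k => exists a, T a /\ code a = k).

(** * The arithmetical hierarchy *)

(** Bounded formulas.  The bounding term is shifted, so that the bound variable
    does not occur in it. *)
Inductive Delta0 : form -> Prop :=
| Delta0_eq s t : Delta0 (Eq s t)
| Delta0_lt s t : Delta0 (Lt s t)
| Delta0_bot : Delta0 Bot
| Delta0_imp a b : Delta0 a -> Delta0 b -> Delta0 (Imp a b)
| Delta0_and a b : Delta0 a -> Delta0 b -> Delta0 (And a b)
| Delta0_or a b : Delta0 a -> Delta0 b -> Delta0 (Or a b)
| Delta0_all t a :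
    Delta0 a -> Delta0 (All (Imp (Lt (Var 0) (shift_term t)) a))
| Delta0_ex t a :
    Delta0 a -> Delta0 (Ex (And (Lt (Var 0) (shift_term t)) a)).

(** [Sigma (S n)] formulas are a (possibly empty) block of existential
    quantifiers followed by a [Pi n] formula, and dually for [Pi (S n)]. *)
Inductive Sigma : nat -> form -> Prop :=
| Sigma_0 a : Delta0 a -> Sigma 0 a
| Sigma_Pi n a : Pi n a -> Sigma (S n) a
| Sigma_ex n a : Sigma (S n) a -> Sigma (S n) (Ex a)
with Pi : nat -> form -> Prop :=
| Pi_0 a : Delta0 a -> Pi 0 a
| Pi_Sigma n a : Sigma n a -> Pi (S n) a
| Pi_all n a : Pi (S n) a -> Pi (S n) (All a).

(** [BoolComb C] is the set of Boolean combinations of sentences of [C]. *)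
Inductive BoolComb (C : form -> Prop) : form -> Prop :=
| BC_base a : C a -> sentence a -> BoolComb C a
| BC_bot : BoolComb C Bot
| BC_imp a b : BoolComb C a -> BoolComb C b -> BoolComb C (Imp a b)
| BC_and a b : BoolComb C a -> BoolComb C b -> BoolComb C (And a b)
| BC_or a b : BoolComb C a -> BoolComb C b -> BoolComb C (Or a b).

Definition Delta (m : nat) (U : theory) (a : form) : Prop :=
  (exists s, Sigma m s /\ proves U (Iff a s)) /\
  (exists p, Pi m p /\ proves U (Iff a p)).

(** * Consistency and conservativity for a class of formulas *)

Definition consistent_over (C : form -> Prop) (T U : theory) : Prop :=
  ~ exists a, C a /\ bounded 1 a /\ proves U (Ex a) /\
      forall k, proves T (Neg (inst (numeral k) a)).

Definition conservative (C : form -> Prop) (T : theory) (a : form) : Prop :=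
  forall b, C b -> sentence b -> proves (add_axiom T a) b -> proves T b.

Definition DCons (C D : form -> Prop) (T : theory) (a : form) : Prop :=
  sentence a /\ conservative C T a /\ conservative D T (Neg a).

(* Main.v *)
(** All provability statements are reduced, by the completeness theorem, to truth in
    models of PA.

    (2) => (1): two existential quantifiers over a Pi_n formula are contracted to a common
    bound, and below a standard number there are only standard numbers.  (1) => (3): if
    [a] and [~ a] are over [U] the Sigma_(n+1) formulas [ex x, p x] and [ex x, q x], then
    [U] proves [ex x, p x \/ q x], while conservativity of [~ a] and [a] refutes [p k] and
    [q k] in [T] for every [k].

    (4) => (2): let [U] prove [ex x, p x] and let [T] refute all [p k].  Let [d] say that
    some [x] bounds a proof from [T] of an implication [d -> (s -> t)] with [s] true and
    [t] false, [s] and [t] being Sigma_n sentences, and that no smaller number satisfies [p]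
    or bounds such a proof for [~ d].  In [U] the race between the two sides must end, which
    makes [d] Delta_(n+1).  If [T + d] proves [s -> t] then in a model of [T] in which this
    fails, the standard proof makes [d] true unless a smaller, hence standard, number wins
    for the other side; that number cannot satisfy [p], and it cannot bound a proof from
    [~ d] either since [~ d] would be true; so [d] holds, which is absurd, and dually for
    [~ d].  Conservativity for implications between Sigma_n sentences gives
    conservativity for all Boolean combinations. *)
Require Import Defs.
From Stdlib Require Import List Arith Cantor Lia Ring.
From Stdlib Require Import Classical ClassicalEpsilon FunctionalExtensionality
  PropExtensionality ProofIrrelevance.
Import ListNotations.

Local Opaque to_nat of_nat.

(** The difficulty is to let [d] speak of proofs and truth in all models of PA without formalizing
    metamathematics inside PA. Provability from T is shown to be Sigma_1 over the standard numbers
    only. Its Delta0 matrix is then read in an arbitrary model, where absoluteness makes it correct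
    at standard arguments, while at nonstandard ones it may behave in any way. This suffices: U
    needs only that the race ends, which [p] guarantees whatever the matrix does, and conservativity
    is decided at standard stages. For the same reason a stage bounds not only the proof but also
    the indices of [s] and [t]. Truth of Sigma_n sentences is needed in every model, though only for
    standard indices; it comes from coded satisfaction tables for bounded formulas, with the
    unbounded quantifiers put in front. Implications s -> t are treated, rather than single Sigma_n
    sentences, because a Boolean combination of Sigma_n sentences amounts to a conjunction of such
    implications. *)

Lemma subst_term_subst_term sigma tau t :
  subst_term tau (subst_term sigma t) = subst_term (fun i => subst_term tau (sigma i)) t.
Proof. induction t; simpl; congruence. Qed.

Lemma up_comp sigma tau :
  (fun i => subst_term (up tau) (up sigma i)) = up (fun i => subst_term tau (sigma i)).
Proof.
  extensionality i; destruct i as [|i]; simpl; auto.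
  unfold shift_term; rewrite !subst_term_subst_term; reflexivity.
Qed.

Lemma subst_subst sigma tau a :
  subst tau (subst sigma a) = subst (fun i => subst_term tau (sigma i)) a.
Proof.
  revert sigma tau; induction a; intros; simpl; rewrite ?subst_term_subst_term, ?IHa1, ?IHa2;
    try reflexivity; rewrite IHa, up_comp; reflexivity.
Qed.

Lemma subst_term_Var t : subst_term Var t = t.
Proof. induction t; simpl; congruence. Qed.

Lemma up_Var : up Var = Var.
Proof. extensionality i; destruct i; reflexivity. Qed.

Lemma subst_Var a : subst Var a = a.
Proof. induction a; simpl; rewrite ?subst_term_Var, ?up_Var; congruence. Qed.

Definition tcons (t : term) (sigma : nat -> term) (i : nat) : term :=
  match i with 0 => t | S j => sigma j end.

Lemma inst_tcons t a : inst t a = subst (tcons t Var) a.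
Proof. reflexivity. Qed.

Lemma up_tcons t sigma :
  (fun i => subst_term (tcons t Var) (up sigma i)) = tcons t sigma.
Proof.
  extensionality i; destruct i as [|i]; simpl; auto.
  unfold shift_term; rewrite subst_term_subst_term; apply subst_term_Var.
Qed.

Lemma subst_inst sigma t a :
  subst sigma (inst t a) = inst (subst_term sigma t) (subst (up sigma) a).
Proof.
  rewrite !inst_tcons, !subst_subst, up_tcons; f_equal.
  extensionality i; destruct i; reflexivity.
Qed.

Lemma inst_subst_up t sigma a : inst t (subst (up sigma) a) = subst (tcons t sigma) a.
Proof. rewrite inst_tcons, subst_subst, up_tcons; reflexivity. Qed.

Lemma subst_up_shift sigma a : subst (up sigma) (shift a) = shift (subst sigma a).
Proof. unfold shift; rewrite !subst_subst; reflexivity. Qed.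

Lemma subst_term_bounded k sigma tau t :
  bounded_term k t -> (forall i, i < k -> sigma i = tau i) ->
  subst_term sigma t = subst_term tau t.
Proof. induction t; simpl; intros; f_equal; intuition. Qed.

Lemma subst_bounded a : forall k sigma tau,
  bounded k a -> (forall i, i < k -> sigma i = tau i) -> subst sigma a = subst tau a.
Proof.
  induction a; simpl; intros k sigma tau Hb H; auto;
    try (destruct Hb; f_equal; eauto using subst_term_bounded; fail);
    (f_equal; eapply IHa; [eauto|]; intros [|i] Hi; simpl; auto; rewrite H; auto; lia).
Qed.

Lemma bounded_term_mono k l t : bounded_term k t -> k <= l -> bounded_term l t.
Proof. induction t; simpl; intuition lia. Qed.

Lemma bounded_mono a : forall k l, bounded k a -> k <= l -> bounded l a.
Proof.
  induction a; simpl; intros k l H Hl;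
    try (destruct H; split; eauto using bounded_term_mono; fail); auto;
    eapply IHa; eauto; lia.
Qed.

Lemma bounded_term_subst k l sigma t :
  bounded_term k t -> (forall i, i < k -> bounded_term l (sigma i)) ->
  bounded_term l (subst_term sigma t).
Proof. induction t; simpl; intuition. Qed.

Lemma bounded_subst a : forall k l sigma,
  bounded k a -> (forall i, i < k -> bounded_term l (sigma i)) -> bounded l (subst sigma a).
Proof.
  induction a; simpl; intros k l sigma H Hs;
    try (destruct H; split; eauto using bounded_term_subst; fail); auto;
    (eapply IHa; [eauto|]; intros [|i] Hi; simpl; [lia|];
     eapply bounded_term_subst; [apply Hs; lia|]; simpl; lia).
Qed.

(** * Bounds on free variables and structural rules for derivations *)

Fixpoint bnd_term (t : term) : nat :=
  match t with
  | Var i => S i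
  | Zero => 0
  | Succ s => bnd_term s
  | Plus s1 s2 | Mult s1 s2 => bnd_term s1 + bnd_term s2
  end.

Fixpoint bnd (a : form) : nat :=
  match a with
  | Eq s t | Lt s t => bnd_term s + bnd_term t
  | Bot => 0
  | Imp b c | And b c | Or b c => bnd b + bnd c
  | All b | Ex b => bnd b
  end.

Lemma bounded_bnd_term t : bounded_term (bnd_term t) t.
Proof. induction t; simpl; auto; split; eapply bounded_term_mono; eauto; lia. Qed.

Lemma bounded_bnd a : bounded (bnd a) a.
Proof.
  induction a; simpl; auto;
    try (split; eapply bounded_term_mono; eauto using bounded_bnd_term; lia);
    try (split; eapply bounded_mono; eauto; lia); eapply bounded_mono; eauto.
Qed.

Lemma deriv_weak G a : deriv G a -> forall G', incl G G' -> deriv G' a.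
Proof.
  assert (Hc : forall (b : form) G G', incl G G' -> incl (b :: G) (b :: G')).
  { intros b G1 G2 H x [->|]; simpl; auto. }
  induction 1; intros G' HG.
  - apply D_ax; auto.
  - apply D_raa; auto.
  - apply D_imp_i; auto.
  - eapply D_imp_e; eauto.
  - apply D_and_i; auto.
  - eapply D_and_e1; eauto.
  - eapply D_and_e2; eauto.
  - apply D_or_i1; auto.
  - apply D_or_i2; auto.
  - eapply D_or_e; eauto.
  - apply D_all_i; apply IHderiv; apply incl_map; auto.
  - apply D_all_e; auto.
  - eapply D_ex_i; eauto.
  - eapply D_ex_e; eauto. apply IHderiv2. apply Hc, incl_map; auto.
  - apply D_eq_refl.
  - eapply D_eq_subst; eauto.
Qed.

(** Renaming the free variables of a derivation is what allows [witness_consistent] to turn a Henkin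
    witness into an eigenvariable. *)
Lemma deriv_subst G a : deriv G a -> forall sigma, deriv (map (subst sigma) G) (subst sigma a).
Proof.
  assert (Hm : forall sigma G,
            map (subst (up sigma)) (map shift G) = map shift (map (subst sigma) G)).
  { intros; rewrite !map_map; apply map_ext; intros; apply subst_up_shift. }
  induction 1; intros sigma; simpl in *.
  - apply D_ax, in_map; auto.
  - apply D_raa, IHderiv.
  - apply D_imp_i, IHderiv.
  - eapply D_imp_e; [apply IHderiv1|apply IHderiv2].
  - apply D_and_i; auto.
  - eapply D_and_e1; apply IHderiv.
  - eapply D_and_e2; apply IHderiv.
  - apply D_or_i1; auto.
  - apply D_or_i2; auto.
  - eapply D_or_e; [apply IHderiv1|apply IHderiv2|apply IHderiv3].
  - apply D_all_i; rewrite <- Hm; apply IHderiv.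
  - rewrite subst_inst; apply D_all_e, IHderiv.
  - eapply D_ex_i; rewrite <- subst_inst; apply IHderiv.
  - eapply D_ex_e; [apply IHderiv1|]. rewrite <- Hm, <- subst_up_shift; apply IHderiv2.
  - apply D_eq_refl.
  - rewrite subst_inst. eapply D_eq_subst; [apply IHderiv1|].
    rewrite <- subst_inst; apply IHderiv2.
Qed.

(** * Semantics *)

Record structure : Type := Structure {
  carrier :> Type;
  i0 : carrier;
  iS : carrier -> carrier;
  iadd : carrier -> carrier -> carrier;
  imul : carrier -> carrier -> carrier;
  ilt : carrier -> carrier -> Prop }.

Arguments i0 {_}. Arguments iS {_}. Arguments iadd {_}. Arguments imul {_}. Arguments ilt {_}.

Definition scons {X : Type} (x : X) (rho : nat -> X) (i : nat) : X :=
  match i with 0 => x | S j => rho j end.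

Fixpoint ev {M : structure} (rho : nat -> M) (t : term) : M :=
  match t with
  | Var i => rho i
  | Zero => i0
  | Succ s => iS (ev rho s)
  | Plus s1 s2 => iadd (ev rho s1) (ev rho s2)
  | Mult s1 s2 => imul (ev rho s1) (ev rho s2)
  end.

Fixpoint sat {M : structure} (rho : nat -> M) (a : form) : Prop :=
  match a with
  | Eq s t => ev rho s = ev rho t
  | Lt s t => ilt (ev rho s) (ev rho t)
  | Bot => False
  | Imp b c => sat rho b -> sat rho c
  | And b c => sat rho b /\ sat rho c
  | Or b c => sat rho b \/ sat rho c
  | All b => forall x, sat (scons x rho) b
  | Ex b => exists x, sat (scons x rho) b
  end.

Lemma ev_subst (M : structure) (rho : nat -> M) sigma t :
  ev rho (subst_term sigma t) = ev (fun i => ev rho (sigma i)) t.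
Proof. induction t; simpl; congruence. Qed.

Lemma ev_up (M : structure) (rho : nat -> M) sigma x :
  (fun i => ev (scons x rho) (up sigma i)) = scons x (fun i => ev rho (sigma i)).
Proof.
  extensionality i; destruct i; simpl; auto.
  unfold shift_term; rewrite ev_subst; reflexivity.
Qed.

Lemma sat_subst (M : structure) a : forall (rho : nat -> M) sigma,
  sat rho (subst sigma a) <-> sat (fun i => ev rho (sigma i)) a.
Proof.
  induction a; intros rho sigma; simpl; rewrite ?ev_subst; try tauto;
    rewrite ?IHa1, ?IHa2; try tauto.
  - split; intros H x; specialize (H x); rewrite IHa, ev_up in *; auto.
  - split; intros [x H]; exists x; rewrite IHa, ev_up in *; auto.
Qed.

Lemma sat_inst (M : structure) (rho : nat -> M) t a :
  sat rho (inst t a) <-> sat (scons (ev rho t) rho) a.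
Proof.
  rewrite inst_tcons, sat_subst.
  replace (fun i => ev rho (tcons t Var i)) with (scons (ev rho t) rho); [tauto|].
  extensionality i; destruct i; reflexivity.
Qed.

Lemma sat_shift (M : structure) (rho : nat -> M) x a :
  sat (scons x rho) (shift a) <-> sat rho a.
Proof. unfold shift; rewrite sat_subst; simpl. tauto. Qed.

Lemma ev_bounded (M : structure) (rho rho' : nat -> M) k t :
  bounded_term k t -> (forall i, i < k -> rho i = rho' i) -> ev rho t = ev rho' t.
Proof. induction t; simpl; intros; auto; f_equal; intuition. Qed.

Lemma sat_bounded (M : structure) a : forall k (rho rho' : nat -> M),
  bounded k a -> (forall i, i < k -> rho i = rho' i) -> sat rho a <-> sat rho' a.
Proof.
  induction a; simpl; intros k rho rho' Hb H;
    try (destruct Hb; erewrite (ev_bounded _ rho rho'), (ev_bounded _ rho rho' _ t); eauto; tauto);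
    try tauto;
    try (destruct Hb; rewrite (IHa1 k rho rho'), (IHa2 k rho rho'); auto; tauto).
  - assert (E : forall x, sat (scons x rho) a <-> sat (scons x rho') a).
    { intros x; eapply IHa; eauto; intros [|i] Hi; simpl; auto; apply H; lia. }
    split; intros Hx x; apply E, Hx.
  - assert (E : forall x, sat (scons x rho) a <-> sat (scons x rho') a).
    { intros x; eapply IHa; eauto; intros [|i] Hi; simpl; auto; apply H; lia. }
    split; intros [x Hx]; exists x; apply E, Hx.
Qed.

Lemma sat_sentence (M : structure) a (rho rho' : nat -> M) :
  sentence a -> sat rho a -> sat rho' a.
Proof. intros Ha; apply (sat_bounded M a 0); auto; intros; lia. Qed.

Lemma soundness (M : structure) G a :
  deriv G a -> forall rho : nat -> M, (forall b, In b G -> sat rho b) -> sat rho a.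
Proof.
  assert (Hsh : forall G (rho : nat -> M) x, (forall b, In b G -> sat rho b) ->
            forall b, In b (map shift G) -> sat (scons x rho) b).
  { intros G' rho x H b Hb; apply in_map_iff in Hb as (c & <- & Hc).
    apply sat_shift; auto. }
  assert (Hc : forall a G (rho : nat -> M), sat rho a -> (forall b, In b G -> sat rho b) ->
            forall b, In b (a :: G) -> sat rho b).
  { intros a' G' rho H1 H2 b [<-|]; auto. }
  induction 1; intros rho HG; simpl in *.
  - auto.
  - apply NNPP; intros Hn; apply (IHderiv rho); intros b [<-|Hb]; auto.
  - intros Ha; apply IHderiv; apply Hc; auto.
  - apply IHderiv1; auto.
  - split; auto.
  - apply (IHderiv rho HG).
  - apply (IHderiv rho HG).
  - left; auto.
  - right; auto.
  - destruct (IHderiv1 rho HG); [apply IHderiv2|apply IHderiv3]; apply Hc; auto.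
  - intros x; apply IHderiv; eauto.
  - apply sat_inst, IHderiv; auto.
  - exists (ev rho t); apply sat_inst, IHderiv; auto.
  - destruct (IHderiv1 rho HG) as [x Hx].
    apply (sat_shift M rho x), IHderiv2; apply Hc; eauto.
  - reflexivity.
  - apply sat_inst; rewrite <- IHderiv1; auto. apply sat_inst; auto.
Qed.

Definition models (M : structure) (T : theory) : Prop :=
  forall a, T a -> forall rho : nat -> M, sat rho a.

Lemma proves_sound T a (M : structure) :
  proves T a -> models M T -> forall rho : nat -> M, sat rho a.
Proof. intros (G & HG & Hd) HM rho; eapply soundness; eauto. Qed.

(** * Total decoding of Goedel numbers *)

Lemma to_nat_ge x y : x + y <= to_nat (x, y).
Proof. pose proof (to_nat_non_decreasing x y); lia. Qed.

(* Decoding is total and commutes with the constructors on all numbers, so that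
   arithmetized derivations need not check that their entries are codes. *)
Fixpoint dect_fuel (f n : nat) : term :=
  match f with
  | 0 => Zero
  | S f =>
    match of_nat n with
    | (0, i) => Var i
    | (2, s) => Succ (dect_fuel f s)
    | (3, p) => Plus (dect_fuel f (fst (of_nat p))) (dect_fuel f (snd (of_nat p)))
    | (4, p) => Mult (dect_fuel f (fst (of_nat p))) (dect_fuel f (snd (of_nat p)))
    | _ => Zero
    end
  end.

Definition dect (n : nat) : term := dect_fuel (S n) n.

Fixpoint dec_fuel (f n : nat) : form :=
  match f with
  | 0 => Bot
  | S f =>
    match of_nat n with
    | (0, p) => Eq (dect (fst (of_nat p))) (dect (snd (of_nat p)))
    | (1, p) => Lt (dect (fst (of_nat p))) (dect (snd (of_nat p)))
    | (3, p) => Imp (dec_fuel f (fst (of_nat p))) (dec_fuel f (snd (of_nat p)))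
    | (4, p) => And (dec_fuel f (fst (of_nat p))) (dec_fuel f (snd (of_nat p)))
    | (5, p) => Or (dec_fuel f (fst (of_nat p))) (dec_fuel f (snd (of_nat p)))
    | (6, b) => All (dec_fuel f b)
    | (7, b) => Ex (dec_fuel f b)
    | _ => Bot
    end
  end.

Definition dec (n : nat) : form := dec_fuel (S n) n.

Lemma of_nat_le n : fst (of_nat n) + snd (of_nat n) <= n.
Proof.
  destruct (of_nat n) as [x y] eqn:E; simpl.
  rewrite <- (cancel_to_of n), E; apply to_nat_ge.
Qed.

(** Recursive calls occur only under a tag that is at least 2, and a pair is at least the sum of its
    components, so the argument strictly decreases and any fuel above it suffices. *)
Lemma dect_fuel_irrel f : forall f' n, n < f -> n < f' -> dect_fuel f n = dect_fuel f' n.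
Proof.
  induction f as [|f IH]; intros [|f'] n H H'; try lia; simpl.
  pose proof (of_nat_le n) as L; destruct (of_nat n) as [x y]; simpl in L.
  pose proof (of_nat_le y) as L'.
  destruct x as [|[|[|[|[|x]]]]]; auto; f_equal; apply IH; lia.
Qed.

Lemma dec_fuel_irrel f : forall f' n, n < f -> n < f' -> dec_fuel f n = dec_fuel f' n.
Proof.
  induction f as [|f IH]; intros [|f'] n H H'; try lia; simpl.
  pose proof (of_nat_le n) as L; destruct (of_nat n) as [x y]; simpl in L.
  pose proof (of_nat_le y) as L'.
  destruct x as [|[|[|[|[|[|[|[|x]]]]]]]]; auto; f_equal; apply IH; lia.
Qed.

Lemma dect_unfold n : dect n =
  match of_nat n with
  | (0, i) => Var i
  | (2, s) => Succ (dect s)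
  | (3, p) => Plus (dect (fst (of_nat p))) (dect (snd (of_nat p)))
  | (4, p) => Mult (dect (fst (of_nat p))) (dect (snd (of_nat p)))
  | _ => Zero
  end.
Proof.
  unfold dect at 1; cbn [dect_fuel].
  pose proof (of_nat_le n) as L; destruct (of_nat n) as [x y]; simpl in L.
  pose proof (of_nat_le y) as L'.
  destruct x as [|[|[|[|[|x]]]]]; auto; f_equal; apply dect_fuel_irrel; lia.
Qed.

Lemma dec_unfold n : dec n =
  match of_nat n with
  | (0, p) => Eq (dect (fst (of_nat p))) (dect (snd (of_nat p)))
  | (1, p) => Lt (dect (fst (of_nat p))) (dect (snd (of_nat p)))
  | (3, p) => Imp (dec (fst (of_nat p))) (dec (snd (of_nat p)))
  | (4, p) => And (dec (fst (of_nat p))) (dec (snd (of_nat p)))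
  | (5, p) => Or (dec (fst (of_nat p))) (dec (snd (of_nat p)))
  | (6, b) => All (dec b)
  | (7, b) => Ex (dec b)
  | _ => Bot
  end.
Proof.
  unfold dec at 1; cbn [dec_fuel].
  pose proof (of_nat_le n) as L; destruct (of_nat n) as [x y]; simpl in L.
  pose proof (of_nat_le y) as L'.
  destruct x as [|[|[|[|[|[|[|[|x]]]]]]]]; auto; f_equal; apply dec_fuel_irrel; lia.
Qed.

Lemma dect_var i : dect (to_nat (0, i)) = Var i.
Proof. rewrite dect_unfold; rewrite !cancel_of_to; reflexivity. Qed.
Lemma dect_zero x : dect (to_nat (1, x)) = Zero.
Proof. rewrite dect_unfold; rewrite !cancel_of_to; reflexivity. Qed.
Lemma dect_succ s : dect (to_nat (2, s)) = Succ (dect s).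
Proof. rewrite dect_unfold; rewrite !cancel_of_to; reflexivity. Qed.
Lemma dect_plus s t : dect (to_nat (3, to_nat (s, t))) = Plus (dect s) (dect t).
Proof. rewrite dect_unfold; rewrite !cancel_of_to; reflexivity. Qed.
Lemma dect_mult s t : dect (to_nat (4, to_nat (s, t))) = Mult (dect s) (dect t).
Proof. rewrite dect_unfold; rewrite !cancel_of_to; reflexivity. Qed.
Lemma dec_eq s t : dec (to_nat (0, to_nat (s, t))) = Eq (dect s) (dect t).
Proof. rewrite dec_unfold; rewrite !cancel_of_to; reflexivity. Qed.
Lemma dec_lt s t : dec (to_nat (1, to_nat (s, t))) = Lt (dect s) (dect t).
Proof. rewrite dec_unfold; rewrite !cancel_of_to; reflexivity. Qed.
Lemma dec_bot x : dec (to_nat (2, x)) = Bot.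
Proof. rewrite dec_unfold; rewrite !cancel_of_to; reflexivity. Qed.
Lemma dec_imp a b : dec (to_nat (3, to_nat (a, b))) = Imp (dec a) (dec b).
Proof. rewrite dec_unfold; rewrite !cancel_of_to; reflexivity. Qed.
Lemma dec_and a b : dec (to_nat (4, to_nat (a, b))) = And (dec a) (dec b).
Proof. rewrite dec_unfold; rewrite !cancel_of_to; reflexivity. Qed.
Lemma dec_or a b : dec (to_nat (5, to_nat (a, b))) = Or (dec a) (dec b).
Proof. rewrite dec_unfold; rewrite !cancel_of_to; reflexivity. Qed.
Lemma dec_all a : dec (to_nat (6, a)) = All (dec a).
Proof. rewrite dec_unfold; rewrite !cancel_of_to; reflexivity. Qed.
Lemma dec_ex a : dec (to_nat (7, a)) = Ex (dec a).
Proof. rewrite dec_unfold; rewrite !cancel_of_to; reflexivity. Qed.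

Lemma dect_code t : dect (code_term t) = t.
Proof.
  induction t; simpl code_term;
    rewrite ?dect_var, ?dect_zero, ?dect_succ, ?dect_plus, ?dect_mult; congruence.
Qed.

Lemma dec_code a : dec (code a) = a.
Proof.
  induction a; simpl code;
    rewrite ?dec_eq, ?dec_lt, ?dec_bot, ?dec_imp, ?dec_and, ?dec_or, ?dec_all, ?dec_ex,
      ?dect_code; congruence.
Qed.

(** * Completeness *)

Lemma proves_ax (T : theory) a : T a -> proves T a.
Proof.
  intros H; exists [a]; split; [intros b [<-|[]]; auto|apply D_ax; left; auto].
Qed.

Lemma proves_mono (T T' : theory) a : (forall b, T b -> T' b) -> proves T a -> proves T' a.
Proof. intros H (G & HG & Hd); exists G; split; auto. Qed.

Lemma proves_imp_e T a b : proves T (Imp a b) -> proves T a -> proves T b.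
Proof.
  intros (G & HG & Hd) (G' & HG' & Hd'); exists (G ++ G'); split.
  - intros c Hc; apply in_app_or in Hc; intuition.
  - eapply D_imp_e; eapply deriv_weak; eauto using incl_appl, incl_appr, incl_refl.
Qed.

Lemma proves_deriv T G : forall a, deriv G a -> (forall b, In b G -> proves T b) -> proves T a.
Proof.
  induction G as [|b G IH]; intros a Hd H.
  - exists []; split; auto; intros c [].
  - apply (proves_imp_e T b); [apply IH; [apply D_imp_i; auto|]|]; intros; apply H; simpl; auto.
Qed.

Lemma proves_imp_i (T : theory) a b : proves (add_axiom T a) b -> proves T (Imp a b).
Proof.
  intros (G & HG & Hd).
  assert (H : exists G', (forall c, In c G' -> T c) /\ incl G (a :: G')).
  { clear Hd; induction G as [|c G IH].
    - exists []; split; [intros ? []|intros ? []].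
    - destruct IH as (G' & H1 & H2); [intros; apply HG; right; auto|].
      destruct (HG c) as [Hc | ->]; [left; auto| |].
      + exists (c :: G'); split.
        * intros d [<-|Hd]; auto.
        * intros d [<-|Hd]; [right; left; auto|].
          destruct (H2 d Hd) as [<-|]; [left|right; right]; auto.
      + exists G'; split; auto. intros d [<-|Hd]; [left; auto|apply H2; auto]. }
  destruct H as (G' & H1 & H2). exists G'; split; auto.
  apply D_imp_i. eapply deriv_weak; eauto.
Qed.

Lemma proves_raa (T : theory) a : ~ consistent (add_axiom T (Neg a)) -> proves T a.
Proof.
  intros H; apply NNPP in H; apply proves_imp_i in H.
  apply (proves_deriv T [Imp (Neg a) Bot]).
  - apply D_raa; eapply D_imp_e; apply D_ax; simpl; eauto.
  - intros b [<-|[]]; auto.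
Qed.

(* In the limit theory below, the variables themselves serve as Henkin constants. *)
Section Henkin.
Variables (T : theory) (L0 : list form).
Hypothesis HT : is_theory T.

Definition with_list (L : list form) : theory := fun a => T a \/ In a L.

Hypothesis Hcon0 : consistent (with_list L0).

Fixpoint bnd_list (L : list form) : nat :=
  match L with [] => 0 | a :: L => bnd a + bnd_list L end.

Lemma bnd_list_spec L a : In a L -> bounded (bnd_list L) a.
Proof.
  induction L as [|b L IH]; simpl; [tauto|]. intros [->|H].
  - apply bounded_mono with (bnd a); [apply bounded_bnd|lia].
  - apply bounded_mono with (bnd_list L); [auto|lia].
Qed.

Definition witness (a : form) (z : nat) : list form :=
  match a with Ex b => [inst (Var z) b] | _ => [] end.

Definition hstep (L : list form) (a : form) : list form :=
  if excluded_middle_informative (consistent (with_list (a :: L)))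
  then witness a (bnd_list (a :: L)) ++ a :: L else L.

Fixpoint hlist (n : nat) : list form :=
  match n with 0 => L0 | S n => hstep (hlist n) (dec n) end.

Definition Omega : theory := fun a => T a \/ exists n, In a (hlist n).

Lemma witness_consistent L b z :
  (forall a, In a L -> bounded z a) -> bounded z (Ex b) -> In (Ex b) L ->
  consistent (with_list L) -> consistent (with_list (inst (Var z) b :: L)).
Proof.
  intros HL Hb Hin Hc Hp; apply Hc.
  assert (Hp' : proves (with_list L) (Neg (inst (Var z) b))).
  { apply proves_imp_i; eapply proves_mono; [|exact Hp].
    intros c [Hc'|[<-|Hc']]; [left; left|right|left; right]; auto. }
  destruct Hp' as (G & HG & Hd).
  exists (Ex b :: G); split.
  { intros c [<-|Hc']; [right; auto|auto]. }
  apply D_ex_e with b; [apply D_ax; left; auto|].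
  pose (sigma := fun i => if Nat.eq_dec i z then Var 0 else Var (S i)).
  pose proof (deriv_subst _ _ Hd sigma) as Hs.
  assert (E : map (subst sigma) G = map shift G).
  { apply map_ext_in; intros c Hc'.
    assert (Hz : bounded z c).
    { destruct (HG c Hc'); auto. apply bounded_mono with 0; [apply HT; auto|lia]. }
    eapply subst_bounded; eauto. intros i Hi; unfold sigma; destruct Nat.eq_dec; [lia|auto]. }
  assert (Ez : sigma z = Var 0) by (unfold sigma; destruct Nat.eq_dec; [auto|lia]).
  rewrite E in Hs; simpl in Hs. rewrite subst_inst in Hs; simpl in Hs.
  rewrite Ez in Hs.
  rewrite inst_subst_up in Hs.
  replace (subst (tcons (Var 0) sigma) b) with b in Hs.
  - eapply D_imp_e; [eapply deriv_weak; [exact Hs|]|apply D_ax; left; auto].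
    intros c Hc'; right; simpl; auto.
  - rewrite <- (subst_Var b) at 1; eapply subst_bounded; [exact Hb|].
    intros [|i] Hi; simpl; auto. unfold sigma; destruct Nat.eq_dec; [lia|auto].
Qed.

Lemma hlist_consistent n : consistent (with_list (hlist n)).
Proof.
  induction n as [|n IH]; simpl; auto.
  unfold hstep; destruct excluded_middle_informative as [Hc|]; auto.
  destruct (dec n) as [| | | | | | |e]; simpl; auto.
  apply witness_consistent; [| |left; auto|exact Hc].
  - intros b Hb; apply (bnd_list_spec (Ex e :: hlist n)); auto.
  - apply (bnd_list_spec (Ex e :: hlist n)); left; auto.
Qed.

Lemma hlist_mono m n : m <= n -> incl (hlist m) (hlist n).
Proof.
  induction 1 as [|n H IH]; [apply incl_refl|]. eapply incl_tran; [exact IH|].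
  simpl; unfold hstep; destruct excluded_middle_informative; [|apply incl_refl].
  apply incl_appr, incl_tl, incl_refl.
Qed.

Lemma Omega_finite G : (forall b, In b G -> Omega b) ->
  exists n, forall m, n <= m -> forall b, In b G -> with_list (hlist m) b.
Proof.
  induction G as [|a G IH]; intros H; [exists 0; intros ? ? ? []|].
  destruct IH as [n Hn]; [intros; apply H; right; auto|].
  destruct (H a) as [Ha|[k Hk]]; [left; auto| |].
  - exists n; intros m Hm b [<-|Hb]; [left; auto|apply Hn; auto].
  - exists (n + k); intros m Hm b [<-|Hb]; [right; apply (hlist_mono k); auto; lia|].
    apply Hn; auto; lia.
Qed.

Lemma Omega_consistent : consistent Omega.
Proof.
  intros (G & HG & Hd). destruct (Omega_finite G HG) as [n Hn].
  apply (hlist_consistent n); exists G; split; auto.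
Qed.

(** Stage [code a] is the one that examines [a], since [dec] inverts [code]; consistency with the
    whole limit implies consistency with that stage. *)
Lemma Omega_max a : consistent (add_axiom Omega a) -> In a (hlist (S (code a))).
Proof.
  intros H; simpl; rewrite dec_code; unfold hstep.
  destruct excluded_middle_informative as [Hc|Hc].
  - apply in_or_app; right; left; auto.
  - exfalso; apply Hc; intros Hp; apply H; eapply proves_mono; [|exact Hp].
    intros b [Hb|[<-|Hb]]; [left; left|right|left; right]; eauto.
Qed.

Lemma Omega_closed a : proves Omega a -> Omega a.
Proof.
  intros H; right; exists (S (code a)); apply Omega_max; intros Hp.
  apply Omega_consistent. apply proves_imp_i in Hp. eapply proves_imp_e; eauto.
Qed.

Lemma Omega_deriv G a : deriv G a -> (forall b, In b G -> Omega b) -> Omega a.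
Proof. intros Hd H; apply Omega_closed; exists G; auto. Qed.

Lemma Omega_neg a : Omega (Neg a) <-> ~ Omega a.
Proof.
  split.
  - intros H1 H2; apply Omega_consistent; apply (proves_imp_e _ a); apply proves_ax; auto.
  - intros H; apply Omega_closed, proves_imp_i; apply NNPP; intros Hc; apply H.
    right; exists (S (code a)); apply Omega_max; auto.
Qed.

Lemma Omega_imp a b : Omega (Imp a b) <-> (Omega a -> Omega b).
Proof.
  split.
  - intros H1 H2; apply Omega_closed, (proves_imp_e _ a); apply proves_ax; auto.
  - intros H. destruct (classic (Omega a)) as [Ha|Ha].
    + apply (Omega_deriv [b]).
      * apply D_imp_i, D_ax; right; left; auto.
      * intros c [<-|[]]; auto.
    + apply Omega_neg in Ha. apply (Omega_deriv [Neg a]).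
      * apply D_imp_i, D_raa; apply D_imp_e with a; apply D_ax; simpl; tauto.
      * intros c [<-|[]]; auto.
Qed.

Lemma Omega_and a b : Omega (And a b) <-> Omega a /\ Omega b.
Proof.
  split.
  - intros H; split; apply (Omega_deriv [And a b]);
      try (intros c [<-|[]]; auto; fail);
      [eapply D_and_e1|eapply D_and_e2]; apply D_ax; left; eauto.
  - intros [H1 H2]; apply (Omega_deriv [a; b]).
    + apply D_and_i; apply D_ax; simpl; auto.
    + intros c [<-|[<-|[]]]; auto.
Qed.

Lemma Omega_or a b : Omega (Or a b) <-> Omega a \/ Omega b.
Proof.
  split.
  - intros H; apply NNPP; intros Hn.
    assert (Ha : Omega (Neg a)) by (apply Omega_neg; tauto).
    assert (Hb : Omega (Neg b)) by (apply Omega_neg; tauto).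
    apply Omega_consistent; exists [Or a b; Neg a; Neg b]; split.
    + intros c [<-|[<-|[<-|[]]]]; auto.
    + eapply D_or_e; [apply D_ax; left; eauto|..];
        [apply D_imp_e with a|apply D_imp_e with b]; apply D_ax; simpl; tauto.
  - intros [H|H]; [apply (Omega_deriv [a])|apply (Omega_deriv [b])];
      try (intros c [<-|[]]; auto; fail);
      [apply D_or_i1|apply D_or_i2]; apply D_ax; left; auto.
Qed.

Lemma Omega_ex b : Omega (Ex b) <-> exists t, Omega (inst t b).
Proof.
  split.
  - intros H. pose (n := code (Ex b)).
    assert (Hc : consistent (with_list (Ex b :: hlist n))).
    { intros (G & HG & Hd); apply Omega_consistent; exists G; split; auto.
      intros c Hc; destruct (HG c Hc) as [|[<-|]]; [left|exact H|right]; eauto. }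
    exists (Var (bnd_list (Ex b :: hlist n))). right; exists (S n); simpl.
    unfold n in *; rewrite dec_code; unfold hstep.
    destruct excluded_middle_informative; [left; auto|tauto].
  - intros [t H]; apply (Omega_deriv [inst t b]); [|intros c [<-|[]]; auto].
    apply D_ex_i with t, D_ax; left; auto.
Qed.

Lemma Omega_all b : Omega (All b) <-> forall t, Omega (inst t b).
Proof.
  split.
  - intros H t; apply (Omega_deriv [All b]); [|intros c [<-|[]]; auto].
    apply D_all_e, D_ax; left; auto.
  - intros H. apply NNPP; intros Hn.
    (* A failing universal formula is passed to the existential case, where the construction has
       supplied a witness. *)
    assert (He : Omega (Ex (Neg b))).
    { apply Omega_neg in Hn; apply (Omega_deriv [Neg (All b)]); [|intros c [<-|[]]; auto].
      apply D_raa. eapply D_imp_e; [apply D_ax; right; left; reflexivity|].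
      apply D_all_i, D_raa; simpl. eapply D_imp_e.
      - apply D_ax; right; left; reflexivity.
      - apply D_ex_i with (Var 0). apply D_ax; left.
        rewrite inst_subst_up; unfold Neg; simpl; f_equal.
        rewrite <- (subst_Var b) at 1. f_equal; extensionality i; destruct i; reflexivity. }
    apply Omega_ex in He as [t Ht]. change (Omega (Neg (inst t b))) in Ht.
    apply Omega_neg in Ht; auto.
Qed.

(** * Provable equality and the term model *)

Lemma Omega_refl t : Omega (Eq t t).
Proof. apply (Omega_deriv []); [apply D_eq_refl|intros c []]. Qed.

Lemma Omega_rewrite s t a : Omega (Eq s t) -> Omega (inst s a) -> Omega (inst t a).
Proof.
  intros H1 H2; apply (Omega_deriv [Eq s t; inst s a]); [|intros c [<-|[<-|[]]]; auto].
  eapply D_eq_subst; apply D_ax; simpl; eauto.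
Qed.

Lemma inst_shift_term t u : subst_term (tcons t Var) (shift_term u) = u.
Proof. unfold shift_term; rewrite subst_term_subst_term; apply subst_term_Var. Qed.

Lemma Omega_sym s t : Omega (Eq s t) -> Omega (Eq t s).
Proof.
  intros H. pose proof (Omega_rewrite s t (Eq (Var 0) (shift_term s)) H) as H'.
  rewrite !inst_tcons in H'; simpl in H'; rewrite !inst_shift_term in H'.
  apply H', Omega_refl.
Qed.

Lemma Omega_trans s t u : Omega (Eq s t) -> Omega (Eq t u) -> Omega (Eq s u).
Proof.
  intros H1 H2. pose proof (Omega_rewrite t u (Eq (shift_term s) (Var 0)) H2) as H'.
  rewrite !inst_tcons in H'; simpl in H'; rewrite !inst_shift_term in H'; auto.
Qed.

(** A canonical choice in each class of provably equal terms: by extensionality equivalent terms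
    give the same predicate to [epsilon], hence the same value. The quotient becomes a subtype of
    the terms. *)
Definition rep (t : term) : term := epsilon (inhabits Zero) (fun s => Omega (Eq t s)).

Lemma rep_spec t : Omega (Eq t (rep t)).
Proof. unfold rep; apply epsilon_spec; exists t; apply Omega_refl. Qed.

Lemma rep_eq s t : Omega (Eq s t) <-> rep s = rep t.
Proof.
  split.
  - intros H; unfold rep; f_equal; extensionality u; apply propositional_extensionality.
    split; eauto using Omega_trans, Omega_sym.
  - intros H; eapply Omega_trans; [apply rep_spec|]; rewrite H; apply Omega_sym, rep_spec.
Qed.

Definition mk (t : term) : {t : term | rep t = t} :=
  exist _ (rep t) (proj1 (rep_eq _ _) (Omega_sym _ _ (rep_spec t))).

Lemma mk_eq s t : mk s = mk t <-> Omega (Eq s t).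
Proof.
  rewrite rep_eq; split; [apply (f_equal (@proj1_sig _ _))|].
  intros H; apply subset_eq_compat; auto.
Qed.

Lemma mk_val x : mk (proj1_sig x) = x.
Proof. destruct x as [t Ht]; apply subset_eq_compat; exact Ht. Qed.

Definition term_model : structure :=
  {| carrier := {t : term | rep t = t};
     i0 := mk Zero;
     iS := fun x => mk (Succ (proj1_sig x));
     iadd := fun x y => mk (Plus (proj1_sig x) (proj1_sig y));
     imul := fun x y => mk (Mult (proj1_sig x) (proj1_sig y));
     ilt := fun x y => Omega (Lt (proj1_sig x) (proj1_sig y)) |}.

Lemma Omega_cong s t (f : term -> term) :
  (forall u, subst_term (tcons u Var) (f (Var 0)) = f u) ->
  subst_term (tcons t Var) (shift_term (f s)) = f s ->
  Omega (Eq s t) -> Omega (Eq (f s) (f t)).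
Proof.
  intros Hf Hs H. pose proof (Omega_rewrite s t (Eq (shift_term (f s)) (f (Var 0))) H) as H'.
  rewrite !inst_tcons in H'; simpl in H'; rewrite !inst_shift_term, !Hf in H'.
  apply H', Omega_refl.
Qed.

Lemma val_mk t : Omega (Eq (proj1_sig (mk t)) t).
Proof. apply Omega_sym, rep_spec. Qed.

Lemma ev_term_model (sigma : nat -> term) t :
  ev (M := term_model) (fun i => mk (sigma i)) t = mk (subst_term sigma t).
Proof.
  induction t; simpl; auto.
  - rewrite IHt; apply mk_eq.
    apply (Omega_cong _ _ Succ); auto using val_mk, inst_shift_term.
  - rewrite IHt1, IHt2; apply mk_eq.
    set (a := subst_term sigma t1); set (b := subst_term sigma t2).
    apply Omega_trans with (Plus a (proj1_sig (mk b))).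
    + pose proof (Omega_rewrite _ _ (Eq (shift_term (Plus (proj1_sig (mk a)) (proj1_sig (mk b))))
        (Plus (Var 0) (shift_term (proj1_sig (mk b))))) (val_mk a)) as H.
      rewrite !inst_tcons in H; simpl in H; rewrite !inst_shift_term in H; apply H, Omega_refl.
    + pose proof (Omega_rewrite _ _ (Eq (shift_term (Plus a (proj1_sig (mk b))))
        (Plus (shift_term a) (Var 0))) (val_mk b)) as H.
      rewrite !inst_tcons in H; simpl in H; rewrite !inst_shift_term in H; apply H, Omega_refl.
  - rewrite IHt1, IHt2; apply mk_eq.
    set (a := subst_term sigma t1); set (b := subst_term sigma t2).
    apply Omega_trans with (Mult a (proj1_sig (mk b))).
    + pose proof (Omega_rewrite _ _ (Eq (shift_term (Mult (proj1_sig (mk a)) (proj1_sig (mk b))))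
        (Mult (Var 0) (shift_term (proj1_sig (mk b))))) (val_mk a)) as H.
      rewrite !inst_tcons in H; simpl in H; rewrite !inst_shift_term in H; apply H, Omega_refl.
    + pose proof (Omega_rewrite _ _ (Eq (shift_term (Mult a (proj1_sig (mk b))))
        (Mult (shift_term a) (Var 0))) (val_mk b)) as H.
      rewrite !inst_tcons in H; simpl in H; rewrite !inst_shift_term in H; apply H, Omega_refl.
Qed.

Lemma Omega_lt_mk s t :
  Omega (Lt (proj1_sig (mk s)) (proj1_sig (mk t))) <-> Omega (Lt s t).
Proof.
  assert (H : forall a b c d, Omega (Eq a b) -> Omega (Eq c d) -> Omega (Lt a c) -> Omega (Lt b d)).
  { intros a b c d H1 H2 H3.
    pose proof (Omega_rewrite _ _ (Lt (Var 0) (shift_term c)) H1) as H.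
    rewrite !inst_tcons in H; simpl in H; rewrite !inst_shift_term in H; specialize (H H3).
    pose proof (Omega_rewrite _ _ (Lt (shift_term b) (Var 0)) H2) as H'.
    rewrite !inst_tcons in H'; simpl in H'; rewrite !inst_shift_term in H'; auto. }
  split; apply H; auto using val_mk, Omega_sym.
Qed.

Lemma truth_lemma a : forall sigma : nat -> term,
  sat (M := term_model) (fun i => mk (sigma i)) a <-> Omega (subst sigma a).
Proof.
  assert (Hs : forall t sigma, scons (mk t) (fun i => mk (sigma i)) = (fun i => mk (tcons t sigma i))).
  { intros; extensionality i; destruct i; reflexivity. }
  induction a; intros sigma; simpl; rewrite ?ev_term_model.
  - apply mk_eq.
  - apply Omega_lt_mk.
  - split; [tauto|]. intros H; apply Omega_consistent, proves_ax; auto.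
  - rewrite Omega_imp, IHa1, IHa2; tauto.
  - rewrite Omega_and, IHa1, IHa2; tauto.
  - rewrite Omega_or, IHa1, IHa2; tauto.
  - rewrite Omega_all; split.
    + intros H t. rewrite inst_subst_up. apply IHa. rewrite <- Hs; apply H.
    + intros H x. rewrite <- (mk_val x), Hs. apply IHa. rewrite <- inst_subst_up; apply H.
  - rewrite Omega_ex; split.
    + intros [x H]; exists (proj1_sig x). rewrite inst_subst_up; apply IHa.
      rewrite <- Hs, mk_val; auto.
    + intros [t H]; exists (mk t). rewrite Hs; apply IHa; rewrite <- inst_subst_up; auto.
Qed.

Lemma term_model_spec :
  models term_model T /\ forall a, In a L0 -> sat (M := term_model) (fun i => mk (Var i)) a.
Proof.
  split.
  - intros a Ha rho. apply sat_sentence with (rho := fun i => mk (Var i)); [apply HT; auto|].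
    apply truth_lemma; rewrite subst_Var; left; auto.
  - intros a Ha; apply truth_lemma; rewrite subst_Var; right; exists 0; auto.
Qed.

End Henkin.

Theorem completeness (T : theory) (HT : is_theory T) a :
  (forall (M : structure), models M T -> forall rho : nat -> M, sat rho a) -> proves T a.
Proof.
  intros H; apply proves_raa; intros Hc.
  assert (Hc' : consistent (with_list T [Neg a])).
  { intros (G & HG & Hd); apply Hc; exists G; split; auto.
    intros b Hb; destruct (HG b Hb) as [|[<-|[]]]; [left|right]; auto. }
  destruct (term_model_spec T [Neg a] HT Hc') as [H1 H2].
  apply (H2 (Neg a)); [left; auto|]. apply H; auto.
Qed.

Record model : Type := Model { str :> structure; str_PA : models str PA }.

(** * Relations that are definable uniformly in all models of PA *)

Definition rel : Type := forall M : model, (nat -> M) -> Prop.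

Definition Tm (f : forall M : model, (nat -> M) -> M) : Prop :=
  exists t, forall (M : model) (rho : nat -> M), f M rho = ev rho t.

(** The formula is chosen before the model. Closure lemmas for such relations replace the writing of
    formulas: each yields one formula with the intended meaning in every model of PA. *)
Definition Def (R : rel) : Prop :=
  exists a, forall (M : model) (rho : nat -> M), R M rho <-> sat rho a.

Definition D0 (R : rel) : Prop :=
  exists a, Delta0 a /\ forall (M : model) (rho : nat -> M), R M rho <-> sat rho a.

Lemma Tm_var i : Tm (fun M rho => rho i).
Proof. exists (Var i); reflexivity. Qed.
Lemma Tm_zero : Tm (fun M rho => i0).
Proof. exists Zero; reflexivity. Qed.
Lemma Tm_succ f : Tm f -> Tm (fun M rho => iS (f M rho)).
Proof. intros [t H]; exists (Succ t); intros; simpl; rewrite H; auto. Qed.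
Lemma Tm_add f g : Tm f -> Tm g -> Tm (fun M rho => iadd (f M rho) (g M rho)).
Proof. intros [t H] [s H']; exists (Plus t s); intros; simpl; rewrite H, H'; auto. Qed.
Lemma Tm_mul f g : Tm f -> Tm g -> Tm (fun M rho => imul (f M rho) (g M rho)).
Proof. intros [t H] [s H']; exists (Mult t s); intros; simpl; rewrite H, H'; auto. Qed.

Lemma Tm_shift f : Tm f -> Tm (fun M rho => f M (fun i => rho (S i))).
Proof.
  intros [t H]; exists (shift_term t); intros; rewrite H.
  unfold shift_term; rewrite ev_subst; reflexivity.
Qed.

Lemma subst_up_shift_term sigma t :
  subst_term (up sigma) (shift_term t) = shift_term (subst_term sigma t).
Proof. unfold shift_term; rewrite !subst_term_subst_term; reflexivity. Qed.

Lemma Delta0_subst a : Delta0 a -> forall sigma, Delta0 (subst sigma a).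
Proof.
  induction 1; intros sigma; simpl; rewrite ?subst_up_shift_term; constructor; auto.
Qed.

(** Choice collects infinitely many terms into one simultaneous substitution. *)
Lemma Tm_choice (F : nat -> forall M : model, (nat -> M) -> M) :
  (forall i, Tm (F i)) ->
  exists sigma, forall (M : model) (rho : nat -> M) i, F i M rho = ev rho (sigma i).
Proof.
  intros H. exists (fun i => proj1_sig (constructive_indefinite_description _ (H i))).
  intros M rho i; destruct constructive_indefinite_description as [t Ht]; simpl; auto.
Qed.

Lemma Def_comp R (F : nat -> forall M : model, (nat -> M) -> M) :
  Def R -> (forall i, Tm (F i)) -> Def (fun M rho => R M (fun i => F i M rho)).
Proof.
  intros [a Ha] H; destruct (Tm_choice F H) as [sigma Hs].
  exists (subst sigma a); intros M rho; rewrite sat_subst, Ha.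
  replace (fun i => F i M rho) with (fun i => ev rho (sigma i)); [tauto|].
  extensionality i; auto.
Qed.

Lemma D0_comp R (F : nat -> forall M : model, (nat -> M) -> M) :
  D0 R -> (forall i, Tm (F i)) -> D0 (fun M rho => R M (fun i => F i M rho)).
Proof.
  intros (a & Ha & Hr) H; destruct (Tm_choice F H) as [sigma Hs].
  exists (subst sigma a); split; [apply Delta0_subst; auto|].
  intros M rho; rewrite sat_subst, Hr.
  replace (fun i => F i M rho) with (fun i => ev rho (sigma i)); [tauto|].
  extensionality i; auto.
Qed.

Lemma Def_iff R R' :
  (forall M rho, R M rho <-> R' M rho) -> Def R -> Def R'.
Proof. intros H [a Ha]; exists a; intros; rewrite <- H; auto. Qed.

Lemma D0_iff R R' :
  (forall M rho, R M rho <-> R' M rho) -> D0 R -> D0 R'.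
Proof. intros H (a & Ha & H'); exists a; split; auto; intros; rewrite <- H; auto. Qed.

Lemma D0_Def R : D0 R -> Def R.
Proof. intros (a & _ & H); exists a; auto. Qed.

Lemma D0_eq f g : Tm f -> Tm g -> D0 (fun M rho => f M rho = g M rho).
Proof.
  intros [t H] [s H']; exists (Eq t s); split; [constructor|].
  intros; rewrite H, H'; simpl; tauto.
Qed.
Lemma D0_lt f g : Tm f -> Tm g -> D0 (fun M rho => ilt (f M rho) (g M rho)).
Proof.
  intros [t H] [s H']; exists (Lt t s); split; [constructor|].
  intros; rewrite H, H'; simpl; tauto.
Qed.
Lemma D0_False : D0 (fun M rho => False).
Proof. exists Bot; split; [constructor|simpl; tauto]. Qed.
Lemma D0_imp P Q : D0 P -> D0 Q -> D0 (fun M rho => P M rho -> Q M rho).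
Proof.
  intros (a & Ha & H) (b & Hb & H'); exists (Imp a b); split; [constructor; auto|].
  intros; rewrite H, H'; simpl; tauto.
Qed.
Lemma D0_and P Q : D0 P -> D0 Q -> D0 (fun M rho => P M rho /\ Q M rho).
Proof.
  intros (a & Ha & H) (b & Hb & H'); exists (And a b); split; [constructor; auto|].
  intros; rewrite H, H'; simpl; tauto.
Qed.
Lemma D0_or P Q : D0 P -> D0 Q -> D0 (fun M rho => P M rho \/ Q M rho).
Proof.
  intros (a & Ha & H) (b & Hb & H'); exists (Or a b); split; [constructor; auto|].
  intros; rewrite H, H'; simpl; tauto.
Qed.
Lemma D0_not P : D0 P -> D0 (fun M rho => ~ P M rho).
Proof. intros H; apply D0_imp; auto using D0_False. Qed.
Lemma D0_iff2 P Q : D0 P -> D0 Q -> D0 (fun M rho => P M rho <-> Q M rho).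
Proof. intros; apply D0_and; apply D0_imp; auto. Qed.
(** Passing the bound element separately from the environment lets unification find [P] when the
    lemma is applied to a concrete relation. *)
Lemma D0_ball (f : forall M : model, (nat -> M) -> M) (P : forall M : model, M -> (nat -> M) -> Prop) :
  Tm f -> D0 (fun M rho => P M (rho 0) (fun i => rho (S i))) ->
  D0 (fun M rho => forall x, ilt x (f M rho) -> P M x rho).
Proof.
  intros [t Ht] (a & Ha & H).
  exists (All (Imp (Lt (Var 0) (shift_term t)) a)); split; [constructor; auto|].
  intros M rho; simpl.
  assert (E : forall x, P M x rho <-> sat (scons x rho) a).
  { intros x; rewrite <- H; simpl; tauto. }
  assert (E' : forall x, ev (scons x rho) (shift_term t) = f M rho).
  { intros x; rewrite Ht; unfold shift_term; rewrite ev_subst; reflexivity. }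
  split; intros Hx x; specialize (Hx x); rewrite E, E' in *; auto.
Qed.
Lemma D0_bex (f : forall M : model, (nat -> M) -> M) (P : forall M : model, M -> (nat -> M) -> Prop) :
  Tm f -> D0 (fun M rho => P M (rho 0) (fun i => rho (S i))) ->
  D0 (fun M rho => exists x, ilt x (f M rho) /\ P M x rho).
Proof.
  intros [t Ht] (a & Ha & H).
  exists (Ex (And (Lt (Var 0) (shift_term t)) a)); split; [constructor; auto|].
  intros M rho; simpl.
  assert (E : forall x, P M x rho <-> sat (scons x rho) a).
  { intros x; rewrite <- H; simpl; tauto. }
  assert (E' : forall x, ev (scons x rho) (shift_term t) = f M rho).
  { intros x; rewrite Ht; unfold shift_term; rewrite ev_subst; reflexivity. }
  split; intros [x Hx]; exists x; rewrite E, E' in *; auto.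
Qed.

Lemma Def_imp P Q : Def P -> Def Q -> Def (fun M rho => P M rho -> Q M rho).
Proof. intros (a & H) (b & H'); exists (Imp a b); intros; rewrite H, H'; simpl; tauto. Qed.
Lemma Def_and P Q : Def P -> Def Q -> Def (fun M rho => P M rho /\ Q M rho).
Proof. intros (a & H) (b & H'); exists (And a b); intros; rewrite H, H'; simpl; tauto. Qed.
Lemma Def_or P Q : Def P -> Def Q -> Def (fun M rho => P M rho \/ Q M rho).
Proof. intros (a & H) (b & H'); exists (Or a b); intros; rewrite H, H'; simpl; tauto. Qed.
Lemma Def_False : Def (fun M rho => False).
Proof. exists Bot; simpl; tauto. Qed.
Lemma Def_not P : Def P -> Def (fun M rho => ~ P M rho).
Proof. intros H; apply Def_imp; auto using Def_False. Qed.
Lemma Def_iff2 P Q : Def P -> Def Q -> Def (fun M rho => P M rho <-> Q M rho).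
Proof. intros; apply Def_and; apply Def_imp; auto. Qed.
Lemma Def_all (P : forall M : model, M -> (nat -> M) -> Prop) :
  Def (fun M rho => P M (rho 0) (fun i => rho (S i))) -> Def (fun M rho => forall x, P M x rho).
Proof.
  intros (a & H); exists (All a); intros M rho; simpl.
  split; intros Hx x; specialize (Hx x); [rewrite <- H|rewrite <- H in Hx]; auto.
Qed.
Lemma Def_ex (P : forall M : model, M -> (nat -> M) -> Prop) :
  Def (fun M rho => P M (rho 0) (fun i => rho (S i))) -> Def (fun M rho => exists x, P M x rho).
Proof.
  intros (a & H); exists (Ex a); intros M rho; simpl.
  split; intros [x Hx]; exists x; [rewrite <- H|rewrite <- H in Hx]; auto.
Qed.
Lemma Def_app1 D f (g : nat -> nat) :
  Def D -> Tm f -> Def (fun M rho => D M (scons (f M rho) (fun i => rho (g i)))).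
Proof.
  intros HD Hf.
  apply (Def_iff (fun M rho => D M (fun i => match i with 0 => f M rho | S j => rho (g j) end))).
  - intros; replace (scons (f M rho) (fun i => rho (g i))) with
      (fun i => match i with 0 => f M rho | S j => rho (g j) end); [tauto|].
    extensionality i; destruct i; auto.
  - apply (Def_comp D (fun i M rho => match i with 0 => f M rho | S j => rho (g j) end)); auto.
    intros [|i]; auto using Tm_var.
Qed.
Lemma D0_app2 (Q : forall M : model, M -> M -> Prop) f g :
  D0 (fun M rho => Q M (rho 0) (rho 1)) -> Tm f -> Tm g ->
  D0 (fun M rho => Q M (f M rho) (g M rho)).
Proof.
  intros HQ Hf Hg.
  apply (D0_comp (fun M rho => Q M (rho 0) (rho 1)) (fun i => match i with 0 => f | _ => g end) HQ).
  intros [|]; auto.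
Qed.
Ltac tm_hook := fail.
Ltac tm := cbn beta; first
  [ assumption | apply Tm_var | apply Tm_zero | apply Tm_succ; tm | apply Tm_add; tm
  | apply Tm_mul; tm | tm_hook ].
Ltac d0_hook := fail.
Ltac d0 := cbn beta; first
  [ assumption | apply D0_False | apply D0_eq; tm | apply D0_lt; tm
  | apply D0_ball; [tm | d0] | apply D0_bex; [tm | d0]
  | apply D0_and; d0 | apply D0_or; d0 | apply D0_not; d0 | apply D0_iff2; d0
  | d0_hook | apply D0_imp; d0 ].
Ltac def_hook := fail.
Ltac def := cbn beta; first
  [ assumption | apply Def_and; def | apply Def_or; def | apply Def_not; def
  | apply Def_iff2; def | apply Def_ex; def
  | apply D0_Def; d0 | def_hook
  | apply Def_app1; [assumption | tm]
  | apply Def_imp; def | apply Def_all; def ].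

(** * Arithmetic in a model of PA *)

Declare Scope M_scope.
Delimit Scope M_scope with M.
Notation "x + y" := (iadd x y) : M_scope.
Notation "x * y" := (imul x y) : M_scope.
Notation "x < y" := (ilt x y) : M_scope.
Definition ione {M : structure} : M := iS i0.
Definition ile {M : structure} (x y : M) : Prop := ilt x (iS y).
Notation "x <= y" := (ile x y) : M_scope.

(** A polynomial without the halving in Cantor's pairing, so that pairs are values of terms of the
    language. With s = x + y it lies between s^2 and (s + 1)^2, which makes it injective;
    surjectivity is given up. *)
Definition pair {M : structure} (x y : M) : M := iadd (imul (iadd x y) (iadd x y)) x.

Lemma Tm_pair f g : Tm f -> Tm g -> Tm (fun M rho => pair (f M rho) (g M rho)).
Proof. intros; unfold pair; tm. Qed.
Lemma D0_le f g : Tm f -> Tm g -> D0 (fun M rho => ile (f M rho) (g M rho)).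
Proof. intros; unfold ile; d0. Qed.
Ltac tm_hook ::= apply Tm_pair; tm.
Ltac d0_hook ::= first [apply D0_le; tm].

Definition nenv {M : structure} (l : list M) : nat -> M := fun i => nth i l i0.
Arguments nenv {M} l i /.

Section Arith.
Variable M : model.
Implicit Types x y z u v w b c : M.
Local Open Scope M_scope.

Lemma ax a : PA a -> forall rho : nat -> M, sat rho a.
Proof. intros H rho; apply str_PA; auto. Qed.

Lemma S_neq_0 x : iS x <> i0.
Proof. apply (ax _ PA_succ_0 (fun _ => x) x). Qed.
Lemma S_inj x y : iS x = iS y -> x = y.
Proof. apply (ax _ PA_succ_inj (fun _ => x) x y). Qed.
Lemma add_0_r x : x + i0 = x.
Proof. apply (ax _ PA_plus_0 (fun _ => x) x). Qed.
Lemma add_S_r x y : x + iS y = iS (x + y).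
Proof. apply (ax _ PA_plus_succ (fun _ => x) x y). Qed.
Lemma mul_0_r x : x * i0 = i0.
Proof. apply (ax _ PA_mult_0 (fun _ => x) x). Qed.
Lemma mul_S_r x y : x * iS y = x * y + x.
Proof. apply (ax _ PA_mult_succ (fun _ => x) x y). Qed.
Lemma lt_def x y : x < y <-> exists z, x + iS z = y.
Proof. apply (ax _ PA_lt (fun _ => x) x y). Qed.

Lemma sat_iter_All (N : structure) k : forall a, (forall rho : nat -> N, sat rho (Nat.iter k All a)) ->
  forall rho : nat -> N, sat rho a.
Proof.
  induction k as [|k IH]; simpl; intros a H; auto.
  apply IH; intros rho. specialize (H (fun i => rho (S i)) (rho 0)).
  replace rho with (scons (rho 0) (fun i => rho (S i))); auto.
  extensionality i; destruct i; auto.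
Qed.

Lemma bounded_iter_All k : forall j a, bounded (k + j) a -> bounded j (Nat.iter k All a).
Proof.
  induction k as [|k IH]; simpl; intros j a H; auto.
  apply IH; replace (k + S j)%nat with (S (k + j)) by lia; auto.
Qed.

Lemma induction_sat a (rho : nat -> M) :
  sat (scons i0 rho) a -> (forall x, sat (scons x rho) a -> sat (scons (iS x) rho) a) ->
  forall x, sat (scons x rho) a.
Proof.
  intros H0 HS.
  assert (H : sat rho (induction a)).
  { apply (sat_iter_All M (bnd (induction a))). intros; apply ax, PA_induction.
    apply bounded_iter_All. rewrite Nat.add_0_r; apply bounded_bnd. }
  simpl in H. apply H.
  - apply sat_inst; auto.
  - intros x Hx; apply sat_subst.
    replace (fun i => _) with (scons (iS x) rho); auto.
    extensionality i; destruct i; auto.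
Qed.

Lemma ind_def (R : rel) : Def R -> forall rho : nat -> M,
  R M (scons i0 rho) -> (forall x, R M (scons x rho) -> R M (scons (iS x) rho)) ->
  forall x, R M (scons x rho).
Proof.
  intros [a Ha] rho H0 HS x; apply Ha; apply induction_sat; [apply Ha; auto|].
  intros y; rewrite <- !Ha; auto.
Qed.

Lemma add_0_l x : i0 + x = x.
Proof.
  apply (ind_def (fun M rho => i0 + rho 0 = rho 0)%M ltac:(def) (nenv [])); simpl.
  - apply add_0_r.
  - intros y H; rewrite add_S_r, H; auto.
Qed.
Lemma add_S_l x y : iS x + y = iS (x + y).
Proof.
  apply (ind_def (fun M rho => iS (rho 1) + rho 0 = iS (rho 1 + rho 0))%M ltac:(def) (nenv [x])); simpl.
  - rewrite !add_0_r; auto.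
  - intros z H; rewrite !add_S_r, H; auto.
Qed.
Lemma add_comm x y : x + y = y + x.
Proof.
  apply (ind_def (fun M rho => rho 1 + rho 0 = rho 0 + rho 1)%M ltac:(def) (nenv [x])); simpl.
  - rewrite add_0_r, add_0_l; auto.
  - intros z H; rewrite add_S_r, add_S_l, H; auto.
Qed.
Lemma add_assoc x y z : x + (y + z) = x + y + z.
Proof.
  apply (ind_def (fun M rho => rho 1 + (rho 2 + rho 0) = rho 1 + rho 2 + rho 0)%M
    ltac:(def) (nenv [x; y])); simpl.
  - rewrite !add_0_r; auto.
  - intros t H; rewrite !add_S_r, H; auto.
Qed.
Lemma mul_0_l x : i0 * x = i0.
Proof.
  apply (ind_def (fun M rho => i0 * rho 0 = i0)%M ltac:(def) (nenv [])); simpl.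
  - apply mul_0_r.
  - intros y H; rewrite mul_S_r, H, add_0_r; auto.
Qed.
Lemma mul_S_l x y : iS x * y = x * y + y.
Proof.
  apply (ind_def (fun M rho => iS (rho 1) * rho 0 = rho 1 * rho 0 + rho 0)%M
    ltac:(def) (nenv [x])); simpl.
  - rewrite !mul_0_r, add_0_r; auto.
  - intros z H; rewrite !mul_S_r, H, !add_S_r, <- !add_assoc. rewrite (add_comm z x); auto.
Qed.
Lemma mul_comm x y : x * y = y * x.
Proof.
  apply (ind_def (fun M rho => rho 1 * rho 0 = rho 0 * rho 1)%M ltac:(def) (nenv [x])); simpl.
  - rewrite mul_0_r, mul_0_l; auto.
  - intros z H; rewrite mul_S_r, mul_S_l, H; auto.
Qed.
Lemma mul_add_r x y z : x * (y + z) = x * y + x * z.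
Proof.
  apply (ind_def (fun M rho => rho 1 * (rho 2 + rho 0) = rho 1 * rho 2 + rho 1 * rho 0)%M
    ltac:(def) (nenv [x; y])); simpl.
  - rewrite mul_0_r, !add_0_r; auto.
  - intros t H; rewrite add_S_r, !mul_S_r, H, add_assoc; auto.
Qed.
Lemma mul_assoc x y z : x * (y * z) = x * y * z.
Proof.
  apply (ind_def (fun M rho => rho 1 * (rho 2 * rho 0) = rho 1 * rho 2 * rho 0)%M
    ltac:(def) (nenv [x; y])); simpl.
  - rewrite !mul_0_r; auto.
  - intros t H; rewrite !mul_S_r, mul_add_r, H; auto.
Qed.

Lemma M_semi_ring : semi_ring_theory (i0 : M) ione iadd imul eq.
Proof.
  constructor; auto using add_0_l, add_comm, add_assoc, mul_comm, mul_assoc, mul_0_l.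
  - intros x; unfold ione; rewrite mul_S_l, mul_0_l, add_0_l; auto.
  - intros x y z; rewrite mul_comm, mul_add_r, !(mul_comm z); auto.
Qed.
Add Ring Mring : M_semi_ring.

Lemma succE x : iS x = x + ione.
Proof. unfold ione; rewrite add_S_r, add_0_r; auto. Qed.

Lemma add_cancel_l x y z : x + y = x + z -> y = z.
Proof.
  apply (ind_def (fun M rho => rho 0 + rho 1 = rho 0 + rho 2 -> rho 1 = rho 2)%M
    ltac:(def) (nenv [y; z])); simpl.
  - rewrite !add_0_l; auto.
  - intros t H; rewrite !add_S_l; intros E; apply H, S_inj; auto.
Qed.
Lemma add_cancel_r x y z : y + x = z + x -> y = z.
Proof. rewrite !(add_comm _ x); apply add_cancel_l. Qed.

Lemma zero_or_succ x : x = i0 \/ exists y, x = iS y.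
Proof.
  apply (ind_def (fun M rho => rho 0 = i0 \/ exists y : M, rho 0 = iS y) ltac:(def) (nenv [])); simpl; eauto.
Qed.

Lemma lt_add x y : x < y <-> exists z, y = x + z + ione.
Proof.
  rewrite lt_def; split; intros [z H]; exists z; [rewrite <- H|rewrite H]; rewrite succE; ring.
Qed.
Lemma le_add x y : x <= y <-> exists z, y = x + z.
Proof.
  unfold ile; rewrite lt_add; split; intros [z H]; exists z.
  - rewrite succE in H; apply add_cancel_r in H; auto.
  - rewrite H, succE; ring.
Qed.

Lemma add_one_neq_0 x : x + ione <> i0.
Proof. rewrite <- succE; apply S_neq_0. Qed.

Lemma not_lt_0 x : ~ x < i0.
Proof. rewrite lt_add; intros [z H]; apply (add_one_neq_0 (x + z)); auto. Qed.

Lemma lt_irrefl x : ~ x < x.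
Proof.
  rewrite lt_add; intros [z H]. apply (add_one_neq_0 z), (add_cancel_l x).
  rewrite H at 2. ring.
Qed.

Lemma lt_trans x y z : x < y -> y < z -> x < z.
Proof.
  rewrite !lt_add; intros [u ->] [v ->]; exists (u + v + ione); ring.
Qed.
Lemma le_lt_trans x y z : x <= y -> y < z -> x < z.
Proof. rewrite le_add, !lt_add; intros [u ->] [v ->]; exists (u + v); ring. Qed.
Lemma lt_le_trans x y z : x < y -> y <= z -> x < z.
Proof. rewrite le_add, !lt_add; intros [u ->] [v ->]; exists (u + v); ring. Qed.
Lemma le_trans x y z : x <= y -> y <= z -> x <= z.
Proof. rewrite !le_add; intros [u ->] [v ->]; exists (u + v); ring. Qed.
Lemma le_refl x : x <= x.
Proof. apply le_add; exists i0; ring. Qed.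
Lemma lt_le x y : x < y -> x <= y.
Proof. rewrite le_add, lt_add; intros [u ->]; exists (u + ione); ring. Qed.
Lemma lt_S_iff x y : x < iS y <-> x <= y.
Proof. reflexivity. Qed.
Lemma le_lt_or_eq x y : x <= y <-> x < y \/ x = y.
Proof.
  rewrite le_add, lt_add; split.
  - intros [z ->]. destruct (zero_or_succ z) as [->|[t ->]].
    + right; ring.
    + left; exists t; rewrite succE; ring.
  - intros [[z ->]| ->]; [exists (z + ione); ring|exists i0; ring].
Qed.
Lemma le_S x y : x < y <-> iS x <= y.
Proof.
  rewrite le_add, lt_add; split; intros [z ->]; exists z; rewrite succE; ring.
Qed.
Lemma le_0 x : i0 <= x.
Proof. apply le_add; exists x; ring. Qed.
Lemma le_total x y : x <= y \/ y < x.
Proof.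
  apply (ind_def (fun M rho => rho 0 <= rho 1 \/ rho 1 < rho 0)%M ltac:(def) (nenv [y])); simpl.
  - left; apply le_0.
  - intros z [H|H].
    + apply le_lt_or_eq in H as [H| ->]; [left; apply (proj1 (le_S _ _) H)|right; apply le_refl].
    + right. eapply lt_trans; [exact H|]. apply le_refl.
Qed.
Lemma lt_not_le x y : x < y <-> ~ y <= x.
Proof.
  split; [intros H H'; apply (lt_irrefl x); eapply lt_le_trans; eauto|].
  intros H; destruct (le_total y x); tauto.
Qed.
Lemma trichotomy x y : x < y \/ x = y \/ y < x.
Proof. destruct (le_total x y) as [H|H]; [apply le_lt_or_eq in H|]; tauto. Qed.
Lemma le_add_r x y : x <= x + y.
Proof. apply le_add; eauto. Qed.
Lemma le_add_l x y : x <= y + x.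
Proof. apply le_add; exists y; ring. Qed.
Lemma le_antisym x y : x <= y -> y <= x -> x = y.
Proof.
  intros H H'; apply le_lt_or_eq in H as [H|]; auto. apply lt_not_le in H; tauto.
Qed.

Lemma least (R : rel) : Def R -> forall (rho : nat -> M) x, R M (scons x rho) ->
  exists y, R M (scons y rho) /\ forall z, z < y -> ~ R M (scons z rho).
Proof.
  intros HR rho x Hx; apply NNPP; intros Hn.
  assert (H : forall y z, z < y -> ~ R M (scons z rho)).
  { intros y.
    apply (ind_def (fun M rho => forall z : M, (z < rho 0)%M -> ~ R M (scons z (fun i => rho (S i))))
      ltac:(def) rho); simpl.
    - intros z Hz; destruct (not_lt_0 _ Hz).
    - intros u Hu z Hz Hr. apply lt_S_iff, le_lt_or_eq in Hz as [Hz| ->].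
      + exact (Hu z Hz Hr).
      + apply Hn; exists u; split; [exact Hr|exact Hu]. }
  apply (H (iS x) x); auto. apply le_refl.
Qed.

(** * The pairing polynomial *)

Lemma square_lt x y x' y' : x + y < x' + y' -> pair x y < pair x' y'.
Proof.
  rewrite !lt_add; intros [d H]; unfold pair; rewrite H.
  set (s := x + y). exists ((s + s) * d + s + d * d + d + d + x' + y). unfold s; ring.
Qed.
Lemma pair_inj x y x' y' : pair x y = pair x' y' -> x = x' /\ y = y'.
Proof.
  intros H. assert (E : x + y = x' + y').
  { destruct (trichotomy (x + y) (x' + y')) as [L|[E|L]]; auto;
      apply square_lt in L; rewrite H in L; destruct (lt_irrefl _ L). }
  unfold pair in H; rewrite E in H; apply add_cancel_l in H; subst x'.
  apply add_cancel_l in E; auto.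
Qed.
Lemma pair_ge_l x y : x <= pair x y.
Proof. unfold pair; apply le_add_l. Qed.
Lemma square_ge x : x <= x * x.
Proof.
  apply le_add. destruct (zero_or_succ x) as [->|[z ->]].
  - exists i0; ring.
  - exists (iS z * z); rewrite succE; ring.
Qed.
Lemma pair_ge_r x y : y <= pair x y.
Proof.
  unfold pair; apply le_trans with (x + y); [apply le_add_l|].
  eapply le_trans; [apply square_ge|]; apply le_add_r.
Qed.
Lemma pair_gt_l x y : x < iS (pair x y).
Proof. apply pair_ge_l. Qed.
Lemma pair_gt_r x y : y < iS (pair x y).
Proof. apply pair_ge_r. Qed.

End Arith.

(** * Coded finite sets *)

Section Coding.
Variable M : model.
Implicit Types x y z u v w b c m : M.
Local Open Scope M_scope.
Add Ring Mring2 : (M_semi_ring M).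

Definition dvd m u : Prop := exists q, u = q * m.
(** Plays the role of being coprime to [m], in a form that passes to products at once and needs no
    greatest common divisors. *)
Definition invertible u m : Prop := exists s q, s * u = ione + q * m.

Lemma invertible_mul u v m : invertible u m -> invertible v m -> invertible (u * v) m.
Proof.
  intros (s & q & H) (s' & q' & H'); exists (s * s'), (q + q' + q * q' * m).
  replace (s * s' * (u * v)) with ((s * u) * (s' * v)) by ring. rewrite H, H'; ring.
Qed.

Lemma invertible_one m : invertible ione m.
Proof. exists ione, i0; ring. Qed.

(** An invertible multiple of the modulus would make 1 a multiple of it, but the modulus exceeds 1
    because [x] and [v] are nonzero. *)
Lemma not_dvd_invertible u v x : v <> i0 -> x <> i0 ->
  dvd (iS (x * v)) u -> invertible u (iS (x * v)) -> False.
Proof.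
  intros Hv Hx [q ->] (s & q' & H).
  destruct (zero_or_succ M v) as [|[v' ->]]; [tauto|].
  destruct (zero_or_succ M x) as [|[x' ->]]; [tauto|].
  rewrite !succE in H.
  set (k := x' * v' + x' + v' + ione) in H.
  replace ((x' + ione) * (v' + ione) + ione) with (k + ione) in H by (unfold k; ring).
  destruct (le_total M (s * q) q') as [L|L].
  - apply le_add in L as [d ->].
    apply (add_one_neq_0 M (d * (k + ione))), (add_cancel_l M (s * q * (k + ione))).
    transitivity (ione + (s * q + d) * (k + ione)); [ring|].
    rewrite <- H; ring.
  - apply lt_add in L as [d E].
    assert (H' : q' * (k + ione) + (d * (k + ione) + k + ione) = q' * (k + ione) + ione).
    { transitivity ((q' + d + ione) * (k + ione)); [ring|]. rewrite <- E.
      transitivity (s * (q * (k + ione))); [ring|]. rewrite H; ring. }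
    apply add_cancel_l in H'.
    apply (add_one_neq_0 M (d * (k + ione) + x' * v' + x' + v')), (add_cancel_r M ione).
    transitivity (d * (k + ione) + k + ione); [unfold k; ring|]. rewrite H'; ring.
Qed.

(* Both cases compute modulo [1 + y], [y = (x+1)v], where [y = -1] and hence [y*y = 1]. *)
Lemma invertible_modulus b v x y :
  v <> i0 -> (forall d, d <= b -> d <> i0 -> dvd d v) ->
  x <= b -> y <= b -> x <> y -> invertible (iS (iS y * v)) (iS (iS x * v)).
Proof.
  intros Hv Hd Hx Hy Hxy.
  destruct (zero_or_succ M v) as [|[v' Ev]]; [tauto|].
  set (t := iS x * v).
  assert (Ht : exists t', t = t' + ione).
  { exists (x * v' + x + v'); unfold t; rewrite Ev, !succE; ring. }
  destruct Ht as [t' Ht].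
  destruct (trichotomy M x y) as [L|[L|L]]; [|tauto|].
  - apply lt_add in L as [d E].
    destruct (Hd (d + ione)) as [w Hw].
    { eapply le_trans; [|exact Hy]. rewrite E. apply le_add; exists x; ring. }
    { apply add_one_neq_0. }
    (* Modulo 1 + t the number to invert is (d + 1)v, where d + 1 = y - x. As v = w(d + 1),
       multiplying by w(x + 1)^2 gives t^2, which is congruent to 1. *)
    exists (w * iS x * iS x), (w * iS x * iS x + t').
    transitivity (w * iS x * iS x * (iS t) + t * (iS x * (w * (d + ione)))).
    { unfold t; rewrite E, !succE; ring. }
    rewrite <- Hw. replace (iS x * v) with t by reflexivity.
    rewrite (succE _ t). rewrite Ht at 2 3. rewrite Ht. ring.
  - apply lt_add in L as [d E].
    destruct (Hd (d + ione)) as [w Hw].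
    { eapply le_trans; [|exact Hx]. rewrite E. apply le_add; exists y; ring. }
    { apply add_one_neq_0. }
    (* Now the number to invert is congruent to -(d + 1)v. The further factor t in [A], congruent to
       -1, restores the sign; [B] is the quotient of t^3 + 1 by t + 1, written with t' = t - 1 to
       avoid subtraction. *)
    set (B := ione + t' + t' * t').
    set (A := w * iS x * iS x * t).
    set (n := iS y * v).
    exists (A + B * iS t), (A + B * n).
    assert (E1 : t = n + (d + ione) * v) by (unfold t, n; rewrite E, !succE; ring).
    assert (E2 : A * (d + ione) * v = t * t * t).
    { unfold A. transitivity (iS x * (w * (d + ione)) * (iS x * v) * t); [ring|].
      rewrite <- Hw. fold t. ring. }
    assert (E3 : t * t * t + ione = B * iS t).
    { unfold B; rewrite succE, Ht; ring. }
    assert (E4 : A * iS t = A * iS n + t * t * t).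
    { rewrite <- E2, !succE, E1; ring. }
    apply (add_cancel_r M (t * t * t)).
    transitivity (A * iS t + B * iS t * iS n); [rewrite E4; ring|].
    transitivity (A * iS t + B * n * iS t + B * iS t); [rewrite !succE; ring|].
    rewrite <- E3, !succE; ring.
Qed.

(** Goedel's coding by divisibility: a suitable [v] makes the moduli 1 + (x + 1)v for x < b pairwise
    coprime. Every quantifier is bounded, the quotient included, so membership is Delta0. *)
Definition mem x c : Prop :=
  exists b, b < iS c /\ exists u, u < iS c /\ exists v, v < iS c /\
    c = pair b (pair u v) /\ x < b /\ exists q, q < iS u /\ u = q * iS (iS x * v).

Lemma mem_code x b u v : mem x (pair b (pair u v)) <-> x < b /\ dvd (iS (iS x * v)) u.
Proof.
  split.
  - intros (b' & _ & u' & _ & v' & _ & E & Hx & q & _ & Hq).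
    apply pair_inj in E as [-> E]; apply pair_inj in E as [-> ->].
    split; auto; exists q; auto.
  - intros [Hx [q Hq]]; exists b; split; [apply pair_gt_l|].
    exists u; split; [apply le_lt_trans with (pair u v); [apply pair_ge_l|apply pair_gt_r]|].
    exists v; split; [apply le_lt_trans with (pair u v); [apply pair_ge_r|apply pair_gt_r]|].
    repeat split; auto. exists q; split; auto.
    rewrite Hq. apply lt_S_iff, le_add. exists (q * (iS x * v)); rewrite !succE; ring.
Qed.

Lemma mem_lt x c : mem x c -> x < c.
Proof.
  intros (b & _ & u & _ & v & _ & E & Hx & _).
  rewrite E; eapply lt_le_trans; [exact Hx|apply pair_ge_l].
Qed.

(** Takes the place of the factorial of [b], whose definition would already require coded
    sequences. *)
Lemma common_multiple b : exists v, v <> i0 /\ forall d, d <= b -> d <> i0 -> dvd d v.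
Proof.
  apply (ind_def M (fun M rho => exists v : M, v <> i0 /\
    forall d : M, (d <= rho 0)%M -> d <> i0 -> exists q : M, v = (q * d)%M) ltac:(def) (nenv []));
    simpl.
  - exists ione; split; [apply S_neq_0|].
    intros d Hd Hn. destruct Hn. apply le_antisym; auto. apply le_0.
  - intros x (v & Hv & H). exists (v * iS x); split.
    + destruct (zero_or_succ M v) as [|[v' ->]]; [tauto|].
      intros E; apply (add_one_neq_0 M (v' * x + v' + x)). rewrite <- E, !succE; ring.
    + intros d Hd Hn. apply le_lt_or_eq in Hd as [Hd| ->].
      * destruct (H d Hd Hn) as [q ->]; exists (q * iS x); ring.
      * exists v; ring.
Qed.

(** The number [u] is the product of the moduli of the chosen elements, built by induction on how
    many candidates have been examined. The product itself is not a term, so the induction carries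
    two properties of it: it is divisible by the chosen moduli and invertible modulo the others. *)
Lemma comprehension (D : rel) (HD : Def D) (rho : nat -> M) b :
  exists c, forall x, mem x c <-> x < b /\ D M (scons x rho).
Proof.
  destruct (common_multiple b) as (v & Hv & Hd).
  assert (H : forall i, exists u, i <= b -> forall x, x < b ->
    (x < i /\ D M (scons x rho) -> exists q, u = q * iS (iS x * v)) /\
    (~ (x < i /\ D M (scons x rho)) -> exists s q, s * u = ione + q * iS (iS x * v))).
  { intros i.
    apply (ind_def M (fun M rho => exists u : M, (rho 0 <= rho 1)%M ->
      forall x : M, (x < rho 1)%M ->
      ((x < rho 0)%M /\ D M (scons x (fun i => rho (3 + i)%nat)) ->
        exists q : M, u = (q * iS (iS x * rho 2))%M) /\
      (~ ((x < rho 0)%M /\ D M (scons x (fun i => rho (3 + i)%nat))) ->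
        exists s q : M, (s * u = ione + q * iS (iS x * rho 2))%M)) ltac:(def)
      (scons b (scons v rho))); simpl.
    - exists ione; intros _ x Hx; split; [intros [H _]; destruct (not_lt_0 _ _ H)|].
      intros _; apply invertible_one.
    - clear i; intros i (u & Hu).
      assert (Hi : iS i <= b -> i <= b).
      { intros L; eapply le_trans; [|exact L]. apply lt_le, le_refl. }
      destruct (classic (D M (scons i rho))) as [Di|Di].
      + exists (u * iS (iS i * v)); intros L x Hx; split.
        * intros [Hxi Dx]. apply lt_S_iff, le_lt_or_eq in Hxi as [Hxi| ->].
          -- destruct (Hu (Hi L) x Hx) as [H1 _]. destruct H1 as [q ->]; auto.
             exists (q * iS (iS i * v)); ring.
          -- exists u; ring.
        * intros Hn. apply invertible_mul.
          -- apply (Hu (Hi L) x Hx). intros [H1 H2]; apply Hn; split; auto.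
             eapply lt_trans; [exact H1|apply le_refl].
          -- apply (invertible_modulus b); auto using lt_le.
             intros ->; apply Hn; split; [apply le_refl|auto].
      + exists u; intros L x Hx. destruct (Hu (Hi L) x Hx) as [H1 H2]. split.
        * intros [Hxi Dx]; apply H1; split; auto.
          apply lt_S_iff, le_lt_or_eq in Hxi as [Hxi| ->]; tauto.
        * intros Hn; apply H2; intros [Hxi Dx]; apply Hn; split; auto.
          eapply lt_trans; [exact Hxi|apply le_refl]. }
  destruct (H b) as [u Hu]. specialize (Hu (le_refl M b)).
  exists (pair b (pair u v)); intros x. rewrite mem_code.
  split; intros [Hx H']; split; auto; destruct (Hu x Hx) as [H1 H2].
  - apply NNPP; intros Hn. eapply (not_dvd_invertible u v (iS x)); auto using S_neq_0.
    apply H2; tauto.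
  - apply H1; auto.
Qed.

End Coding.

Arguments mem {M}.

Lemma D0_mem f g : Tm f -> Tm g -> D0 (fun M rho => mem (f M rho) (g M rho)).
Proof. intros; apply (D0_app2 (fun M => @mem M)); auto. unfold mem; d0. Qed.

Ltac d0_hook ::= first [apply D0_le; tm | apply D0_mem; tm].

Lemma insert (M : model) (c i : M) : exists c', forall x, mem x c' <-> mem x c \/ x = i.
Proof.
  destruct (comprehension M (fun M rho => mem (rho 0) (rho 1) \/ rho 0 = rho 2) ltac:(def)
    (nenv [c; i]) (iadd c (iS i))) as [c' H].
  exists c'; intros x; rewrite H; simpl; split; [tauto|].
  intros Hx; split; auto. destruct Hx as [Hx| ->].
  - eapply lt_le_trans; [apply mem_lt; exact Hx|apply le_add_r].
  - eapply lt_le_trans; [apply le_refl|apply le_add_l].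
Qed.

Lemma empty_set (M : model) : exists c : M, forall x, ~ mem x c.
Proof.
  destruct (comprehension M (fun M rho => False) ltac:(def) (nenv []) i0) as [c H].
  exists c; intros x Hx; apply H in Hx; tauto.
Qed.

(** * Collection *)

Lemma collection (R : rel) (HR : Def R) (M : model) (rho : nat -> M) b :
  (forall x, ilt x b -> exists y, R M (scons y (scons x rho))) ->
  exists w, forall x, ilt x b -> exists y, ilt y w /\ R M (scons y (scons x rho)).
Proof.
  intros H.
  assert (H' : forall i, ile i b -> exists w, forall x, ilt x i ->
            exists y, ilt y w /\ R M (scons y (scons x rho))).
  { intros i.
    refine (ind_def M (fun M rho => ile (rho 0) (rho 1) -> exists w : M, forall x : M, ilt x (rho 0) ->
      exists y : M, ilt y w /\ R M (scons y (scons x (fun i => rho (2 + i))))) _ (scons b rho) _ _ i);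
      simpl.
    - apply Def_imp; [def|]. apply Def_ex, Def_all, Def_imp; [def|]. apply Def_ex, Def_and; [def|].
      simpl. apply (Def_iff (fun M rho => R M (fun i =>
         match i with 0 => rho 0 | 1 => rho 1 | S (S i) => rho (5 + i) end))).
      + intros M' r. replace (fun i => match i with 0 => r 0 | 1 => r 1 | S (S i) => r (5 + i) end)
          with (scons (r 0) (scons (r 1) (fun i => r (S (S (S (S (S i))))))));
          [tauto|extensionality i'; destruct i' as [|[|]]; auto].
      + apply (Def_comp R (fun i M rho =>
          match i with 0 => rho 0 | 1 => rho 1 | S (S i) => rho (5 + i) end)); auto.
        intros [|[|j]]; apply Tm_var.
    - intros _; exists i0; intros x Hx; destruct (not_lt_0 _ _ Hx).
    - clear i; intros i IH L.
      destruct IH as [w Hw]; [eapply le_trans; [|exact L]; apply lt_le, le_refl|].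
      destruct (H i) as [y Hy]; [apply le_S; exact L|].
      exists (iadd w (iS y)); intros x Hx.
      apply lt_S_iff, le_lt_or_eq in Hx as [Hx| ->].
      + destruct (Hw x Hx) as (z & Hz & Hr); exists z; split; auto.
        eapply lt_le_trans; [exact Hz|apply le_add_r].
      + exists y; split; auto. eapply lt_le_trans; [apply le_refl|apply le_add_l]. }
  apply (H' b), le_refl.
Qed.

(** * The arithmetical hierarchy for uniform relations *)

(** A prenex form with a single quantifier per level. The negation before the matrix turns Sigma
    into Pi, so one recursion serves both classes. *)
Fixpoint Sg (n : nat) (R : rel) : Prop :=
  match n with
  | 0 => D0 R
  | S n => exists R', Sg n R' /\ forall M rho, R M rho <-> exists x, ~ R' M (scons x rho)
  end.

Definition Pg (n : nat) (R : rel) : Prop := Sg n (fun M rho => ~ R M rho).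

Lemma Sg_iff n R R' : (forall M rho, R M rho <-> R' M rho) -> Sg n R -> Sg n R'.
Proof.
  destruct n as [|n]; simpl; [apply D0_iff|].
  intros H (Q & HQ & E); exists Q; split; auto; intros; rewrite <- H; auto.
Qed.

Lemma Pg_iff n R R' : (forall M rho, R M rho <-> R' M rho) -> Pg n R -> Pg n R'.
Proof. intros H; apply Sg_iff; intros; rewrite H; tauto. Qed.

Lemma Sg_Def n : forall R, Sg n R -> Def R.
Proof.
  induction n as [|n IH]; simpl; [apply D0_Def|].
  intros R (Q & HQ & E). destruct (IH _ HQ) as [a Ha]. exists (Ex (Neg a)).
  intros M rho; rewrite E; simpl; split; intros [x Hx]; exists x; rewrite Ha in *; auto.
Qed.

Lemma Sg_comp n : forall R (F : nat -> forall M : model, (nat -> M) -> M),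
  Sg n R -> (forall i, Tm (F i)) -> Sg n (fun M rho => R M (fun i => F i M rho)).
Proof.
  induction n as [|n IH]; simpl; intros R F HR HF; [apply D0_comp; auto|].
  destruct HR as (Q & HQ & E).
  exists (fun M rho => Q M (fun i => match i with
            | 0 => rho 0 | S j => F j M (fun i => rho (S i)) end)); split.
  - apply (IH Q (fun i M rho => match i with 0 => rho 0 | S j => F j M (fun i => rho (S i)) end)); auto.
    intros [|i]; [apply Tm_var|apply Tm_shift; auto].
  - intros M rho; rewrite E.
    assert (E' : forall x, scons x (fun i => F i M rho) =
      (fun i => match i with 0 => x | S j => F j M rho end))
      by (intros; extensionality i; destruct i; auto).
    split; intros [x Hx]; exists x; rewrite E' in *; exact Hx.
Qed.

Lemma Sg_app2 n R f g (h : nat -> nat) : Sg n R -> Tm f -> Tm g ->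
  Sg n (fun M rho => R M (scons (f M rho) (scons (g M rho) (fun i => rho (h i))))).
Proof.
  intros HR Hf Hg.
  apply (Sg_iff n (fun M rho => R M (fun i =>
    match i with 0 => f M rho | 1 => g M rho | S (S i) => rho (h i) end))).
  - intros M rho.
    replace (scons (f M rho) (scons (g M rho) (fun i => rho (h i)))) with
      (fun i => match i with 0 => f M rho | 1 => g M rho | S (S i) => rho (h i) end); [tauto|].
    extensionality i; destruct i as [|[|]]; auto.
  - apply (Sg_comp n R (fun i M rho =>
      match i with 0 => f M rho | 1 => g M rho | S (S i) => rho (h i) end)); auto.
    intros [|[|]]; auto using Tm_var.
Qed.

Lemma Pg_Sg_S n R : Pg n R -> Sg (S n) R.
Proof.
  intros H; exists (fun M rho => ~ R M (fun i => rho (S i))); split.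
  - apply (Sg_comp n (fun M rho => ~ R M rho) (fun i M rho => rho (S i))); auto.
    intros; apply Tm_var.
  - intros M rho; split.
    + intros Hr; exists i0; auto.
    + intros [x Hx]; apply NNPP in Hx; exact Hx.
Qed.

Lemma Pg_neg n R : Sg n R <-> Pg n (fun M rho => ~ R M rho).
Proof.
  split; apply Sg_iff; intros M rho; destruct (classic (R M rho)); tauto.
Qed.

Lemma Sg_Sg_S n : forall R, Sg n R -> Sg (S n) R.
Proof.
  induction n as [|n IH]; intros R H.
  - apply Pg_Sg_S, D0_not; auto.
  - destruct H as (Q & HQ & E). exists Q; split; auto.
Qed.

Lemma Sg_le n m R : n <= m -> Sg n R -> Sg m R.
Proof. induction 1; auto using Sg_Sg_S. Qed.

Lemma Pg_le n m R : n <= m -> Pg n R -> Pg m R.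
Proof. apply Sg_le. Qed.

Lemma Sg_S_inv n R : Sg (S n) R -> exists R', Pg n R' /\
  forall M rho, R M rho <-> exists x, R' M (scons x rho).
Proof.
  intros (Q & HQ & E); exists (fun M rho => ~ Q M rho); split; [apply -> Pg_neg; exact HQ|exact E].
Qed.

Lemma max_le (M : model) (x y : M) : exists z, ile x z /\ ile y z.
Proof.
  destruct (le_total M x y) as [H|H]; [exists y|exists x]; split; auto using le_refl, lt_le.
Qed.

Section Closure.
Variable n : nat.

Hypothesis ball_n : forall f (P : forall M : model, M -> (nat -> M) -> Prop), Tm f ->
  Sg n (fun M rho => P M (rho 0) (fun i => rho (S i))) ->
  Sg n (fun M rho => forall x, ilt x (f M rho) -> P M x rho).
Hypothesis bex_n : forall f (P : forall M : model, M -> (nat -> M) -> Prop), Tm f ->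
  Sg n (fun M rho => P M (rho 0) (fun i => rho (S i))) ->
  Sg n (fun M rho => exists x, ilt x (f M rho) /\ P M x rho).
Hypothesis and_n : forall P Q, Sg n P -> Sg n Q -> Sg n (fun M rho => P M rho /\ Q M rho).
Hypothesis or_n : forall P Q, Sg n P -> Sg n Q -> Sg n (fun M rho => P M rho \/ Q M rho).

(** Two witnesses are replaced by a common bound instead of a pair: the bounded quantifiers this
    creates are absorbed by [ball_n], and no projections are needed. *)
Lemma ex_step (P : forall M : model, M -> (nat -> M) -> Prop) :
  Sg (S n) (fun M rho => P M (rho 0) (fun i => rho (S i))) ->
  Sg (S n) (fun M rho => exists x, P M x rho).
Proof.
  intros (Q & HQ & E).
  exists (fun M rho => forall x, ilt x (iS (rho 0)) -> forall y, ilt y (iS (rho 0)) ->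
     Q M (scons y (scons x (fun i => rho (S i))))); split.
  - apply ball_n; [tm|]. apply ball_n; [tm|]. apply Sg_app2; auto; tm.
  - intros M rho. split.
    + intros [x Hx]. apply (E M (scons x rho)) in Hx as [y Hy].
      destruct (max_le M x y) as (z & Hxz & Hyz).
      exists z; intros H; apply Hy, (H x Hxz y Hyz).
    + intros [z Hz]. apply NNPP; intros Hn; apply Hz; intros x _ y _.
      apply NNPP; intros Hq; apply Hn. exists x; apply (E M (scons x rho)); exists y; auto.
Qed.

Lemma or_step P Q : Sg (S n) P -> Sg (S n) Q -> Sg (S n) (fun M rho => P M rho \/ Q M rho).
Proof.
  intros (P' & HP & EP) (Q' & HQ & EQ).
  exists (fun M rho => P' M rho /\ Q' M rho); split; auto.
  intros M rho; rewrite EP, EQ; split.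
  - intros [[x Hx]|[x Hx]]; exists x; tauto.
  - intros [x Hx]; apply not_and_or in Hx as [Hx|Hx]; eauto.
Qed.

Lemma and_step P Q : Sg (S n) P -> Sg (S n) Q -> Sg (S n) (fun M rho => P M rho /\ Q M rho).
Proof.
  intros (P' & HP & EP) (Q' & HQ & EQ).
  apply (Sg_iff (S n) (fun M rho => exists x, exists y,
     ~ (P' M (scons x rho) \/ Q' M (scons y rho)))).
  - intros M rho; rewrite EP, EQ; split.
    + intros (x & y & H); apply not_or_and in H; split; [exists x|exists y]; tauto.
    + intros [[x Hx] [y Hy]]; exists x, y; tauto.
  - apply ex_step.
    exists (fun M rho => P' M (scons (rho 1) (fun i => rho (S (S i)))) \/
                        Q' M (scons (rho 0) (fun i => rho (S (S i))))); split.
    + apply or_n.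
      * apply (Sg_iff n (fun M rho => P' M (fun i => rho (S i)))).
        { intros M rho; replace (scons (rho 1) (fun i => rho (S (S i)))) with (fun i => rho (S i));
            [tauto|extensionality i; destruct i; auto]. }
        apply (Sg_comp n P' (fun i M rho => rho (S i))); auto. intros; apply Tm_var.
      * apply (Sg_iff n (fun M rho => Q' M (fun i => rho (match i with 0 => 0 | S i => S (S i) end)))).
        { intros M rho; replace (scons (rho 0) (fun i => rho (S (S i)))) with
            (fun i => rho (match i with 0 => 0 | S i => S (S i) end));
            [tauto|extensionality i; destruct i; auto]. }
        apply (Sg_comp n Q' (fun i M rho => rho (match i with 0 => 0 | S i => S (S i) end))); auto.
        intros; apply Tm_var.
    + intros M rho; simpl; tauto.
Qed.

Lemma bex_step f (P : forall M : model, M -> (nat -> M) -> Prop) : Tm f ->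
  Sg (S n) (fun M rho => P M (rho 0) (fun i => rho (S i))) ->
  Sg (S n) (fun M rho => exists x, ilt x (f M rho) /\ P M x rho).
Proof.
  intros Hf (Q & HQ & E).
  exists (fun M rho => forall x, ilt x (f M (fun i => rho (S i))) ->
    Q M (scons (rho 0) (scons x (fun i => rho (S i))))); split.
  - apply ball_n; [apply Tm_shift; auto|]. apply Sg_app2; auto; tm.
  - intros M rho; simpl; split.
    + intros (x & Hx & Hp). apply (E M (scons x rho)) in Hp as [y Hy].
      exists y; intros H; apply Hy, H; auto.
    + intros [y Hy]. apply NNPP; intros Hn; apply Hy; intros x Hx.
      apply NNPP; intros Hq; apply Hn; exists x; split; auto.
      apply (E M (scons x rho)); exists y; auto.
Qed.

(** Collection supplies one [w] that bounds witnesses for all x below f, which moves the bounded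
    quantifier inside the unbounded one. *)
Lemma ball_step f (P : forall M : model, M -> (nat -> M) -> Prop) : Tm f ->
  Sg (S n) (fun M rho => P M (rho 0) (fun i => rho (S i))) ->
  Sg (S n) (fun M rho => forall x, ilt x (f M rho) -> P M x rho).
Proof.
  intros Hf (Q & HQ & E).
  exists (fun M rho => exists x, ilt x (f M (fun i => rho (S i))) /\ forall y, ilt y (rho 0) ->
    Q M (scons y (scons x (fun i => rho (S i))))); split.
  - apply bex_n; [apply Tm_shift; auto|]. apply ball_n; [tm|]. apply Sg_app2; auto; tm.
  - intros M rho; simpl; split.
    + intros H.
      assert (HD : Def (fun M rho => ~ Q M rho)) by (apply Def_not, (Sg_Def n); auto).
      destruct (collection _ HD M rho (f M rho)) as [w Hw].
      { intros x Hx; apply (E M (scons x rho)); auto. apply H; auto. }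
      exists w; intros (x & Hx & Hn). destruct (Hw x Hx) as (y & Hy & Hq).
      apply Hq, Hn; auto.
    + intros [w Hw] x Hx. apply (E M (scons x rho)). apply NNPP; intros Hn.
      apply Hw; exists x; split; auto. intros y _. apply NNPP; intros Hq.
      apply Hn; exists y; auto.
Qed.

End Closure.

Lemma Sg_closure n :
  (forall f (P : forall M : model, M -> (nat -> M) -> Prop), Tm f ->
    Sg n (fun M rho => P M (rho 0) (fun i => rho (S i))) ->
    Sg n (fun M rho => forall x, ilt x (f M rho) -> P M x rho)) /\
  (forall f (P : forall M : model, M -> (nat -> M) -> Prop), Tm f ->
    Sg n (fun M rho => P M (rho 0) (fun i => rho (S i))) ->
    Sg n (fun M rho => exists x, ilt x (f M rho) /\ P M x rho)) /\
  (forall P Q, Sg n P -> Sg n Q -> Sg n (fun M rho => P M rho /\ Q M rho)) /\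
  (forall P Q, Sg n P -> Sg n Q -> Sg n (fun M rho => P M rho \/ Q M rho)).
Proof.
  induction n as [|n (H1 & H2 & H3 & H4)].
  - repeat split; [apply D0_ball|apply D0_bex|apply D0_and|apply D0_or].
  - repeat split; [apply ball_step|apply bex_step|apply and_step|apply or_step]; auto.
Qed.

Lemma Sg_ball n f (P : forall M : model, M -> (nat -> M) -> Prop) : Tm f ->
  Sg n (fun M rho => P M (rho 0) (fun i => rho (S i))) ->
  Sg n (fun M rho => forall x, ilt x (f M rho) -> P M x rho).
Proof. apply Sg_closure. Qed.
Lemma Sg_bex n f (P : forall M : model, M -> (nat -> M) -> Prop) : Tm f ->
  Sg n (fun M rho => P M (rho 0) (fun i => rho (S i))) ->
  Sg n (fun M rho => exists x, ilt x (f M rho) /\ P M x rho).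
Proof. apply Sg_closure. Qed.
Lemma Sg_and n P Q : Sg n P -> Sg n Q -> Sg n (fun M rho => P M rho /\ Q M rho).
Proof. apply Sg_closure. Qed.
Lemma Sg_or n P Q : Sg n P -> Sg n Q -> Sg n (fun M rho => P M rho \/ Q M rho).
Proof. apply Sg_closure. Qed.
Lemma Sg_ex n (P : forall M : model, M -> (nat -> M) -> Prop) :
  Sg (S n) (fun M rho => P M (rho 0) (fun i => rho (S i))) ->
  Sg (S n) (fun M rho => exists x, P M x rho).
Proof. apply ex_step, Sg_ball. Qed.
Lemma D0_Sg n R : D0 R -> Sg n R.
Proof. apply (Sg_le 0); lia. Qed.
Lemma D0_Pg n R : D0 R -> Pg n R.
Proof. intros H; apply D0_Sg, D0_not; auto. Qed.
Lemma Pg_and n P Q : Pg n P -> Pg n Q -> Pg n (fun M rho => P M rho /\ Q M rho).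
Proof.
  intros HP HQ; apply (Sg_iff n (fun M rho => ~ P M rho \/ ~ Q M rho)).
  - intros; tauto.
  - apply Sg_or; auto.
Qed.
Lemma Pg_or n P Q : Pg n P -> Pg n Q -> Pg n (fun M rho => P M rho \/ Q M rho).
Proof.
  intros HP HQ; apply (Sg_iff n (fun M rho => ~ P M rho /\ ~ Q M rho)).
  - intros; tauto.
  - apply Sg_and; auto.
Qed.
Lemma Pg_bex n f (P : forall M : model, M -> (nat -> M) -> Prop) : Tm f ->
  Pg n (fun M rho => P M (rho 0) (fun i => rho (S i))) ->
  Pg n (fun M rho => exists x, ilt x (f M rho) /\ P M x rho).
Proof.
  intros Hf HP; apply (Sg_iff n (fun M rho => forall x, ilt x (f M rho) -> ~ P M x rho)).
  - intros; split; [intros H (x & Hx & Hp); apply (H x); auto|].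
    intros H x Hx Hp; apply H; eauto.
  - apply (Sg_ball n f (fun M x rho => ~ P M x rho)); auto.
Qed.
Lemma Sg_not n P : Pg n P -> Sg n (fun M rho => ~ P M rho).
Proof. auto. Qed.
Lemma Pg_not n P : Sg n P -> Pg n (fun M rho => ~ P M rho).
Proof. apply Pg_neg. Qed.

(* Correspondence between the syntactic and the semantic hierarchy *)
Scheme Sigma_mut := Induction for Sigma Sort Prop
with Pi_mut := Induction for Pi Sort Prop.
Combined Scheme Sigma_Pi_ind from Sigma_mut, Pi_mut.

Lemma Sigma_Pi_rel :
  (forall n a, Sigma n a -> Sg n (fun M rho => sat rho a)) /\
  (forall n a, Pi n a -> Pg n (fun M rho => sat rho a)).
Proof.
  apply Sigma_Pi_ind.
  - intros a Ha; exists a; split; auto; tauto.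
  - intros n a _ H; apply Pg_Sg_S; auto.
  - intros n a _ H; simpl. apply (Sg_ex n (fun M x rho => sat (scons x rho) a)).
    eapply Sg_iff; [|exact H]. intros M rho.
    replace (scons (rho 0) (fun i => rho (S i))) with rho; [tauto|].
    extensionality i; destruct i; auto.
  - intros a Ha; apply D0_not; exists a; split; auto; tauto.
  - intros n a _ H; apply Pg_Sg_S. apply Pg_not; auto.
  - intros n a _ H.
    apply (Sg_iff _ (fun M rho => exists x, ~ sat (scons x rho) a)).
    + intros M rho; simpl; split; [intros [x Hx] H'; auto|]. intros H'.
      apply NNPP; intros Hn; apply H'; intros x; apply NNPP; eauto.
    + apply (Sg_ex n (fun M x rho => ~ sat (scons x rho) a)).
      eapply Sg_iff; [|exact H]. intros M rho.
      replace (scons (rho 0) (fun i => rho (S i))) with rho; [tauto|].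
      extensionality i; destruct i; auto.
Qed.

(** Formulas for [R] and for its negation are produced together, because each level of [Sg] negates
    the level below. *)
Lemma Sg_formula n : forall R, Sg n R ->
  (exists a, Sigma n a /\ forall M rho, R M rho <-> sat rho a) /\
  (exists a, Pi n a /\ forall M rho, ~ R M rho <-> sat rho a).
Proof.
  induction n as [|n IH]; intros R HR.
  - destruct HR as (a & Ha & H). split.
    + exists a; split; [constructor|]; auto.
    + exists (Neg a); split; [repeat constructor; auto|].
      intros; rewrite H; simpl; tauto.
  - destruct HR as (Q & HQ & E).
    destruct (IH Q HQ) as [(a & Ha & H) (b & Hb & H')]. split.
    + exists (Ex b); split; [apply Sigma_ex, Sigma_Pi; auto|].
      intros M rho; rewrite E; simpl. split; intros [x Hx]; exists x; apply H'; auto.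
    + exists (All a); split; [apply Pi_all, Pi_Sigma; auto|].
      intros M rho; rewrite E; simpl. split.
      * intros Hn x; apply H, NNPP; eauto.
      * intros Hx [x Hn]; apply Hn, H; auto.
Qed.

Lemma Sigma_Pi_subst :
  (forall n a, Sigma n a -> forall sigma, Sigma n (subst sigma a)) /\
  (forall n a, Pi n a -> forall sigma, Pi n (subst sigma a)).
Proof.
  apply Sigma_Pi_ind; intros; simpl; try (constructor; auto using Delta0_subst; fail).
Qed.

(* Replacing the superfluous variables by [0] bounds the free variables. *)
Lemma close_formula k a (R : rel) : (forall M rho, R M rho <-> sat rho a) ->
  (forall (M : model) (rho rho' : nat -> M), (forall i, i < k -> rho i = rho' i) -> R M rho <-> R M rho') ->
  exists sigma, bounded k (subst sigma a) /\ forall M rho, R M rho <-> sat rho (subst sigma a).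
Proof.
  intros H Hk. exists (fun i => if Nat.ltb i k then Var i else Zero); split.
  - eapply bounded_subst; [apply bounded_bnd|]. intros i _.
    destruct (Nat.ltb_spec i k); simpl; auto.
  - intros M rho; rewrite sat_subst, <- H. apply Hk.
    intros i Hi; apply Nat.ltb_lt in Hi; rewrite Hi; auto.
Qed.

Lemma Sg_bounded_formula n k R : Sg n R ->
  (forall (M : model) (rho rho' : nat -> M), (forall i, i < k -> rho i = rho' i) -> R M rho <-> R M rho') ->
  exists a, Sigma n a /\ bounded k a /\ forall M rho, R M rho <-> sat rho a.
Proof.
  intros HR Hk; destruct (Sg_formula n R HR) as [(a & Ha & H) _].
  destruct (close_formula k a R H Hk) as (s & Hs & H').
  exists (subst s a); split; auto. apply Sigma_Pi_subst; auto.
Qed.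

Lemma Pg_bounded_formula n k R : Pg n R ->
  (forall (M : model) (rho rho' : nat -> M), (forall i, i < k -> rho i = rho' i) -> R M rho <-> R M rho') ->
  exists a, Pi n a /\ bounded k a /\ forall M rho, R M rho <-> sat rho a.
Proof.
  intros HR Hk; destruct (Sg_formula n _ HR) as [_ (a & Ha & H)].
  destruct (close_formula k a R) as (s & Hs & H'); auto.
  { intros M rho; rewrite <- H; destruct (classic (R M rho)); tauto. }
  exists (subst s a); split; auto. apply Sigma_Pi_subst; auto.
Qed.

(** * The standard model *)

Lemma to_nat_inj2 a b c d : to_nat (a, b) = to_nat (c, d) -> a = c /\ b = d.
Proof.
  intros E; apply (f_equal of_nat) in E; rewrite !cancel_of_to in E; inversion E; auto.
Qed.

Definition nat_structure : structure :=
  {| carrier := nat; i0 := 0; iS := S; iadd := Nat.add; imul := Nat.mul; ilt := Nat.lt |}.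

Lemma iter_All_sat (M : structure) k : forall a, (forall rho : nat -> M, sat rho a) ->
  forall rho : nat -> M, sat rho (Nat.iter k All a).
Proof. induction k as [|k IH]; simpl; auto. Qed.

Lemma nat_PA : models nat_structure PA.
Proof.
  intros a Ha; destruct Ha; simpl; unfold scons; try (intros; lia).
  - intros _ x y; split.
    + intros H; exists (y - S x); lia.
    + intros [z H]; lia.
  - apply (iter_All_sat nat_structure); intros rho H0 HS x.
    apply (sat_inst nat_structure) in H0. change nat in x.
    induction x as [|x IH]; [exact H0|]. specialize (HS x IH). apply (sat_subst nat_structure) in HS.
    refine (eq_ind _ (fun r => @sat nat_structure r a) HS _ _).
    apply functional_extensionality; intros [|i]; reflexivity.
Qed.

Definition N : model := Model nat_structure nat_PA.

(** * Sigma_1 relations on the natural numbers *)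

Definition env : Type := nat -> nat.

(** Although [R] lives on the standard numbers, [R'] is a relation on all models: its Delta0 matrix
    will later be read in nonstandard ones. *)
Definition S1 (R : env -> Prop) : Prop :=
  exists R', Sg 1 R' /\ forall rho : env, R rho <-> R' N rho.

Definition Sfn (f : env -> nat) : Prop := S1 (fun rho => rho 0 = f (fun i => rho (S i))).

Lemma S1_iff R R' : (forall rho, R rho <-> R' rho) -> S1 R -> S1 R'.
Proof. intros H (Q & HQ & E); exists Q; split; auto; intros; rewrite <- H; auto. Qed.

Lemma S1_D0 (R : env -> Prop) (R' : rel) :
  D0 R' -> (forall rho : env, R rho <-> R' N rho) -> S1 R.
Proof. intros H E; exists R'; split; auto. apply D0_Sg; auto. Qed.

Lemma S1_and P Q : S1 P -> S1 Q -> S1 (fun rho => P rho /\ Q rho).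
Proof.
  intros (P' & HP & EP) (Q' & HQ & EQ); exists (fun M rho => P' M rho /\ Q' M rho); split.
  - apply Sg_and; auto.
  - intros; rewrite EP, EQ; tauto.
Qed.
Lemma S1_or P Q : S1 P -> S1 Q -> S1 (fun rho => P rho \/ Q rho).
Proof.
  intros (P' & HP & EP) (Q' & HQ & EQ); exists (fun M rho => P' M rho \/ Q' M rho); split.
  - apply Sg_or; auto.
  - intros; rewrite EP, EQ; tauto.
Qed.

Lemma scons_eta {X} (rho : nat -> X) : scons (rho 0) (fun i => rho (S i)) = rho.
Proof. extensionality i; destruct i; auto. Qed.

Lemma S1_ex (P : nat -> env -> Prop) :
  S1 (fun rho => P (rho 0) (fun i => rho (S i))) -> S1 (fun rho => exists x, P x rho).
Proof.
  intros (P' & HP & E); exists (fun M rho => exists x, P' M (scons x rho)); split.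
  - apply (Sg_ex 0 (fun M x rho => P' M (scons x rho))).
    eapply Sg_iff; [|exact HP]; intros; rewrite scons_eta; tauto.
  - intros rho; split; intros [x Hx]; exists x; apply (E (scons x rho)); auto.
Qed.

Lemma S1_ball_var (P : nat -> env -> Prop) :
  S1 (fun rho => P (rho 0) (fun i => rho (S i))) ->
  S1 (fun rho => forall x, x < rho 0 -> P x (fun i => rho (S i))).
Proof.
  intros (P' & HP & E).
  exists (fun M rho => forall x, ilt x (rho 0) -> P' M (scons x (fun i => rho (S i)))); split.
  - apply (Sg_ball 1 (fun M rho => rho 0) (fun M x rho => P' M (scons x (fun i => rho (S i))))).
    { tm. }
    eapply Sg_iff; [|apply (Sg_comp 1 P' (fun i M rho =>
      match i with 0 => rho 0 | S i => rho (S (S i)) end)); eauto].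
    + intros M rho; simpl.
      replace (fun i => match i with 0 => rho 0 | S i => rho (S (S i)) end) with
        (scons (rho 0) (fun i => rho (S (S i)))); [tauto|extensionality i; destruct i; auto].
    + intros [|i]; apply Tm_var.
  - intros rho; simpl; split; intros H x Hx; apply (E (scons x (fun i => rho (S i)))); auto;
      apply H; auto.
Qed.

Lemma S1_subst (P : nat -> env -> Prop) f :
  S1 (fun rho => P (rho 0) (fun i => rho (S i))) -> Sfn f -> S1 (fun rho => P (f rho) rho).
Proof.
  intros HP Hf. apply (S1_iff (fun rho => exists x, x = f rho /\ P x rho)).
  - intros rho; split; [intros (x & -> & H); auto|eauto].
  - apply S1_ex, S1_and; auto.
Qed.

Lemma S1_comp R (h : nat -> nat) : S1 R -> S1 (fun rho => R (fun i => rho (h i))).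
Proof.
  intros (R' & HR & E); exists (fun M rho => R' M (fun i => rho (h i))); split.
  - apply (Sg_comp 1 R' (fun i M rho => rho (h i))); auto. intros; apply Tm_var.
  - intros; apply E.
Qed.

Lemma Sfn_shift f : Sfn f -> Sfn (fun rho => f (fun i => rho (S i))).
Proof.
  intros H; exact (S1_comp _ (fun i => match i with 0 => 0 | S i => S (S i) end) H).
Qed.

Lemma S1_ball f (P : nat -> env -> Prop) : Sfn f ->
  S1 (fun rho => P (rho 0) (fun i => rho (S i))) ->
  S1 (fun rho => forall x, x < f rho -> P x rho).
Proof.
  intros Hf HP.
  apply (S1_subst (fun y rho => forall x, x < y -> P x rho)); auto. apply S1_ball_var; auto.
Qed.

Lemma S1_app1 (Q : nat -> Prop) f :
  S1 (fun rho => Q (rho 0)) -> Sfn f -> S1 (fun rho => Q (f rho)).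
Proof. intros HQ Hf; apply (S1_subst (fun x rho => Q x)); auto. Qed.

Lemma S1_app2 (Q : nat -> nat -> Prop) f g :
  S1 (fun rho => Q (rho 0) (rho 1)) -> Sfn f -> Sfn g -> S1 (fun rho => Q (f rho) (g rho)).
Proof.
  intros HQ Hf Hg. apply (S1_subst (fun x rho => Q x (g rho))); auto.
  apply (S1_subst (fun y rho => Q (rho 0) y)); [|apply Sfn_shift; auto].
  exact (S1_comp _ (fun i => match i with 0 => 1 | _ => 0 end) HQ).
Qed.

Lemma S1_app3 (Q : nat -> nat -> nat -> Prop) f g h :
  S1 (fun rho => Q (rho 0) (rho 1) (rho 2)) -> Sfn f -> Sfn g -> Sfn h ->
  S1 (fun rho => Q (f rho) (g rho) (h rho)).
Proof.
  intros HQ Hf Hg Hh. apply (S1_subst (fun x rho => Q x (g rho) (h rho))); auto.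
  apply (S1_subst (fun y rho => Q (rho 0) y (h (fun i => rho (S i))))); [|apply Sfn_shift; auto].
  apply (S1_subst (fun z rho => Q (rho 1) (rho 0) z));
    [|apply (Sfn_shift (fun rho => h (fun i => rho (S i)))), Sfn_shift; auto].
  exact (S1_comp _ (fun i => match i with 0 => 2 | 1 => 1 | _ => 0 end) HQ).
Qed.

Ltac s1D0 R := apply (S1_D0 _ R); [d0 | intros; simpl; unfold scons; simpl; tauto].

Lemma S1_False : S1 (fun rho => False).
Proof. s1D0 (fun (M : model) (rho : nat -> M) => False). Qed.
Lemma Sfn_var i : Sfn (fun rho => rho i).
Proof. unfold Sfn. s1D0 (fun (M : model) (rho : nat -> M) => rho 0 = rho (S i)). Qed.
Lemma S1_eq f g : Sfn f -> Sfn g -> S1 (fun rho => f rho = g rho).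
Proof.
  apply (S1_app2 (fun x y => x = y)). s1D0 (fun (M : model) (rho : nat -> M) => rho 0 = rho 1).
Qed.
Lemma S1_neq f g : Sfn f -> Sfn g -> S1 (fun rho => f rho <> g rho).
Proof.
  apply (S1_app2 (fun x y => x <> y)). s1D0 (fun (M : model) (rho : nat -> M) => rho 0 <> rho 1).
Qed.
Lemma S1_lt f g : Sfn f -> Sfn g -> S1 (fun rho => f rho < g rho).
Proof.
  apply (S1_app2 (fun x y => x < y)). s1D0 (fun (M : model) (rho : nat -> M) => ilt (rho 0) (rho 1)).
Qed.
Lemma S1_le f g : Sfn f -> Sfn g -> S1 (fun rho => f rho <= g rho).
Proof.
  apply (S1_app2 (fun x y => x <= y)).
  apply (S1_D0 _ (fun (M : model) (rho : nat -> M) => ilt (rho 0) (iS (rho 1)))); [d0|].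
  intros; simpl. unfold Nat.lt. lia.
Qed.
Lemma S1_mem f g : Sfn f -> Sfn g -> S1 (fun rho => mem (M := N) (f rho) (g rho)).
Proof.
  apply (S1_app2 (fun x y => mem (M := N) x y)).
  apply (S1_D0 _ (fun (M : model) (rho : nat -> M) => mem (rho 0) (rho 1))); [d0|]. intros; tauto.
Qed.
Lemma S1_not_mem f g : Sfn f -> Sfn g -> S1 (fun rho => ~ mem (M := N) (f rho) (g rho)).
Proof.
  apply (S1_app2 (fun x y => ~ mem (M := N) x y)).
  apply (S1_D0 _ (fun (M : model) (rho : nat -> M) => ~ mem (rho 0) (rho 1))); [d0|]. intros; tauto.
Qed.

Lemma Sfn_app1 (F : nat -> nat) f : S1 (fun rho => rho 0 = F (rho 1)) -> Sfn f ->
  Sfn (fun rho => F (f rho)).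
Proof.
  intros HF Hf. apply (S1_app2 (fun x y => x = F y) (fun rho => rho 0) (fun rho => f (fun i => rho (S i)))); auto.
  - apply Sfn_var.
  - apply Sfn_shift; auto.
Qed.
Lemma Sfn_app2 (F : nat -> nat -> nat) f g : S1 (fun rho => rho 0 = F (rho 1) (rho 2)) ->
  Sfn f -> Sfn g -> Sfn (fun rho => F (f rho) (g rho)).
Proof.
  intros HF Hf Hg. apply (S1_app3 (fun x y z => x = F y z) (fun rho => rho 0)
    (fun rho => f (fun i => rho (S i))) (fun rho => g (fun i => rho (S i)))); auto.
  - apply Sfn_var.
  - apply Sfn_shift; auto.
  - apply Sfn_shift; auto.
Qed.
Lemma Sfn_S f : Sfn f -> Sfn (fun rho => S (f rho)).
Proof. apply Sfn_app1. s1D0 (fun (M : model) (rho : nat -> M) => rho 0 = iS (rho 1)). Qed.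
Lemma Sfn_const k : Sfn (fun rho => k).
Proof.
  induction k as [|k IH]; [|apply Sfn_S; auto].
  unfold Sfn. s1D0 (fun (M : model) (rho : nat -> M) => rho 0 = i0).
Qed.
Lemma Sfn_add f g : Sfn f -> Sfn g -> Sfn (fun rho => f rho + g rho).
Proof.
  apply (Sfn_app2 Nat.add). s1D0 (fun (M : model) (rho : nat -> M) => rho 0 = iadd (rho 1) (rho 2)).
Qed.
Lemma Sfn_to_nat f g : Sfn f -> Sfn g -> Sfn (fun rho => to_nat (f rho, g rho)).
Proof.
  apply (Sfn_app2 (fun x y => to_nat (x, y))).
  (* Both sides are doubled to remove the halving from Cantor's pairing. *)
  apply (S1_D0 _ (fun (M : model) (rho : nat -> M) => iadd (rho 0) (rho 0) =
    iadd (iadd (rho 2) (rho 2)) (imul (iadd (rho 2) (rho 1)) (iS (iadd (rho 2) (rho 1)))))); [d0|].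
  intros rho. change (rho 0 = to_nat (rho 1, rho 2) <->
    rho 0 + rho 0 = (rho 2 + rho 2) + (rho 2 + rho 1) * S (rho 2 + rho 1)).
  pose proof (to_nat_spec (rho 1) (rho 2)). split; lia.
Qed.

Ltac s1_hook := fail.
Ltac sfn_hook := fail.
Ltac sfn := cbn beta; first
  [ assumption | apply Sfn_var | apply Sfn_const | apply Sfn_S; sfn | apply Sfn_to_nat; sfn
  | apply Sfn_add; sfn | sfn_hook ].
Ltac s1 := cbn beta; first
  [ assumption | apply S1_False | apply S1_eq; sfn | apply S1_neq; sfn | apply S1_lt; sfn
  | apply S1_le; sfn | apply S1_mem; sfn | apply S1_not_mem; sfn
  | apply S1_and; s1 | apply S1_or; s1 | apply S1_ex; s1 | apply S1_ball; [sfn|s1] | s1_hook ].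

Lemma Sfn_fst f : Sfn f -> Sfn (fun rho => fst (of_nat (f rho))).
Proof.
  apply (Sfn_app1 (fun x => fst (of_nat x))).
  apply (S1_iff (fun rho => exists y, rho 1 = to_nat (rho 0, y))); [|s1].
  intros rho; split.
  - intros [y H]; rewrite H, cancel_of_to; auto.
  - intros H; exists (snd (of_nat (rho 1))). rewrite H, <- surjective_pairing, cancel_to_of; auto.
Qed.
Lemma Sfn_snd f : Sfn f -> Sfn (fun rho => snd (of_nat (f rho))).
Proof.
  apply (Sfn_app1 (fun x => snd (of_nat x))).
  apply (S1_iff (fun rho => exists y, rho 1 = to_nat (y, rho 0))); [|s1].
  intros rho; split.
  - intros [y H]; rewrite H, cancel_of_to; auto.
  - intros H; exists (fst (of_nat (rho 1))). rewrite H, <- surjective_pairing, cancel_to_of; auto.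
Qed.
Ltac sfn_hook ::= first [apply Sfn_fst; sfn | apply Sfn_snd; sfn].

(** * Inductively defined sets *)

(** In the standard model the induction runs outside the model, so [D] may be arbitrary, whereas
    [comprehension] asks for a definable relation. *)
Lemma finite_set (D : nat -> Prop) b : exists c, forall x, mem (M := N) x c <-> x < b /\ D x.
Proof.
  induction b as [|b [c Hc]].
  - destruct (empty_set N) as [c Hc]; exists c; intros x; split; [intros H; destruct (Hc _ H)|lia].
  - destruct (classic (D b)) as [Hb|Hb].
    + destruct (insert N c b) as [c' Hc']; exists c'; intros x; rewrite Hc', Hc.
      split.
      * intros [[H1 H2]| ->]; split; auto.
      * intros [H1 H2]. destruct (Nat.eq_dec x b) as [->|]; [auto|left; split; auto; lia].
    + exists c; intros x; rewrite Hc.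
      split; intros [H1 H2]; split; auto.
      destruct (Nat.eq_dec x b) as [->|]; [tauto|lia].
Qed.

Lemma finite_collection (A : nat -> nat -> Prop) b :
  (forall x, x < b -> exists y, A x y) -> exists B, forall x, x < b -> exists y, y < B /\ A x y.
Proof.
  induction b as [|b IH]; intros H; [exists 0; lia|].
  destruct IH as [B HB]; [intros; apply H; lia|]. destruct (H b) as [y Hy]; [lia|].
  exists (B + S y); intros x Hx. destruct (Nat.eq_dec x b) as [->|].
  - exists y; split; auto; lia.
  - destruct (HB x) as (z & Hz & Ha); [lia|]. exists z; split; auto; lia.
Qed.

(** An inductive definition with finitely many premises, collected in the coded set [l].
    Computations, substitution and derivability are all instances, so a single argument makes them
    Sigma_1. *)
Inductive Least (step : nat -> nat -> Prop) : nat -> Prop :=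
| Least_intro c l : step c l -> (forall p, mem (M := N) p l -> Least step p) -> Least step c.

Section Least.
Variable step : nat -> nat -> Prop.
Hypothesis Hstep : S1 (fun rho => step (rho 0) (rho 1)).

(* [w] contains pairs of a rank and an element, each of which follows by [step]
   from elements of smaller rank. *)
Definition table (w : nat) : Prop :=
  forall z, z < w -> ~ mem (M := N) z w \/ exists r c l, z = to_nat (r, c) /\ step c l /\
    forall p, p < l -> ~ mem (M := N) p l \/ exists r', r' < r /\ mem (M := N) (to_nat (r', p)) w.

Lemma table_sound w : table w ->
  forall r c, mem (M := N) (to_nat (r, c)) w -> Least step c.
Proof.
  intros Hw r; induction r as [r IH] using lt_wf_ind; intros c Hc.
  destruct (Hw (to_nat (r, c))) as [H|(r' & c' & l & E & Hs & H)]; [apply (mem_lt N); auto|tauto|].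
  apply to_nat_inj2 in E as [<- <-].
  apply Least_intro with l; auto. intros p Hp.
  destruct (H p) as [Hn|(r' & Hr & Hm)]; [apply (mem_lt N); auto|tauto|]. eauto.
Qed.

(** The number [B] exceeds some table and some rank for every premise. The union of all tables below
    [B], with [c] added at rank [B], is again a table. *)
Lemma table_complete c : Least step c -> exists w r, table w /\ mem (M := N) (to_nat (r, c)) w.
Proof.
  induction 1 as [c l Hs _ IH].
  destruct (finite_collection (fun p y => mem (M := N) p l ->
    exists w r, w < y /\ r < y /\ table w /\ mem (M := N) (to_nat (r, p)) w) l) as [B HB].
  { intros p _. destruct (classic (mem (M := N) p l)) as [Hp|Hp]; [|exists 0; tauto].
    destruct (IH p Hp) as (w & r & Hw & Hm); exists (S (w + r)); intros _; exists w, r.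
    repeat split; auto; lia. }
  destruct (finite_set (fun z => z = to_nat (B, c) \/
    exists w, w < B /\ table w /\ mem (M := N) z w) (S (to_nat (B, c)) + B)) as [w Hw].
  assert (Hin : forall z w', w' < B -> table w' -> mem (M := N) z w' -> mem (M := N) z w).
  { intros z w' H1 H2 H3; apply Hw; split; [|right; eauto].
    pose proof (mem_lt N _ _ H3) as L; simpl in L; unfold Nat.lt in L; lia. }
  exists w, B; split; [|apply Hw; split; [lia|auto]].
  intros z _. destruct (classic (mem (M := N) z w)) as [Hz|]; [right|auto].
  apply Hw in Hz as [_ [->|(w' & Hw1 & Hw2 & Hz)]].
  - exists B, c, l; repeat split; auto. intros p Hp.
    destruct (classic (mem (M := N) p l)) as [Hpl|]; [right|auto].
    destruct (HB p Hp) as (y & Hy & H). destruct (H Hpl) as (w' & r & H1 & H2 & H3 & H4).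
    exists r; split; [lia|]. apply (Hin _ w'); auto; lia.
  - destruct (Hw2 z) as [Hn|(r & c' & l' & E & Hs' & H)]; [apply (mem_lt N); auto|tauto|].
    exists r, c', l'; repeat split; auto. intros p Hp.
    destruct (H p Hp) as [|(r' & Hr & Hm)]; [left; auto|right].
    exists r'; split; auto. apply (Hin _ w'); auto.
Qed.

(** The table is the existential witness. Its implications from membership are written as
    disjunctions with a negated Delta0 relation, which stay Sigma_1. *)
Lemma S1_Least : S1 (fun rho => Least step (rho 0)).
Proof.
  apply (S1_iff (fun rho => exists w r, table w /\ mem (M := N) (to_nat (r, rho 0)) w)).
  - intros rho; split; [intros (w & r & H1 & H2); eapply table_sound; eauto|apply table_complete].
  - unfold table.
    assert (H : forall f g, Sfn f -> Sfn g -> S1 (fun rho => step (f rho) (g rho)))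
      by (intros; apply (S1_app2 step); auto).
    do 2 apply S1_ex. apply S1_and; [|s1]. cbn beta. apply S1_ball; [sfn|].
    apply S1_or; [s1|]. do 3 apply S1_ex; cbn beta. apply S1_and; [s1|]. apply S1_and; [apply H; sfn|].
    s1.
Qed.

End Least.

(** * Computably enumerable sets are Sigma_1 *)

Lemma set2 (a b : nat) : exists l, forall p, mem (M := N) p l <-> p = a \/ p = b.
Proof.
  destruct (finite_set (fun p => p = a \/ p = b) (S (a + b))) as [l Hl].
  exists l; intros p; rewrite Hl; split; [tauto|]. intros [->| ->]; split; auto; lia.
Qed.

(** The graph of the recursion is an inductively defined set of triples of argument, stage and
    value, so no coded computation sequence is needed. *)
Lemma S1_eval_rec (P Q : nat -> nat -> Prop) :
  S1 (fun rho => P (rho 0) (rho 1)) -> S1 (fun rho => Q (rho 0) (rho 1)) ->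
  S1 (fun rho => eval_rec P Q (rho 0) (rho 1) (rho 2)).
Proof.
  intros HP HQ.
  pose (step := fun c l => exists x m v, c = to_nat (x, to_nat (m, v)) /\
    ((m = 0 /\ P x v) \/ exists m' v', m = S m' /\
      mem (M := N) (to_nat (x, to_nat (m', v'))) l /\ Q (to_nat (x, to_nat (m', v'))) v)).
  assert (Hs : S1 (fun rho => step (rho 0) (rho 1))).
  { assert (HP' : forall f g, Sfn f -> Sfn g -> S1 (fun rho => P (f rho) (g rho)))
      by (intros; apply (S1_app2 P); auto).
    assert (HQ' : forall f g, Sfn f -> Sfn g -> S1 (fun rho => Q (f rho) (g rho)))
      by (intros; apply (S1_app2 Q); auto).
    unfold step. do 3 apply S1_ex; cbn beta. apply S1_and; [s1|].
    apply S1_or; [apply S1_and; [s1|apply HP'; sfn]|].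
    do 2 apply S1_ex; cbn beta. apply S1_and; [s1|]. apply S1_and; [s1|apply HQ'; sfn]. }
  apply (S1_iff (fun rho => Least step (to_nat (rho 0, to_nat (rho 1, rho 2))))).
  - intros rho. generalize (rho 0) (rho 1) (rho 2). clear rho. intros x n y. split.
    + intros H. remember (to_nat (x, to_nat (n, y))) as c eqn:Ec. revert n y Ec.
      induction H as [c l (x' & m & v & E & H) _ IH]; intros n y ->.
      apply to_nat_inj2 in E as [<- E]; apply to_nat_inj2 in E as [<- <-].
      destruct H as [[-> Hp]|(m' & v' & -> & Hm & Hq)]; simpl; auto.
      exists v'; split; auto. eapply IH; eauto.
    + revert y; induction n as [|n IH]; intros y; simpl.
      * intros Hp. destruct (empty_set N) as [l Hl]. apply Least_intro with l.
        -- exists x, 0, y; auto.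
        -- intros p Hp'; destruct (Hl p Hp').
      * intros (z & Hz & Hq). destruct (set2 (to_nat (x, to_nat (n, z))) (to_nat (x, to_nat (n, z)))) as [l Hl].
        apply Least_intro with l.
        -- exists x, (S n), y; split; auto. right; exists n, z; repeat split; auto. apply Hl; auto.
        -- intros p Hp. apply Hl in Hp as [->| ->]; auto.
  - apply (S1_app1 (Least step)); [apply S1_Least; auto|sfn].
Qed.

Lemma S1_eval p : S1 (fun rho => eval p (rho 0) (rho 1)).
Proof.
  assert (A2 : forall R : nat -> nat -> Prop, S1 (fun rho => R (rho 0) (rho 1)) ->
    forall f g, Sfn f -> Sfn g -> S1 (fun rho => R (f rho) (g rho)))
    by (intros; apply (S1_app2 R); auto).
  induction p as [| | | |p IHp q IHq|p IHp q IHq|p IHp q IHq|p IHp]; simpl; try s1.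
  - do 2 apply S1_ex; cbn beta. apply S1_and; [apply (A2 (eval p)); auto; sfn|].
    apply S1_and; [apply (A2 (eval q)); auto; sfn|s1].
  - apply S1_ex; cbn beta. apply S1_and; [apply (A2 (eval q))|apply (A2 (eval p))]; auto; sfn.
  - apply (S1_app3 (eval_rec (eval p) (eval q)));
      [apply S1_eval_rec; auto|sfn..].
  - apply S1_and; [apply (A2 (eval p)); auto; sfn|]. apply S1_ball; [sfn|].
    apply S1_ex; apply (A2 (eval p)); auto; sfn.
Qed.

Lemma ce_S1 A : ce_set A -> S1 (fun rho => A (rho 0)).
Proof.
  intros [p Hp]. apply (S1_iff (fun rho => exists y, eval p (rho 0) y)).
  - intros; symmetry; apply Hp.
  - apply S1_ex. apply (S1_app2 (eval p)); [apply S1_eval|sfn..].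
Qed.

(** * The standard cut of a model *)

Section Cut.
Variable M : model.
Implicit Types x y : M.

Definition nu (k : nat) : M := Nat.iter k iS i0.

Lemma ev_numeral (rho : nat -> M) k : ev rho (numeral k) = nu k.
Proof. induction k as [|k IH]; simpl; auto. f_equal; apply IH. Qed.

Lemma nu_add a b : nu (a + b) = iadd (nu a) (nu b).
Proof.
  induction a as [|a IH]; simpl; [rewrite add_0_l; auto|rewrite add_S_l; f_equal; apply IH].
Qed.

Lemma nu_mul a b : nu (a * b) = imul (nu a) (nu b).
Proof.
  induction a as [|a IH]; simpl; [rewrite mul_0_l; auto|].
  rewrite nu_add, IH, mul_S_l, add_comm; auto.
Qed.

Lemma nu_inj a b : nu a = nu b -> a = b.
Proof.
  revert b; induction a as [|a IH]; intros [|b] H; simpl in H; auto.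
  - symmetry in H; destruct (S_neq_0 M _ H).
  - destruct (S_neq_0 M _ H).
  - f_equal; apply IH, (S_inj M); auto.
Qed.

(** This is how standard stages are separated from nonstandard ones: whatever precedes a standard
    stage is standard too. *)
Lemma lt_nu k x : ilt x (nu k) <-> exists j, j < k /\ x = nu j.
Proof.
  induction k as [|k IH]; simpl.
  - split; [intros H; destruct (not_lt_0 _ _ H)|intros (j & Hj & _); lia].
  - split.
    + intros H. apply (lt_S_iff M), le_lt_or_eq in H as [H|H]; [|exists k; auto].
      apply IH in H as (j & Hj & ->); exists j; split; auto; lia.
    + intros (j & Hj & ->). destruct (Nat.eq_dec j k) as [->|]; [apply (le_refl M)|].
      eapply lt_trans; [apply IH; exists j; split; [lia|reflexivity]|apply (le_refl M)].
Qed.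

Lemma ev_nu (rho : nat -> nat) t : ev (fun i => nu (rho i)) t = nu (ev (M := N) rho t).
Proof.
  induction t; simpl; auto.
  - rewrite IHt; auto.
  - rewrite IHt1, IHt2, <- nu_add; auto.
  - rewrite IHt1, IHt2, <- nu_mul; auto.
Qed.

Lemma scons_nu (x : nat) (rho : nat -> nat) :
  scons (nu x) (fun i => nu (rho i)) = (fun i => nu (scons x rho i)).
Proof. extensionality i; destruct i; auto. Qed.

Lemma nu_lt a b : ilt (nu a) (nu b) <-> a < b.
Proof.
  rewrite lt_nu; split; [intros (j & Hj & E); apply nu_inj in E; subst; auto|eauto].
Qed.

Lemma Delta0_absolute a : Delta0 a -> forall rho : nat -> nat,
  sat (M := N) rho a <-> sat (fun i => nu (rho i)) a.
Proof.
  assert (Hsh : forall (K : model) (x : K) (rho : nat -> K) t,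
            ev (scons x rho) (shift_term t) = ev rho t).
  { intros; unfold shift_term; rewrite ev_subst; auto. }
  induction 1; intros rho; simpl; rewrite ?ev_nu.
  - split; [intros E; apply (f_equal nu E)|apply nu_inj].
  - rewrite nu_lt; reflexivity.
  - tauto.
  - rewrite IHDelta0_1, IHDelta0_2; tauto.
  - rewrite IHDelta0_1, IHDelta0_2; tauto.
  - rewrite IHDelta0_1, IHDelta0_2; tauto.
  - split.
    + intros Hx x; rewrite Hsh, ev_nu, lt_nu; intros (j & Hj & ->).
      rewrite scons_nu; apply IHDelta0, Hx.
      pose proof (Hsh N j rho t) as E; simpl in E; rewrite E; auto.
    + intros Hx x Hl. pose proof (Hsh N x rho t) as E; simpl in E; rewrite E in Hl.
      apply IHDelta0; rewrite <- scons_nu; apply Hx. rewrite Hsh, ev_nu, nu_lt; auto.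
  - split.
    + intros (x & Hl & Hx). pose proof (Hsh N x rho t) as E; simpl in E; rewrite E in Hl.
      exists (nu x); rewrite Hsh, ev_nu, nu_lt, scons_nu; split; auto. apply IHDelta0; auto.
    + intros (x & Hl & Hx). rewrite Hsh, ev_nu, lt_nu in Hl; destruct Hl as (j & Hj & ->).
      rewrite scons_nu in Hx; exists j; split; [|apply IHDelta0; auto].
      pose proof (Hsh N j rho t) as E; simpl in E; rewrite E; auto.
Qed.

Lemma D0_absolute R : D0 R -> forall rho : nat -> nat, R N rho <-> R M (fun i => nu (rho i)).
Proof. intros (a & Ha & H) rho; rewrite !H; apply Delta0_absolute; auto. Qed.

End Cut.

Notation "⟨ x , y ⟩" := (to_nat (x, y)) (at level 0).
Notation "x ∈ l" := (mem (M := N) x l) (at level 70).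

(** * Arithmetization of substitution *)

Lemma iter_up_lt k sigma i : i < k -> Nat.iter k up sigma i = Var i.
Proof.
  revert i; induction k as [|k IH]; intros i H; [lia|]. simpl.
  destruct i as [|i]; simpl; auto. rewrite IH; [reflexivity|lia].
Qed.

Lemma iter_up_ge k sigma d :
  Nat.iter k up sigma (k + d) = subst_term (fun i => Var (k + i)) (sigma d).
Proof.
  induction k as [|k IH]; simpl; [symmetry; apply subst_term_Var|].
  rewrite IH; unfold shift_term; rewrite subst_term_subst_term; reflexivity.
Qed.

(* An operation is coded by [⟨0, j⟩] (add [j] to every variable) or by [⟨1, t⟩]
   (instantiate variable [0] by [t]); it acts below [k] binders. *)
Definition op (o : nat) : nat -> term :=
  match of_nat o with
  | (0, j) => fun i => Var (j + i)
  | (_, s) => tcons (dect s) Var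
  end.

(** The flag [f] is 0 for terms and 1 for formulas, so that one inductive set serves both. *)
Definition sub_code (f k o a a' : nat) : nat := ⟨f, ⟨k, ⟨o, ⟨a, a'⟩⟩⟩⟩.

(** A term inserted below [k] binders must be lifted by [k], which is itself the operation ⟨0, k⟩ at
    depth 0; hence a premise in [l] even in the variable case. *)
Definition sub_step_term (l k o a a' : nat) : Prop :=
  (exists i, a = ⟨0, i⟩ /\ ((i < k /\ a' = ⟨0, i⟩) \/ exists d, i = k + d /\
     ((exists j, o = ⟨0, j⟩ /\ a' = ⟨0, j + i⟩) \/
      exists s, o = ⟨1, s⟩ /\ ((d = 0 /\ sub_code 0 0 ⟨0, k⟩ s a' ∈ l) \/
        exists d', d = S d' /\ a' = ⟨0, k + d'⟩)))) \/
  (a = ⟨1, 0⟩ /\ a' = ⟨1, 0⟩) \/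
  (exists s s', a = ⟨2, s⟩ /\ a' = ⟨2, s'⟩ /\ sub_code 0 k o s s' ∈ l) \/
  (exists t s1 s2 s1' s2', (t = 3 \/ t = 4) /\ a = ⟨t, ⟨s1, s2⟩⟩ /\ a' = ⟨t, ⟨s1', s2'⟩⟩ /\
     sub_code 0 k o s1 s1' ∈ l /\ sub_code 0 k o s2 s2' ∈ l).

Definition sub_step_form (l k o a a' : nat) : Prop :=
  (exists t s1 s2 s1' s2', (t = 0 \/ t = 1) /\ a = ⟨t, ⟨s1, s2⟩⟩ /\ a' = ⟨t, ⟨s1', s2'⟩⟩ /\
     sub_code 0 k o s1 s1' ∈ l /\ sub_code 0 k o s2 s2' ∈ l) \/
  (a = ⟨2, 0⟩ /\ a' = ⟨2, 0⟩) \/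
  (exists t s1 s2 s1' s2', (t = 3 \/ t = 4 \/ t = 5) /\ a = ⟨t, ⟨s1, s2⟩⟩ /\
     a' = ⟨t, ⟨s1', s2'⟩⟩ /\ sub_code 1 k o s1 s1' ∈ l /\ sub_code 1 k o s2 s2' ∈ l) \/
  (exists t s s', (t = 6 \/ t = 7) /\ a = ⟨t, s⟩ /\ a' = ⟨t, s'⟩ /\ sub_code 1 (S k) o s s' ∈ l).

Definition sub_step (c l : nat) : Prop :=
  exists f k o a a', c = sub_code f k o a a' /\
    ((f = 0 /\ sub_step_term l k o a a') \/ (f = 1 /\ sub_step_form l k o a a')).

Definition Sub (c : nat) : Prop := Least sub_step c.

Lemma S1_Sub f : Sfn f -> S1 (fun rho => Sub (f rho)).
Proof.
  apply (S1_app1 Sub), S1_Least. unfold sub_step, sub_step_term, sub_step_form, sub_code; s1.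
Qed.

Lemma sub_code_inj f k o a b f' k' o' a' b' :
  sub_code f k o a b = sub_code f' k' o' a' b' ->
  f = f' /\ k = k' /\ o = o' /\ a = a' /\ b = b'.
Proof.
  unfold sub_code; intros E. do 4 (apply to_nat_inj2 in E as [? E]). auto.
Qed.

Ltac rw_dec :=
  rewrite ?dect_var, ?dect_zero, ?dect_succ, ?dect_plus, ?dect_mult, ?dec_eq, ?dec_lt, ?dec_bot,
    ?dec_imp, ?dec_and, ?dec_or, ?dec_all, ?dec_ex in *.

Lemma Sub_sound c : Sub c -> forall f k o a a', c = sub_code f k o a a' ->
  (f = 0 -> dect a' = subst_term (Nat.iter k up (op o)) (dect a)) /\
  (f = 1 -> dec a' = subst (Nat.iter k up (op o)) (dec a)).
Proof.
  induction 1 as [c l (f & k & o & a & a' & -> & Hs) _ IH]; intros f0 k0 o0 a0 a0' E.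
  apply sub_code_inj in E as (<- & <- & <- & <- & <-).
  destruct Hs as [[-> Hs]|[-> Hs]]; split; intros Hf; try discriminate; clear Hf.
  - destruct Hs as [(i & -> & H)|[(-> & ->)|[(s & s' & -> & -> & H)|
      (t & s1 & s2 & s1' & s2' & Ht & -> & -> & H1 & H2)]]].
    + rw_dec; simpl. destruct H as [[Hi ->]|(d & -> & H)]; [rw_dec; rewrite iter_up_lt; auto|].
      rewrite iter_up_ge. destruct H as [(j & -> & ->)|(s & -> & H)].
      * unfold op; rw_dec; rewrite cancel_of_to; simpl; f_equal; lia.
      * unfold op; rewrite cancel_of_to; simpl. destruct H as [[-> H]|(d' & -> & ->)].
        -- destruct (IH _ H _ _ _ _ _ eq_refl) as [E _]. rewrite E by auto.
           unfold op; rewrite cancel_of_to; reflexivity.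
        -- rw_dec; reflexivity.
    + rw_dec; reflexivity.
    + destruct (IH _ H _ _ _ _ _ eq_refl) as [E _]. rw_dec; simpl; rewrite E; auto.
    + destruct (IH _ H1 _ _ _ _ _ eq_refl) as [E1 _].
      destruct (IH _ H2 _ _ _ _ _ eq_refl) as [E2 _].
      destruct Ht as [->| ->]; rw_dec; simpl; rewrite E1, E2; auto.
  - destruct Hs as [(t & s1 & s2 & s1' & s2' & Ht & -> & -> & H1 & H2)|[(-> & ->)|
      [(t & s1 & s2 & s1' & s2' & Ht & -> & -> & H1 & H2)|(t & s & s' & Ht & -> & -> & H)]]].
    + destruct (IH _ H1 _ _ _ _ _ eq_refl) as [E1 _].
      destruct (IH _ H2 _ _ _ _ _ eq_refl) as [E2 _].
      destruct Ht as [->| ->]; rw_dec; simpl; rewrite E1, E2; auto.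
    + rw_dec; reflexivity.
    + destruct (IH _ H1 _ _ _ _ _ eq_refl) as [_ E1].
      destruct (IH _ H2 _ _ _ _ _ eq_refl) as [_ E2].
      destruct Ht as [->|[->| ->]]; rw_dec; simpl; rewrite E1, E2; auto.
    + destruct (IH _ H _ _ _ _ _ eq_refl) as [_ E].
      destruct Ht as [->| ->]; rw_dec; simpl; rewrite E; auto.
Qed.

Lemma set_of_list (L : list nat) : exists l, forall p, p ∈ l <-> In p L.
Proof.
  induction L as [|a L [l Hl]].
  - destruct (empty_set N) as [l Hl]; exists l; intros p; split; [intros H; destruct (Hl p H)|intros []].
  - destruct (insert N l a) as [l' Hl']; exists l'; intros p; rewrite Hl', Hl; simpl.
    split; intros [H|H]; auto.
Qed.

Lemma Least_list (step : nat -> nat -> Prop) c (L : list nat) :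
  (forall l, (forall p, In p L -> p ∈ l) -> step c l) -> (forall p, In p L -> Least step p) ->
  Least step c.
Proof.
  intros H HL; destruct (set_of_list L) as [l Hl]; apply Least_intro with l.
  - apply H; intros p; apply Hl.
  - intros p Hp; apply HL, Hl; auto.
Qed.

Ltac in_list :=
  intros ? HIn; simpl in HIn; repeat destruct HIn as [<-|HIn]; try destruct HIn; auto.

(** The variable case is left as a hypothesis because for instantiation it depends on completeness
    for lifting, which is obtained from this same lemma. *)
Lemma Sub_term_complete o :
  (forall k d, Sub (sub_code 0 k o ⟨0, k + d⟩ (code_term (Nat.iter k up (op o) (k + d))))) ->
  forall t k, Sub (sub_code 0 k o (code_term t) (code_term (subst_term (Nat.iter k up (op o)) t))).
Proof.
  intros Hv; induction t as [i| |s IH|s IHs t IHt|s IHs t IHt]; intros k; simpl.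
  - destruct (le_lt_dec k i) as [L|L].
    + replace i with (k + (i - k)) by lia. apply Hv.
    + rewrite iter_up_lt by auto. apply (Least_list _ _ []); [|in_list].
      intros l _; exists 0, k, o, ⟨0, i⟩, ⟨0, i⟩; split; auto. left; split; auto.
      left; exists i; auto.
  - apply (Least_list _ _ []); [|in_list].
    intros l _; do 5 eexists; split; [reflexivity|]. left; split; auto. right; left; auto.
  - apply (Least_list _ _ [sub_code 0 k o (code_term s) (code_term (subst_term (Nat.iter k up (op o)) s))]);
      [|in_list; apply IH].
    intros l Hl; do 5 eexists; split; [reflexivity|]. left; split; auto. right; right; left.
    do 2 eexists; repeat split; auto. apply Hl; left; auto.
  - apply (Least_list _ _ [sub_code 0 k o (code_term s) (code_term (subst_term (Nat.iter k up (op o)) s));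
      sub_code 0 k o (code_term t) (code_term (subst_term (Nat.iter k up (op o)) t))]);
      [|in_list; [apply IHs|apply IHt]].
    intros l Hl; do 5 eexists; split; [reflexivity|]. left; split; auto. right; right; right.
    exists 3; do 4 eexists; repeat split; auto; apply Hl; simpl; auto.
  - apply (Least_list _ _ [sub_code 0 k o (code_term s) (code_term (subst_term (Nat.iter k up (op o)) s));
      sub_code 0 k o (code_term t) (code_term (subst_term (Nat.iter k up (op o)) t))]);
      [|in_list; [apply IHs|apply IHt]].
    intros l Hl; do 5 eexists; split; [reflexivity|]. left; split; auto. right; right; right.
    exists 4; do 4 eexists; repeat split; auto; apply Hl; simpl; auto.
Qed.

Lemma Sub_add_complete j t k :
  Sub (sub_code 0 k ⟨0, j⟩ (code_term t) (code_term (subst_term (Nat.iter k up (op ⟨0, j⟩)) t))).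
Proof.
  apply Sub_term_complete; clear; intros k d.
  rewrite iter_up_ge; unfold op; rewrite cancel_of_to; simpl.
  apply (Least_list _ _ []); [|in_list].
  intros l _; do 5 eexists; split; [reflexivity|]. left; split; auto. left.
  exists (k + d); split; auto. right; exists d; split; auto. left; exists j; split; auto.
  f_equal; f_equal; lia.
Qed.

Lemma Sub_inst_complete s t k :
  Sub (sub_code 0 k ⟨1, code_term s⟩ (code_term t)
        (code_term (subst_term (Nat.iter k up (op ⟨1, code_term s⟩)) t))).
Proof.
  apply Sub_term_complete; clear; intros k d.
  rewrite iter_up_ge. unfold op at 1; rewrite cancel_of_to, dect_code.
  destruct d as [|d].
  - pose proof (Sub_add_complete k s 0) as H. simpl in H. simpl.
    replace (op ⟨0, k⟩) with (fun i => Var (k + i)) in H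
      by (unfold op; rewrite cancel_of_to; auto).
    apply (Least_list _ _ [sub_code 0 0 ⟨0, k⟩ (code_term s)
      (code_term (subst_term (fun i => Var (k + i)) s))]); [|in_list].
    intros l Hl; do 5 eexists; split; [reflexivity|]. left; split; auto. left.
    exists (k + 0); split; auto. right; exists 0; split; auto. right; exists (code_term s).
    split; auto. left; split; auto. apply Hl; left; auto.
  - simpl. apply (Least_list _ _ []); [|in_list].
    intros l _; do 5 eexists; split; [reflexivity|]. left; split; auto. left.
    exists (k + S d); split; auto. right; exists (S d); split; auto. right; exists (code_term s).
    split; auto. right; exists d; auto.
Qed.

Lemma Sub_form_complete o :
  (forall t k, Sub (sub_code 0 k o (code_term t) (code_term (subst_term (Nat.iter k up (op o)) t)))) ->
  forall a k, Sub (sub_code 1 k o (code a) (code (subst (Nat.iter k up (op o)) a))).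
Proof.
  intros Ht. induction a as [s t|s t| |a IHa b IHb|a IHa b IHb|a IHa b IHb|a IH|a IH]; intros k; simpl.
  1-2: apply (Least_list _ _ [sub_code 0 k o (code_term s) (code_term (subst_term (Nat.iter k up (op o)) s));
      sub_code 0 k o (code_term t) (code_term (subst_term (Nat.iter k up (op o)) t))]);
      [|in_list; apply Ht];
    intros l Hl; do 5 eexists; split; [reflexivity|]; right; split; auto; left;
    do 5 eexists; split; [|split; [reflexivity|split; [reflexivity|split; apply Hl; simpl; auto]]]; auto.
  - apply (Least_list _ _ []); [|in_list].
    intros l _; do 5 eexists; split; [reflexivity|]. right; split; auto. right; left; auto.
  - apply (Least_list _ _ [sub_code 1 k o (code a) (code (subst (Nat.iter k up (op o)) a));
      sub_code 1 k o (code b) (code (subst (Nat.iter k up (op o)) b))]);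
      [|in_list; [apply IHa|apply IHb]].
    intros l Hl; do 5 eexists; split; [reflexivity|]; right; split; auto; right; right; left.
    exists 3; do 4 eexists; repeat split; auto; apply Hl; simpl; auto.
  - apply (Least_list _ _ [sub_code 1 k o (code a) (code (subst (Nat.iter k up (op o)) a));
      sub_code 1 k o (code b) (code (subst (Nat.iter k up (op o)) b))]);
      [|in_list; [apply IHa|apply IHb]].
    intros l Hl; do 5 eexists; split; [reflexivity|]; right; split; auto; right; right; left.
    exists 4; do 4 eexists; repeat split; auto; apply Hl; simpl; auto.
  - apply (Least_list _ _ [sub_code 1 k o (code a) (code (subst (Nat.iter k up (op o)) a));
      sub_code 1 k o (code b) (code (subst (Nat.iter k up (op o)) b))]);
      [|in_list; [apply IHa|apply IHb]].
    intros l Hl; do 5 eexists; split; [reflexivity|]; right; split; auto; right; right; left.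
    exists 5; do 4 eexists; repeat split; auto; apply Hl; simpl; auto.
  - apply (Least_list _ _ [sub_code 1 (S k) o (code a) (code (subst (Nat.iter (S k) up (op o)) a))]);
      [|in_list; apply IH].
    intros l Hl; do 5 eexists; split; [reflexivity|]; right; split; auto; right; right; right.
    exists 6; do 2 eexists; repeat split; auto; apply Hl; simpl; auto.
  - apply (Least_list _ _ [sub_code 1 (S k) o (code a) (code (subst (Nat.iter (S k) up (op o)) a))]);
      [|in_list; apply IH].
    intros l Hl; do 5 eexists; split; [reflexivity|]; right; split; auto; right; right; right.
    exists 7; do 2 eexists; repeat split; auto; apply Hl; simpl; auto.
Qed.

Definition Inst (t a a' : nat) : Prop := Sub (sub_code 1 0 ⟨1, t⟩ a a').
Definition Shift (a a' : nat) : Prop := Sub (sub_code 1 0 ⟨0, 1⟩ a a').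

Lemma Inst_sound t a a' : Inst t a a' -> dec a' = inst (dect t) (dec a).
Proof.
  intros H. destruct (Sub_sound _ H _ _ _ _ _ eq_refl) as [_ E]. rewrite E by auto.
  simpl; unfold op; rewrite cancel_of_to; reflexivity.
Qed.

Lemma Shift_sound a a' : Shift a a' -> dec a' = shift (dec a).
Proof.
  intros H. destruct (Sub_sound _ H _ _ _ _ _ eq_refl) as [_ E]. rewrite E by auto.
  simpl; unfold op; rewrite cancel_of_to; reflexivity.
Qed.

Lemma Inst_complete t a : Inst (code_term t) (code a) (code (inst t a)).
Proof.
  pose proof (Sub_form_complete ⟨1, code_term t⟩ (Sub_inst_complete t) a 0) as H.
  simpl in H. replace (op ⟨1, code_term t⟩) with (tcons t Var) in H; [exact H|].
  unfold op; rewrite cancel_of_to, dect_code; auto.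
Qed.

Lemma Shift_complete a : Shift (code a) (code (shift a)).
Proof.
  pose proof (Sub_form_complete ⟨0, 1⟩ (fun t k => Sub_add_complete 1 t k) a 0) as H.
  simpl in H. replace (op ⟨0, 1⟩) with (fun i => Var (S i)) in H; [exact H|].
  unfold op; rewrite cancel_of_to; auto.
Qed.

Definition num_step (c l : nat) : Prop :=
  exists k t, c = ⟨k, t⟩ /\ ((k = 0 /\ t = ⟨1, 0⟩) \/
    exists k' t', k = S k' /\ t = ⟨2, t'⟩ /\ ⟨k', t'⟩ ∈ l).

Lemma Num_iff k t : Least num_step ⟨k, t⟩ <-> t = code_term (numeral k).
Proof.
  split.
  - intros H; remember ⟨k, t⟩ as c eqn:E; revert k t E.
    induction H as [c l (k' & t' & E' & H) _ IH]; intros k t ->.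
    apply to_nat_inj2 in E' as [<- <-]. destruct H as [[-> ->]|(k' & t' & -> & -> & H)]; auto.
    simpl; rewrite (IH _ H _ _ eq_refl); auto.
  - intros ->; induction k as [|k IH].
    + apply (Least_list _ _ []); [|in_list]. intros l _; do 2 eexists; split; [reflexivity|]; auto.
    + apply (Least_list _ _ [⟨k, code_term (numeral k)⟩]); [|in_list].
      intros l Hl; do 2 eexists; split; [reflexivity|]. right; do 2 eexists.
      split; [reflexivity|split; [reflexivity|apply Hl; left; auto]].
Qed.

Lemma Sfn_numeral f : Sfn f -> Sfn (fun rho => code_term (numeral (f rho))).
Proof.
  apply (Sfn_app1 (fun k => code_term (numeral k))).
  apply (S1_iff (fun rho => Least num_step ⟨rho 1, rho 0⟩)).
  - intros; apply Num_iff.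
  - apply (S1_app1 (Least num_step)); [|sfn]. apply S1_Least. unfold num_step; s1.
Qed.

Ltac s1_hook ::= first [apply S1_Sub; sfn].

(** * Arithmetization of provability *)

Section Provability.
Variable T : theory.
Hypothesis HT : is_theory T.
Hypothesis T_ce : ce_theory T.

Definition Axm (c : nat) : Prop := exists a, T a /\ code a = c.

Lemma S1_Axm f : Sfn f -> S1 (fun rho => Axm (f rho)).
Proof. apply (S1_app1 Axm), ce_S1, T_ce. Qed.

(** Inclusion is enough: a smaller context in a premise cannot harm soundness, and the disjunctive
    form keeps the relation Sigma_1. *)
Definition ext (g g' x : nat) : Prop := forall p, p < g' -> ~ p ∈ g' \/ p = x \/ p ∈ g.
Definition shifted (g g' : nat) : Prop :=
  forall p, p < g' -> ~ p ∈ g' \/ exists q, q ∈ g /\ Shift q p.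

(* Contexts are coded sets [g] of formulas, and [T] is added to every context. *)
Definition der_step (c l : nat) : Prop :=
  exists g a, c = ⟨g, a⟩ /\ (
    a ∈ g \/
    Axm a \/
    (exists g', ext g g' ⟨3, ⟨a, ⟨2, 0⟩⟩⟩ /\ ⟨g', ⟨2, 0⟩⟩ ∈ l) \/
    (exists x y g', a = ⟨3, ⟨x, y⟩⟩ /\ ext g g' x /\ ⟨g', y⟩ ∈ l) \/
    (exists x, ⟨g, ⟨3, ⟨x, a⟩⟩⟩ ∈ l /\ ⟨g, x⟩ ∈ l) \/
    (exists x y, a = ⟨4, ⟨x, y⟩⟩ /\ ⟨g, x⟩ ∈ l /\ ⟨g, y⟩ ∈ l) \/
    (exists x, ⟨g, ⟨4, ⟨a, x⟩⟩⟩ ∈ l \/ ⟨g, ⟨4, ⟨x, a⟩⟩⟩ ∈ l) \/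
    (exists x y, a = ⟨5, ⟨x, y⟩⟩ /\ (⟨g, x⟩ ∈ l \/ ⟨g, y⟩ ∈ l)) \/
    (exists x y g' g'', ⟨g, ⟨5, ⟨x, y⟩⟩⟩ ∈ l /\ ext g g' x /\ ⟨g', a⟩ ∈ l /\
       ext g g'' y /\ ⟨g'', a⟩ ∈ l) \/
    (exists x g', a = ⟨6, x⟩ /\ shifted g g' /\ ⟨g', x⟩ ∈ l) \/
    (exists x t, ⟨g, ⟨6, x⟩⟩ ∈ l /\ Inst t x a) \/
    (exists x t y, a = ⟨7, x⟩ /\ Inst t x y /\ ⟨g, y⟩ ∈ l) \/
    (exists x g' g'' a', ⟨g, ⟨7, x⟩⟩ ∈ l /\ shifted g g' /\ ext g' g'' x /\
       Shift a a' /\ ⟨g'', a'⟩ ∈ l) \/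
    (exists t, a = ⟨0, ⟨t, t⟩⟩) \/
    (exists x s t y, ⟨g, ⟨0, ⟨s, t⟩⟩⟩ ∈ l /\ Inst s x y /\ ⟨g, y⟩ ∈ l /\ Inst t x a)).

Definition Der (g a : nat) : Prop := Least der_step ⟨g, a⟩.

Ltac s1_hook ::= first [apply S1_Sub; sfn | apply S1_Axm; sfn].

Lemma S1_Der f g : Sfn f -> Sfn g -> S1 (fun rho => Der (f rho) (g rho)).
Proof.
  intros Hf Hg. unfold Der. apply (S1_app1 (Least der_step)); [|sfn]. apply S1_Least.
  unfold der_step, ext, shifted, Shift, Inst, sub_code; s1.
Qed.

Definition holds (M : structure) (rho : nat -> M) (g : nat) : Prop :=
  forall p, p ∈ g -> sat rho (dec p).

Lemma holds_ext (M : structure) (rho : nat -> M) g g' x :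
  ext g g' x -> holds M rho g -> sat rho (dec x) -> holds M rho g'.
Proof.
  intros He Hg Hx p Hp. destruct (He p) as [H|[->|H]]; auto; [apply (mem_lt N); auto|tauto].
Qed.

Lemma holds_shifted (M : structure) (rho : nat -> M) g g' x :
  shifted g g' -> holds M rho g -> holds M (scons x rho) g'.
Proof.
  intros He Hg p Hp. destruct (He p) as [H|(q & Hq & H)]; [apply (mem_lt N); auto|tauto|].
  rewrite (Shift_sound _ _ H). apply sat_shift; auto.
Qed.

(** Soundness is proved by truth rather than by rebuilding a derivation, since the coded contexts
    and formulas need not be genuine codes. The completeness theorem then turns truth in all models
    of [T] into provability. *)
Lemma Der_sound (M : structure) : models M T -> forall c, Least der_step c ->
  forall g a, c = ⟨g, a⟩ -> forall rho : nat -> M, holds M rho g -> sat rho (dec a).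
Proof.
  intros HM; induction 1 as [c l (g & a & -> & Hs) _ IH]; intros g0 a0 E rho Hg.
  apply to_nat_inj2 in E as [<- <-].
  assert (IH' : forall g a, ⟨g, a⟩ ∈ l -> forall rho : nat -> M, holds M rho g -> sat rho (dec a)).
  { intros g' a' H; eapply IH; eauto. }
  clear IH. repeat destruct Hs as [Hs|Hs].
  - apply Hg; auto.
  - destruct Hs as (b & Hb & <-). rewrite dec_code; apply HM; auto.
  - destruct Hs as (g' & He & H). apply NNPP; intros Hn.
    apply IH' with (rho := rho) in H; [rw_dec; exact H|].
    eapply holds_ext; eauto. rw_dec. simpl; auto.
  - destruct Hs as (x & y & g' & -> & He & H). rw_dec. intros Hx.
    apply (IH' _ _ H); eapply holds_ext; eauto.
  - destruct Hs as (x & H1 & H2). apply IH' with (rho := rho) in H1; auto.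
    rw_dec. apply H1, (IH' _ _ H2); auto.
  - destruct Hs as (x & y & -> & H1 & H2). rw_dec. split; eauto.
  - destruct Hs as (x & [H|H]); apply IH' with (rho := rho) in H; auto; rw_dec; apply H.
  - destruct Hs as (x & y & -> & [H|H]); apply IH' with (rho := rho) in H; auto; rw_dec;
      [left|right]; auto.
  - destruct Hs as (x & y & g' & g'' & H & He & H1 & He' & H2).
    apply IH' with (rho := rho) in H; auto. rw_dec.
    destruct H as [H|H]; [apply (IH' _ _ H1)|apply (IH' _ _ H2)]; eapply holds_ext; eauto.
  - destruct Hs as (x & g' & -> & He & H). rw_dec; intros z.
    apply (IH' _ _ H); eapply holds_shifted; eauto.
  - destruct Hs as (x & t & H & Hi). apply IH' with (rho := rho) in H; auto. rw_dec.
    rewrite (Inst_sound _ _ _ Hi). apply sat_inst, H.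
  - destruct Hs as (x & t & y & -> & Hi & H). apply IH' with (rho := rho) in H; auto. rw_dec.
    rewrite (Inst_sound _ _ _ Hi) in H. apply sat_inst in H. exists (ev rho (dect t)); auto.
  - destruct Hs as (x & g' & g'' & a' & H & He & He' & Hsh & H').
    apply IH' with (rho := rho) in H; auto. rw_dec. destruct H as [z Hz].
    apply IH' with (rho := scons z rho) in H'.
    + rewrite (Shift_sound _ _ Hsh) in H'. apply sat_shift in H'; auto.
    + eapply holds_ext; eauto. eapply holds_shifted; eauto.
  - destruct Hs as (t & ->). rw_dec. reflexivity.
  - destruct Hs as (x & s & t & y & H & Hi & H' & Hi').
    apply IH' with (rho := rho) in H; auto. apply IH' with (rho := rho) in H'; auto.
    rw_dec. rewrite (Inst_sound _ _ _ Hi) in H'. rewrite (Inst_sound _ _ _ Hi').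
    apply sat_inst in H'. apply sat_inst. simpl in H. rewrite <- H; auto.
Qed.

Ltac der L := apply (Least_list _ _ L); [intros l Hl; do 2 eexists; split; [reflexivity|]|in_list].

Lemma Der_complete G a : deriv G a -> forall g, (forall b, In b G -> code b ∈ g) -> Der g (code a).
Proof.
  assert (Hext : forall G g x, (forall b, In b G -> code b ∈ g) -> exists g',
    ext g g' (code x) /\ forall b, In b (x :: G) -> code b ∈ g').
  { intros G' g x H. destruct (insert N g (code x)) as [g' Hg']. exists g'; split.
    - intros p _. destruct (classic (p ∈ g')) as [Hp|]; auto. apply Hg' in Hp as [|]; auto.
    - intros b [<-|Hb]; apply Hg'; auto. }
  assert (Hsh : forall G g, (forall b, In b G -> code b ∈ g) -> exists g',
    shifted g g' /\ forall b, In b (map shift G) -> code b ∈ g').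
  { intros G' g H. destruct (set_of_list (map code (map shift G'))) as [g' Hg']. exists g'; split.
    - intros p _. destruct (classic (p ∈ g')) as [Hp|]; auto. right.
      apply Hg' in Hp. rewrite map_map in Hp. apply in_map_iff in Hp as (b & <- & Hb).
      exists (code b); split; auto. apply Shift_complete.
    - intros b Hb; apply Hg', in_map; auto. }
  induction 1; intros g Hg; unfold Der in *.
  - der (@nil nat). left; auto.
  - destruct (Hext G g (Neg a) Hg) as (g' & H1 & H2).
    der [⟨g', code Bot⟩]. do 2 right; left. exists g'; split; [exact H1|apply Hl; left; auto].
  - destruct (Hext G g a Hg) as (g' & H1 & H2).
    der [⟨g', code b⟩]. do 3 right; left. exists (code a), (code b), g'; repeat split; auto.
    apply Hl; left; auto.
  - der [⟨g, code (Imp a b)⟩; ⟨g, code a⟩]. do 4 right; left.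
    exists (code a); split; apply Hl; simpl; auto.
  - der [⟨g, code a⟩; ⟨g, code b⟩]. do 5 right; left.
    exists (code a), (code b); repeat split; auto; apply Hl; simpl; auto.
  - der [⟨g, code (And a b)⟩]. do 6 right; left. exists (code b); left; apply Hl; simpl; auto.
  - der [⟨g, code (And a b)⟩]. do 6 right; left. exists (code a); right; apply Hl; simpl; auto.
  - der [⟨g, code a⟩]. do 7 right; left. exists (code a), (code b); split; auto.
    left; apply Hl; simpl; auto.
  - der [⟨g, code b⟩]. do 7 right; left. exists (code a), (code b); split; auto.
    right; apply Hl; simpl; auto.
  - destruct (Hext G g a Hg) as (g1 & H11 & H12).
    destruct (Hext G g b Hg) as (g2 & H21 & H22).
    der [⟨g, code (Or a b)⟩; ⟨g1, code c⟩; ⟨g2, code c⟩]. do 8 right; left.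
    exists (code a), (code b), g1, g2; repeat split; auto; apply Hl; simpl; auto.
  - destruct (Hsh G g Hg) as (g' & H1 & H2).
    der [⟨g', code a⟩]. do 9 right; left. exists (code a), g'; repeat split; auto.
    apply Hl; simpl; auto.
  - der [⟨g, code (All a)⟩]. do 10 right; left. exists (code a), (code_term t); split.
    + apply Hl; simpl; auto.
    + apply Inst_complete.
  - der [⟨g, code (inst t a)⟩]. do 11 right; left.
    exists (code a), (code_term t), (code (inst t a)); repeat split.
    + apply Inst_complete.
    + apply Hl; simpl; auto.
  - destruct (Hsh G g Hg) as (g1 & H11 & H12).
    destruct (Hext (map shift G) g1 a H12) as (g2 & H21 & H22).
    der [⟨g, code (Ex a)⟩; ⟨g2, code (shift c)⟩]. do 12 right; left.
    exists (code a), g1, g2, (code (shift c)); repeat split; auto.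
    + apply Hl; simpl; auto.
    + apply Shift_complete.
    + apply Hl; simpl; auto.
  - der (@nil nat). do 13 right; left. exists (code_term t); auto.
  - der [⟨g, code (Eq s t)⟩; ⟨g, code (inst s a)⟩]. do 14 right.
    exists (code a), (code_term s), (code_term t), (code (inst s a)); repeat split.
    + apply Hl; simpl; auto.
    + apply Inst_complete.
    + apply Hl; simpl; auto.
    + apply Inst_complete.
Qed.

Lemma provability_S1 : exists Thm : nat -> Prop,
  (forall f, Sfn f -> S1 (fun rho => Thm (f rho))) /\
  (forall c, Thm c -> proves T (dec c)) /\ (forall a, proves T a -> Thm (code a)).
Proof.
  destruct (empty_set N) as [g Hg]. exists (Der g); repeat split.
  - intros f Hf; apply S1_Der; sfn.
  - intros c H; apply completeness; auto. intros M HM rho.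
    eapply Der_sound; eauto. intros p Hp; destruct (Hg p Hp).
  - intros a (G & HG & Hd).
    assert (HG' : forall b, In b G -> Der g (code b)).
    { intros b Hb. der (@nil nat). right; left. exists b; split; auto. }
    (* The assumptions are axioms of [T], hence derivable from the empty context, and are cut one at
       a time. *)
    clear HG. revert a Hd; induction G as [|b G IH]; intros a Hd.
    + eapply Der_complete; eauto. intros b [].
    + assert (H : Der g (code (Imp b a))).
      { apply IH; [intros; apply HG'; right; auto|apply D_imp_i; auto]. }
      assert (H' : Der g (code b)) by (apply HG'; left; auto).
      der [⟨g, code (Imp b a)⟩; ⟨g, code b⟩]. do 4 right; left.
      exists (code b); split; apply Hl; simpl; auto.
Qed.

End Provability.

(** * Universal Sigma_n relations *)

Arguments nu {M}.

Lemma Tm_nu k : Tm (fun M rho => nu k).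
Proof. exists (numeral k); intros; rewrite ev_numeral; auto. Qed.

(* A language for bounded formulas: expressions denote functions of one argument, the
   code of an environment as nested pairs; truth values are [0] and [1]. *)
Inductive expr : Type :=
| Hd
| Tl (f : expr)
| EZero
| Bin (t : nat) (f g : expr)
| Bex (f g : expr).

(** Codes are built with the polynomial pairing, so that [nu] maps them to the corresponding pairs
    in any model. *)
Fixpoint code_expr (f : expr) : nat :=
  match f with
  | Hd => @pair N 0 0
  | Tl f => @pair N 1 (code_expr f)
  | EZero => @pair N 2 0
  | Bin t f g => @pair N 3 (@pair N t (@pair N (code_expr f) (code_expr g)))
  | Bex f g => @pair N 4 (@pair N (code_expr f) (code_expr g))
  end.

Definition truth {M : model} (P : Prop) (y : M) : Prop := (P /\ y = nu 1) \/ (~ P /\ y = nu 0).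

(** Successor, sum and product produce numbers; equality, order and implication produce truth
    values. With the constant 0 and [Bex] these suffice classically for all bounded formulas. *)
Definition binop (M : model) (t a b y : M) : Prop :=
  (t = nu 0 /\ y = iS a) \/
  (t = nu 1 /\ y = iadd a b) \/
  (t = nu 2 /\ y = imul a b) \/
  (t = nu 3 /\ truth (a = b) y) \/
  (t = nu 4 /\ truth (ilt a b) y) \/
  (t = nu 5 /\ truth (a = nu 0 \/ b <> nu 0) y).

Fixpoint eval_expr (M : model) (f : expr) (v y : M) : Prop :=
  match f with
  | Hd => exists v', v = pair y v'
  | Tl f => exists x v', v = pair x v' /\ eval_expr M f v' y
  | EZero => y = nu 0
  | Bin t f g => exists a b, eval_expr M f v a /\ eval_expr M g v b /\ binop M (nu t) a b y
  | Bex f g => exists a, eval_expr M f v a /\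
      ((y = nu 1 /\ exists x b, ilt x a /\ b <> nu 0 /\ eval_expr M g (pair x v) b) \/
       (y = nu 0 /\ forall x, ilt x a -> eval_expr M g (pair x v) (nu 0)))
  end.

Definition entry {M : structure} (c v y : M) : M := pair c (pair v y).

(** Tarski's clauses for one entry. Falsity is recorded as the value 0, so that [X] never has to be
    negated. *)
Definition justified (M : model) (X : M -> Prop) (z : M) : Prop :=
  exists c v y, z = entry c v y /\ (
    (c = pair (nu 0) (nu 0) /\ exists v', v = pair y v') \/
    (exists f x v', c = pair (nu 1) f /\ v = pair x v' /\ X (entry f v' y)) \/
    (c = pair (nu 2) (nu 0) /\ y = nu 0) \/
    (exists t f g a b, c = pair (nu 3) (pair t (pair f g)) /\ X (entry f v a) /\
       X (entry g v b) /\ binop M t a b y) \/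
    (exists f g a, c = pair (nu 4) (pair f g) /\ X (entry f v a) /\
       ((y = nu 1 /\ exists x b, ilt x a /\ b <> nu 0 /\ X (entry g (pair x v) b)) \/
        (y = nu 0 /\ forall x, ilt x a -> X (entry g (pair x v) (nu 0)))))).

(* A [closed] set plays the role of a satisfaction table. As [justified] is positive in
   [X], the union of all closed sets below a bound is again closed. *)
Definition closed (M : model) (w : M) : Prop :=
  forall z, ilt z w -> ~ mem z w \/ justified M (fun p => mem p w) z.

Definition Good (M : model) (z : M) : Prop := exists w, closed M w /\ mem z w.

Lemma Tm_entry f g h : Tm f -> Tm g -> Tm h ->
  Tm (fun M rho => entry (f M rho) (g M rho) (h M rho)).
Proof. intros; unfold entry; apply Tm_pair; auto; apply Tm_pair; auto. Qed.

Ltac tm_hook ::= first [apply Tm_nu | apply Tm_entry; tm | apply Tm_pair; tm].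

Lemma D0_binop f g h k : Tm f -> Tm g -> Tm h -> Tm k ->
  D0 (fun M rho => binop M (f M rho) (g M rho) (h M rho) (k M rho)).
Proof. intros; unfold binop, truth; d0. Qed.

Ltac sg := cbn beta; first
  [ assumption | apply D0_Sg; first [d0 | apply D0_binop; tm]
  | apply Sg_and; sg | apply Sg_or; sg | apply Sg_ex; sg | apply Sg_bex; [tm|sg]
  | apply Sg_ball; [tm|sg] ].

Lemma Sg_app1 n (Q : forall M : model, M -> Prop) f :
  Sg n (fun M rho => Q M (rho 0)) -> Tm f -> Sg n (fun M rho => Q M (f M rho)).
Proof. intros HQ Hf; apply (Sg_comp n (fun M rho => Q M (rho 0)) (fun i => f)); auto. Qed.

Lemma Sg_closed f : Tm f -> Sg 1 (fun M rho => closed M (f M rho)).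
Proof. apply (Sg_app1 1 closed). unfold closed, justified. sg. Qed.

Lemma Sg_Good f : Tm f -> Sg 1 (fun M rho => Good M (f M rho)).
Proof.
  apply (Sg_app1 1 Good). unfold Good. apply Sg_ex, Sg_and; [apply Sg_closed; tm|sg].
Qed.

Section Good.
Variable M : model.
Implicit Types z w v y : M.

Lemma justified_mono (X Y : M -> Prop) z :
  (forall p, X p -> Y p) -> justified M X z -> justified M Y z.
Proof.
  intros H (c & v & y & -> & Hc). exists c, v, y; split; auto.
  destruct Hc as [Hc|[(f & x & v' & H1 & H2 & H3)|[Hc|[(t & f & g & a & b & H1 & H2 & H3 & H4)|
    (f & g & a & H1 & H2 & H3)]]]].
  - left; auto.
  - right; left. exists f, x, v'; auto.
  - right; right; left; auto.
  - do 3 right; left. exists t, f, g, a, b; auto.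
  - do 4 right. exists f, g, a; repeat split; auto.
    destruct H3 as [(H4 & x & b & H5 & H6 & H7)|[H4 H5]]; [left|right]; split; auto.
    exists x, b; auto.
Qed.

Definition Good_below w z : Prop := exists w', ilt w' w /\ closed M w' /\ mem z w'.

Lemma Good_below_mono w1 w2 z : ile w1 w2 -> Good_below w1 z -> Good_below w2 z.
Proof.
  intros H (w & H1 & H2 & H3); exists w; split; auto. eapply lt_le_trans; eauto.
Qed.

Lemma Good_below_ex z : Good M z -> exists w, Good_below w z.
Proof. intros (w & H1 & H2); exists (iS w), w; split; auto. apply (le_refl M). Qed.

Lemma Good_below_two z1 z2 : Good M z1 -> Good M z2 -> exists w, Good_below w z1 /\ Good_below w z2.
Proof.
  intros H1 H2; apply Good_below_ex in H1 as [w1 H1]; apply Good_below_ex in H2 as [w2 H2].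
  destruct (max_le M w1 w2) as (w & L1 & L2); exists w; eauto using Good_below_mono.
Qed.

(** Most clauses use at most two earlier tables. A false bounded existential uses one for each x
    below [a], and collection bounds them all. *)
Lemma justified_bounded z : justified M (Good M) z -> exists w, justified M (Good_below w) z.
Proof.
  intros (c & v & y & -> & Hc).
  destruct Hc as [Hc|[(f & x & v' & H1 & H2 & H3)|[Hc|[(t & f & g & a & b & H1 & H2 & H3 & H4)|
    (f & g & a & H1 & H2 & H3)]]]].
  - exists i0, c, v, y; auto.
  - apply Good_below_ex in H3 as [w Hw]. exists w, c, v, y; split; auto.
    right; left. exists f, x, v'; auto.
  - exists i0, c, v, y; tauto.
  - destruct (Good_below_two _ _ H2 H3) as (w & Hw1 & Hw2). exists w, c, v, y; split; auto.
    do 3 right; left. exists t, f, g, a, b; auto.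
  - destruct H3 as [(H4 & x & b & H5 & H6 & H7)|[H4 H5]].
    + destruct (Good_below_two _ _ H2 H7) as (w & Hw1 & Hw2). exists w, c, v, y; split; auto.
      do 4 right. exists f, g, a; split; [exact H1|split; auto]. left; split; auto. exists x, b; auto.
    + apply Good_below_ex in H2 as [w1 Hw1].
      assert (HD : Def (fun M rho => closed M (rho 0) /\
        mem (entry (rho 2) (pair (rho 1) (rho 3)) (nu 0)) (rho 0))).
      { apply (Sg_Def 1), Sg_and; [apply Sg_closed; tm|sg]. }
      destruct (collection _ HD M (nenv [g; v]) a) as [w2 Hw2].
      { intros x Hx; destruct (H5 x Hx) as (w & Hw & Hm); exists w; split; auto. }
      destruct (max_le M w1 w2) as (w & L1 & L2).
      exists w, c, v, y; split; auto. do 4 right. exists f, g, a; split; [exact H1|split].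
      { apply (Good_below_mono w1); auto. }
      right; split; auto. intros x Hx. destruct (Hw2 x Hx) as (w' & Hw' & Hcl & Hm).
      exists w'; split; [eapply lt_le_trans; eauto|split; auto].
Qed.

Lemma Good_iff z : Good M z <-> justified M (Good M) z.
Proof.
  split.
  - intros (w & Hw & Hz). destruct (Hw z) as [|H]; [apply mem_lt; auto|tauto|].
    eapply justified_mono; [|exact H]. intros p Hp; exists w; auto.
  - intros H. apply justified_bounded in H as [w Hw].
    assert (HD : Def (fun M rho => (exists w' : M, ilt w' (rho 1) /\ closed M w' /\ mem (rho 0) w') \/
      rho 0 = rho 2)).
    { apply (Sg_Def 1), Sg_or; [|sg]. apply Sg_bex; [tm|]. apply Sg_and; [apply Sg_closed; tm|sg]. }
    destruct (comprehension M _ HD (nenv [w; z]) (iadd w (iS z))) as [c Hc]. simpl in Hc.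
    assert (Hin : forall p, Good_below w p -> mem p c).
    { intros p Hp; apply Hc; split; [|left; exact Hp].
      destruct Hp as (w' & H1 & _ & H3). eapply lt_le_trans; [|apply le_add_r].
      eapply lt_trans; [|exact H1]. apply mem_lt; auto. }
    exists c; split.
    + intros p _. destruct (classic (mem p c)) as [Hp|]; [right|auto].
      apply Hc in Hp as [_ [(w' & H1 & H2 & H3)| ->]].
      * destruct (H2 p) as [|H4]; [apply mem_lt; auto|tauto|].
        eapply justified_mono; [|exact H4]. intros q Hq; apply Hin; exists w'; auto.
      * eapply justified_mono; [|exact Hw]. exact Hin.
    + apply Hc; split; auto. eapply lt_le_trans; [apply (le_refl M)|apply le_add_l].
Qed.

Lemma nu_pair a b : @nu M (@pair N a b) = pair (nu a) (nu b).
Proof. unfold pair; simpl. rewrite nu_add, nu_mul, nu_add; auto. Qed.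

Ltac tag E := apply pair_inj in E as [E _]; apply nu_inj in E; discriminate E.

(** The induction is on an actual expression, so nothing is claimed for nonstandard codes; the
    environment [v] and the value [y] are arbitrary. *)
Lemma Good_eval f : forall v y, Good M (entry (nu (code_expr f)) v y) <-> eval_expr M f v y.
Proof.
  induction f as [|f IH| |t f IHf g IHg|f IHf g IHg]; intros v y; rewrite Good_iff;
    cbn [code_expr]; rewrite !nu_pair; split.
  - intros (c & v0 & y0 & E & H). apply pair_inj in E as [<- E]; apply pair_inj in E as [<- <-].
    destruct H as [[_ H]|[(?&?&?&E&_)|[[E _]|[(?&?&?&?&?&E&_)|(?&?&?&E&_)]]]];
      [exact H|tag E..].
  - intros H; do 3 eexists; split; [reflexivity|]. left; auto.
  - intros (c & v0 & y0 & E & H). apply pair_inj in E as [<- E]; apply pair_inj in E as [<- <-].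
    destruct H as [[E _]|[(f'&x&v'&E&->&H)|[[E _]|[(?&?&?&?&?&E&_)|(?&?&?&E&_)]]]];
      [tag E| |tag E..].
    apply pair_inj in E as [_ <-]. apply IH in H. exists x, v'; auto.
  - intros (x & v' & -> & H); do 3 eexists; split; [reflexivity|]. right; left.
    do 3 eexists; repeat split. apply IH; auto.
  - intros (c & v0 & y0 & E & H). apply pair_inj in E as [<- E]; apply pair_inj in E as [<- <-].
    destruct H as [[E _]|[(?&?&?&E&_)|[[_ H]|[(?&?&?&?&?&E&_)|(?&?&?&E&_)]]]];
      [tag E|tag E|exact H|tag E..].
  - intros H; do 3 eexists; split; [reflexivity|]. right; right; left; auto.
  - intros (c & v0 & y0 & E & H). apply pair_inj in E as [<- E]; apply pair_inj in E as [<- <-].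
    destruct H as [[E _]|[(?&?&?&E&_)|[[E _]|[(t'&f'&g'&a&b&E&H1&H2&H3)|(?&?&?&E&_)]]]];
      [tag E|tag E|tag E| |tag E].
    apply pair_inj in E as [_ E]; apply pair_inj in E as [<- E]; apply pair_inj in E as [<- <-].
    exists a, b; rewrite <- IHf, <- IHg; auto.
  - intros (a & b & H1 & H2 & H3). do 3 eexists; split; [reflexivity|]. do 3 right; left.
    exists (nu t), (nu (code_expr f)), (nu (code_expr g)), a, b.
    rewrite IHf, IHg; auto.
  - intros (c & v0 & y0 & E & H). apply pair_inj in E as [<- E]; apply pair_inj in E as [<- <-].
    destruct H as [[E _]|[(?&?&?&E&_)|[[E _]|[(?&?&?&?&?&E&_)|(f'&g'&a&E&H1&H2)]]]];
      [tag E..| ].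
    apply pair_inj in E as [_ E]; apply pair_inj in E as [<- <-].
    exists a; rewrite <- IHf; split; auto.
    destruct H2 as [(-> & x & b & H3 & H4 & H5)|[-> H3]]; [left|right]; split; auto.
    + exists x, b; rewrite <- IHg; auto.
    + intros x Hx; rewrite <- IHg; auto.
  - intros (a & H1 & H2). do 3 eexists; split; [reflexivity|]. do 4 right.
    exists (nu (code_expr f)), (nu (code_expr g)), a; rewrite IHf; repeat split; auto.
    destruct H2 as [(-> & x & b & H3 & H4 & H5)|[-> H3]]; [left|right]; split; auto.
    + exists x, b; rewrite IHg; auto.
    + intros x Hx; rewrite IHg; auto.
Qed.

Fixpoint code_env (k : nat) (rho : nat -> M) : M :=
  match k with 0 => i0 | S k => pair (rho 0) (code_env k (fun i => rho (S i))) end.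

End Good.

Arguments code_env {M}.

(** * Compilation of bounded formulas into expressions *)

Fixpoint expr_var (i : nat) : expr := match i with 0 => Hd | S i => Tl (expr_var i) end.

Fixpoint expr_term (t : term) : expr :=
  match t with
  | Var i => expr_var i
  | Zero => EZero
  | Succ s => Bin 0 (expr_term s) EZero
  | Plus s t => Bin 1 (expr_term s) (expr_term t)
  | Mult s t => Bin 2 (expr_term s) (expr_term t)
  end.

Lemma eval_expr_var (M : model) i : forall k (rho : nat -> M) y, i < k ->
  eval_expr M (expr_var i) (code_env k rho) y <-> y = rho i.
Proof.
  induction i as [|i IH]; intros [|k] rho y H; try lia; simpl.
  - split; [intros [v' E]; apply pair_inj in E as [E _]; auto|intros ->; eauto].
  - rewrite <- (IH k (fun i => rho (S i))) by lia. split.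
    + intros (x & v' & E & H'). apply pair_inj in E as [_ <-]; auto.
    + intros H'; do 2 eexists; split; [reflexivity|auto].
Qed.

Ltac no_tag E := apply nu_inj in E; discriminate E.

Lemma binop_succ (M : model) (a b y : M) : binop M (nu 0) a b y <-> y = iS a.
Proof.
  split; [|left; auto].
  intros [[E H]|[[E H]|[[E H]|[[E H]|[[E H]|[E H]]]]]]; auto; no_tag E.
Qed.
Lemma binop_add (M : model) (a b y : M) : binop M (nu 1) a b y <-> y = iadd a b.
Proof.
  split; [|right; left; auto].
  intros [[E H]|[[E H]|[[E H]|[[E H]|[[E H]|[E H]]]]]]; auto; no_tag E.
Qed.
Lemma binop_mul (M : model) (a b y : M) : binop M (nu 2) a b y <-> y = imul a b.
Proof.
  split; [|do 2 right; left; auto].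
  intros [[E H]|[[E H]|[[E H]|[[E H]|[[E H]|[E H]]]]]]; auto; no_tag E.
Qed.
Lemma binop_eq (M : model) (a b y : M) : binop M (nu 3) a b y <-> truth (a = b) y.
Proof.
  split; [|do 3 right; left; auto].
  intros [[E H]|[[E H]|[[E H]|[[E H]|[[E H]|[E H]]]]]]; auto; no_tag E.
Qed.
Lemma binop_lt (M : model) (a b y : M) : binop M (nu 4) a b y <-> truth (ilt a b) y.
Proof.
  split; [|do 4 right; left; auto].
  intros [[E H]|[[E H]|[[E H]|[[E H]|[[E H]|[E H]]]]]]; auto; no_tag E.
Qed.
Lemma binop_imp (M : model) (a b y : M) :
  binop M (nu 5) a b y <-> truth (a = nu 0 \/ b <> nu 0) y.
Proof.
  split; [|do 5 right; auto].
  intros [[E H]|[[E H]|[[E H]|[[E H]|[[E H]|[E H]]]]]]; auto; no_tag E.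
Qed.

Lemma eval_expr_term (M : model) t : forall k (rho : nat -> M) y, bounded_term k t ->
  eval_expr M (expr_term t) (code_env k rho) y <-> y = ev rho t.
Proof.
  assert (Hbin : forall t s1 s2 k (rho : nat -> M) y (P : M -> M -> M),
    (forall y, eval_expr M (expr_term s1) (code_env k rho) y <-> y = ev rho s1) ->
    (forall y, eval_expr M (expr_term s2) (code_env k rho) y <-> y = ev rho s2) ->
    (forall a b y, binop M (nu t) a b y <-> y = P a b) ->
    eval_expr M (Bin t (expr_term s1) (expr_term s2)) (code_env k rho) y <->
      y = P (ev rho s1) (ev rho s2)).
  { intros t' s1 s2 k rho y P H1 H2 H3; cbn [eval_expr]. split.
    - intros (a & b & Ha & Hb & H). apply H1 in Ha; apply H2 in Hb; apply H3 in H; subst; auto.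
    - intros ->. do 2 eexists. rewrite H1, H2, H3; auto. }
  induction t as [i| |s IH|s IHs t IHt|s IHs t IHt]; intros k rho y Hb; cbn [expr_term ev].
  - apply eval_expr_var; auto.
  - reflexivity.
  - apply (Hbin 0 s Zero k rho y (fun a _ => iS a)); auto using binop_succ. reflexivity.
  - destruct Hb; apply (Hbin 1 s t k rho y iadd); auto using binop_add.
  - destruct Hb; apply (Hbin 2 s t k rho y imul); auto using binop_mul.
Qed.

(** The equivalence for every [y] also fixes the value 0 in the false case, on which implication and
    negation rely. *)
Definition computes (f : expr) (a : form) : Prop :=
  forall k, bounded k a -> forall (M : model) (rho : nat -> M) y,
    eval_expr M f (code_env k rho) y <-> truth (sat rho a) y.

Lemma truth_nonzero (M : model) P (y : M) : truth P y -> (y <> nu 0 <-> P).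
Proof.
  assert (H : @nu M 1 <> nu 0) by (intros E; apply nu_inj in E; discriminate).
  intros [[HP ->]|[HP ->]]; tauto.
Qed.

Lemma truth_ex (M : model) (P : Prop) : exists y : M, truth P y.
Proof. destruct (classic P); [exists (nu 1); left|exists (nu 0); right]; auto. Qed.

Lemma truth_iff (M : model) (P Q : Prop) (y : M) : (P <-> Q) -> truth P y <-> truth Q y.
Proof. unfold truth; tauto. Qed.

Lemma computes_imp f g a b : computes f a -> computes g b -> computes (Bin 5 f g) (Imp a b).
Proof.
  intros Hf Hg k [H1 H2] M rho y; cbn [eval_expr sat].
  assert (E : forall u v : M, truth (sat rho a) u -> truth (sat rho b) v ->
    (u = nu 0 \/ v <> nu 0 <-> (sat rho a -> sat rho b))).
  { intros u v Hu Hv; apply truth_nonzero in Hu; apply truth_nonzero in Hv.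
    destruct (classic (u = nu 0)); tauto. }
  split.
  - intros (u & v & Hu & Hv & H). apply Hf in Hu; auto; apply Hg in Hv; auto.
    apply binop_imp in H. eapply truth_iff; [|exact H]. symmetry; auto.
  - intros H. destruct (truth_ex M (sat rho a)) as [u Hu]. destruct (truth_ex M (sat rho b)) as [v Hv].
    exists u, v. rewrite (Hf k), (Hg k), binop_imp; auto. repeat split; auto.
    eapply truth_iff; [|exact H]; auto.
Qed.

Lemma computes_bot : computes EZero Bot.
Proof. intros k _ M rho y; simpl; unfold truth; tauto. Qed.

Lemma computes_equiv f a b : computes f a -> (forall k, bounded k b -> bounded k a) ->
  (forall (M : model) (rho : nat -> M), sat rho a <-> sat rho b) -> computes f b.
Proof. intros Hf Hb H k Hk M rho y. rewrite (Hf k); auto. apply truth_iff, H. Qed.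

Lemma bounded_term_shift k t : bounded_term (S k) (shift_term t) -> bounded_term k t.
Proof. induction t; simpl; auto; [lia|tauto..]. Qed.

Lemma computes_bex t g b :
  computes g b -> computes (Bex (expr_term t) g) (Ex (And (Lt (Var 0) (shift_term t)) b)).
Proof.
  intros Hg k [[_ Ht] Hb] M rho y; cbn [eval_expr sat ev]. apply bounded_term_shift in Ht.
  assert (Es : forall x, ev (scons x rho) (shift_term t) = ev rho t).
  { intros; unfold shift_term; rewrite ev_subst; auto. }
  assert (Eg : forall x y, eval_expr M g (pair x (code_env k rho)) y <->
    truth (sat (scons x rho) b) y).
  { intros x y'. apply (Hg (S k) Hb M (scons x rho) y'). }
  assert (Hx : (exists x y, ilt x (ev rho t) /\ y <> nu 0 /\ eval_expr M g (pair x (code_env k rho)) y)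
    <-> exists x, ilt (scons x rho 0) (ev (scons x rho) (shift_term t)) /\ sat (scons x rho) b).
  { split.
    - intros (x & u & H1 & H2 & H3). apply Eg in H3. exists x; rewrite Es; split; auto.
      apply truth_nonzero in H3; tauto.
    - intros (x & H1 & H2). rewrite Es in H1. exists x, (nu 1); split; auto. split.
      + intros E; apply nu_inj in E; discriminate.
      + apply Eg; left; auto. }
  unfold truth. rewrite <- Hx. split.
  - intros (u & Hu & H). apply eval_expr_term in Hu; auto; subst u.
    destruct H as [[-> H]|[-> H]]; [left; auto|right]. split; auto.
    intros (x & u & H1 & H2 & H3). apply Eg in H3. specialize (H x H1); apply Eg in H.
    apply truth_nonzero in H3; apply truth_nonzero in H; tauto.
  - intros H; exists (ev rho t); split; [apply eval_expr_term; auto|].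
    destruct H as [[H ->]|[H ->]]; [left; auto|right; split; auto].
    intros x Hlt; apply Eg. right; split; auto. intros Hs; apply H.
    exists x, (nu 1); split; auto. split; [intros E; apply nu_inj in E; discriminate|].
    apply Eg; left; auto.
Qed.

Lemma Delta0_computes a : Delta0 a -> exists f, computes f a.
Proof.
  induction 1 as [s t|s t| |a b _ [f Hf] _ [g Hg]|a b _ [f Hf] _ [g Hg]|a b _ [f Hf] _ [g Hg]
    |t a _ [f Hf]|t a _ [f Hf]].
  - exists (Bin 3 (expr_term s) (expr_term t)). intros k [Hs Ht] M rho y; cbn [eval_expr sat]. split.
    + intros (u & v & Hu & Hv & H). apply eval_expr_term in Hu, Hv; auto; subst.
      apply binop_eq; auto.
    + intros H; do 2 eexists; rewrite !eval_expr_term, binop_eq; eauto.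
  - exists (Bin 4 (expr_term s) (expr_term t)). intros k [Hs Ht] M rho y; cbn [eval_expr sat]. split.
    + intros (u & v & Hu & Hv & H). apply eval_expr_term in Hu, Hv; auto; subst.
      apply binop_lt; auto.
    + intros H; do 2 eexists; rewrite !eval_expr_term, binop_lt; eauto.
  - exists EZero; apply computes_bot.
  - eexists; apply computes_imp; eauto.
  - exists (Bin 5 (Bin 5 f (Bin 5 g EZero)) EZero).
    apply (computes_equiv _ (Neg (Imp a (Neg b)))); simpl; try tauto.
    + repeat apply computes_imp; auto using computes_bot.
    + intros M rho; destruct (classic (sat rho a)), (classic (sat rho b)); tauto.
  - exists (Bin 5 (Bin 5 f EZero) g).
    apply (computes_equiv _ (Imp (Neg a) b)); simpl; try tauto.
    + repeat apply computes_imp; auto using computes_bot.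
    + intros M rho; destruct (classic (sat rho a)); tauto.
  - exists (Bin 5 (Bex (expr_term t) (Bin 5 f EZero)) EZero).
    apply (computes_equiv _ (Neg (Ex (And (Lt (Var 0) (shift_term t)) (Neg a))))); simpl; try tauto.
    + apply computes_imp, computes_bot. apply computes_bex. apply computes_imp; auto using computes_bot.
    + intros M rho; split.
      * intros H x Hx; apply NNPP; intros Hn; apply H; eauto.
      * intros H (x & Hx & Hn); auto.
  - eexists; apply computes_bex; eauto.
Qed.

(* The index is shifted: [Univ n] is universal for [Sigma_(n+1)]. *)
Fixpoint Univ (n : nat) (M : model) (e v : M) : Prop :=
  match n with
  | 0 => exists x, Good M (entry e (pair x v) (nu 1))
  | S n => exists x, ~ Univ n M e (pair x v)
  end.

Lemma Sg_Univ n : forall f g, Tm f -> Tm g -> Sg (S n) (fun M rho => Univ n M (f M rho) (g M rho)).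
Proof.
  induction n as [|n IH]; intros f g Hf Hg; cbn [Univ].
  - apply Sg_ex. apply Sg_Good. pose proof (Tm_shift _ Hf); pose proof (Tm_shift _ Hg). tm.
  - exists (fun M rho => Univ n M (f M (fun i => rho (S i))) (pair (rho 0) (g M (fun i => rho (S i))))).
    split; [|reflexivity].
    apply (IH (fun M rho => f M (fun i => rho (S i)))
      (fun M rho => pair (rho 0) (g M (fun i => rho (S i))))); [apply Tm_shift; auto|].
    pose proof (Tm_shift _ Hg). tm.
Qed.

(** Only finitely many variables can be coded into an element of the model, so the others are set to
    0. *)
Definition restrict {M : structure} (k : nat) (rho : nat -> M) (i : nat) : M :=
  if Nat.ltb i k then rho i else i0.

Definition depends (k : nat) (R : rel) : Prop :=
  forall (M : model) (rho : nat -> M), R M rho <-> R M (restrict k rho).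

Lemma restrict_scons (M : structure) k x (rho : nat -> M) :
  restrict (S k) (scons x rho) = scons x (restrict k rho).
Proof. extensionality i; destruct i; reflexivity. Qed.

Lemma restrict_idem (M : structure) k (rho : nat -> M) : restrict k (restrict k rho) = restrict k rho.
Proof. extensionality i; unfold restrict; destruct Nat.ltb; auto. Qed.

Lemma Sg_restrict n k R : Sg n R -> Sg n (fun M rho => R M (restrict k rho)).
Proof.
  intros HR. apply (Sg_comp n R (fun i M rho => if Nat.ltb i k then rho i else i0)); auto.
  intros i; destruct Nat.ltb; tm.
Qed.

(** Each quantifier prefixes its witness to the coded environment, so the index found for the
    innermost matrix serves for [R] as well; at the bottom it is the code of a compiled
    expression. *)
Lemma universal n : forall k R, Sg (S n) R -> depends k R ->
  exists e, forall (M : model) (rho : nat -> M), R M rho <-> Univ n M (nu e) (code_env k rho).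
Proof.
  induction n as [|n IH]; intros k R (Q & HQ & E) Hk.
  - assert (HQ' : D0 (fun M rho => ~ Q M (restrict (S k) rho))).
    { apply D0_not. apply (Sg_restrict 0); auto. }
    destruct HQ' as (a & Ha & Ea).
    destruct (close_formula (S k) a _ Ea) as (s & Hs & Es).
    { intros M rho rho' H. replace (restrict (S k) rho') with (restrict (S k) rho); [tauto|].
      extensionality i; unfold restrict. destruct (Nat.ltb_spec i (S k)); auto. }
    destruct (Delta0_computes _ (Delta0_subst a Ha s)) as [f Hf].
    exists (code_expr f). intros M rho. rewrite (Hk M rho), E. cbn [Univ].
    split; intros [x Hx]; exists x; rewrite <- restrict_scons in *.
    + apply Good_eval. apply (Hf (S k) Hs M (scons x rho)). left; split; auto. apply Es; auto.
    + apply Good_eval in Hx. apply (Hf (S k) Hs M (scons x rho)) in Hx.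
      apply Es. destruct Hx as [[Hx _]|[_ Hx]]; auto. apply nu_inj in Hx; discriminate.
  - destruct (IH (S k) (fun M rho => Q M (restrict (S k) rho))) as [e He].
    + apply Sg_restrict; auto.
    + intros M rho; rewrite restrict_idem; tauto.
    + exists e; intros M rho. rewrite (Hk M rho), E. cbn [Univ].
      split; intros [x Hx]; exists x; intros H; apply Hx.
      * rewrite <- restrict_scons. apply He; auto.
      * apply (He M (scons x rho)). rewrite restrict_scons; auto.
Qed.

(** * Theories extending PA *)

Definition zeros {M : structure} : nat -> M := fun _ => i0.

Lemma proves_models T a : is_theory T -> extends T PA ->
  (proves T a <-> forall M : model, models M T -> forall rho : nat -> M, sat rho a).
Proof.
  intros HT HP; split.
  - intros H M HM rho; eapply proves_sound; eauto.
  - intros H; apply completeness; auto. intros M HM.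
    assert (HMP : models M PA) by (intros b Hb rho; eapply proves_sound; eauto).
    exact (H (Model M HMP) HM).
Qed.

Lemma models_extends T U (M : structure) : extends T U -> models M T -> models M U.
Proof. intros H HM a Ha rho; eapply proves_sound; eauto. Qed.

Lemma proves_add_axiom T a b : proves (add_axiom T a) b <-> proves T (Imp a b).
Proof.
  split; [apply proves_imp_i|]. intros H; apply (proves_imp_e _ a).
  - eapply proves_mono; [|exact H]. intros c; left; auto.
  - apply proves_ax; right; auto.
Qed.

Lemma sat_inst_numeral (M : model) (rho : nat -> M) k a :
  sat rho (inst (numeral k) a) <-> sat (scons (nu k) rho) a.
Proof. rewrite sat_inst, ev_numeral; tauto. Qed.

Lemma bounded_numeral k j : bounded_term j (numeral k).
Proof. induction k; simpl; auto. Qed.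

Lemma sentence_inst_numeral k a : bounded 1 a -> sentence (inst (numeral k) a).
Proof.
  intros H; eapply bounded_subst; [exact H|]. intros [|i] Hi; [apply bounded_numeral|lia].
Qed.

Lemma Sg_Pg_S n R : Sg n R -> Pg (S n) R.
Proof. intros H; apply Pg_Sg_S, Pg_not; auto. Qed.

Lemma Sg_fixed_env n R f : Sg n R -> Tm f -> Sg n (fun M rho => R M (scons (f M rho) zeros)).
Proof.
  intros HR Hf. eapply Sg_iff; [|apply (Sg_comp n R (fun i M rho =>
    match i with 0 => f M rho | _ => i0 end)); auto].
  - intros M rho; simpl. replace (scons (f M rho) zeros) with
      (fun i => match i with 0 => f M rho | S _ => i0 end); [tauto|].
    extensionality i; destruct i; auto.
  - intros [|i]; auto. apply Tm_zero.
Qed.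

Lemma Pg_fixed_env n R f : Pg n R -> Tm f -> Pg n (fun M rho => R M (scons (f M rho) zeros)).
Proof. apply Sg_fixed_env. Qed.

(** * Consistency over [U], and the exclusion of doubly conservative sentences *)

Section Main.
Variables T U : theory.
Hypothesis HT : is_theory T.
Hypothesis HU : is_theory U.
Hypothesis T_ce : ce_theory T.
Hypothesis T_PA : extends T PA.
Hypothesis T_U : extends T U.
Hypothesis U_PA : extends U PA.

Lemma Pi_consistent_of_Sigma n :
  consistent_over (Sigma (S n)) T U -> consistent_over (Pi n) T U.
Proof.
  intros H (a & Ha & Hb & H1 & H2); apply H; exists a; split; auto using Sigma_Pi.
Qed.

Lemma Sigma_consistent_of_Pi n :
  consistent_over (Pi n) T U -> consistent_over (Sigma (S n)) T U.
Proof.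
  intros H (a & Ha & Hb & H1 & H2); apply H.
  destruct (Sg_S_inv _ _ (proj1 Sigma_Pi_rel _ _ Ha)) as (R & HR & E).
  pose (Q := fun (M : model) (rho : nat -> M) => exists x, ilt x (iS (rho 0)) /\
    exists y, ilt y (iS (rho 0)) /\ R M (scons y (scons x zeros))).
  destruct (Pg_bounded_formula n 1 Q) as (p & Hp & Hpb & Ep).
  { apply Pg_bex; [tm|]. apply Pg_bex; [tm|].
    eapply Pg_iff; [|apply (Sg_comp n (fun M rho => ~ R M rho) (fun i M rho =>
      match i with 0 => rho 0 | 1 => rho 1 | _ => i0 end)); [exact HR|]].
    - intros M rho; simpl. replace (scons (rho 0) (scons (rho 1) zeros)) with
        (fun i => match i with 0 => rho 0 | 1 => rho 1 | _ => i0 end); [tauto|].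
      extensionality i; destruct i as [|[|]]; auto.
    - intros [|[|i]]; tm. }
  { intros M rho rho' Hr; unfold Q; rewrite (Hr 0) by lia; tauto. }
  exists p; repeat split; auto.
  - apply proves_models; auto. intros M HM rho.
    destruct (proj1 (proves_models U _ HU U_PA) H1 M HM zeros) as [x Hx].
    apply E in Hx as [y Hy]. destruct (max_le M x y) as (z & Hxz & Hyz).
    exists z; apply Ep. exists x; split; auto. exists y; auto.
  - intros k; apply proves_models; auto. intros M HM rho Hs.
    apply sat_inst_numeral, Ep in Hs as (x & Hx & y & _ & Hy).
    (* [iS (nu k)] computes to [nu (S k)], so the outer witness is standard. The inner one may
       remain nonstandard, because it is quantified again in the instance of [a] that [T]
       refutes. *)
    simpl in Hx. change (ilt x (nu (S k))) in Hx. apply lt_nu in Hx as (j & _ & ->).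
    pose proof (proj1 (proves_models T _ HT T_PA) (H2 j) M HM zeros) as Hn.
    apply Hn. apply sat_inst_numeral, E; eauto.
Qed.

Lemma Pi_consistent_no_DCons n : consistent_over (Pi n) T U ->
  forall a, ~ (Delta (S n) U a /\ DCons (Sigma n) (Sigma n) T a).
Proof.
  intros Hcon a ([(s & Hs & Es) (p & Hp & Ep)] & Ha & C1 & C2); apply Hcon.
  destruct (Sg_S_inv _ _ (proj1 Sigma_Pi_rel _ _ Hs)) as (R1 & HR1 & E1).
  destruct (Sg_S_inv _ _ (proj2 Sigma_Pi_rel _ _ Hp)) as (R2 & HR2 & E2).
  pose proof (proj1 (proves_models U _ HU U_PA) Es) as Fs.
  pose proof (proj1 (proves_models U _ HU U_PA) Ep) as Fp. simpl in Fs, Fp.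
  destruct (Pg_bounded_formula n 1 (fun M rho =>
    R1 M (scons (rho 0) zeros) \/ R2 M (scons (rho 0) zeros))) as (q & Hq & Hqb & Eq).
  { apply Pg_or; apply Pg_fixed_env; auto; tm. }
  { intros M rho rho' Hr; rewrite (Hr 0) by lia; tauto. }
  exists q; repeat split; auto.
  - apply proves_models; auto. intros M HM rho. simpl.
    destruct (classic (sat (@zeros M) a)) as [Hz|Hz].
    + apply (Fs M HM zeros), E1 in Hz as [x Hx]. exists x; apply Eq; left; auto.
    + assert (Hz' : ~ sat (@zeros M) p) by (intros H; apply Hz, (Fp M HM zeros); auto).
      apply E2 in Hz' as [x Hx]. exists x; apply Eq; right; auto.
  - intros k.
    (* Shared by both directions of conservativity: the negation of a Pi_n relation at [k] is a
       Sigma_n sentence, so if it holds under [b] it already holds in every model of [T]. *)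
    assert (HC : forall b R, sentence b -> conservative (Sigma n) T b -> Pg n R ->
      (forall M : model, models M T -> sat (@zeros M) b -> ~ R M (scons (nu k) zeros)) ->
      forall M : model, models M T -> ~ R M (scons (nu k) zeros)).
    { intros b R Hb HC HR HMb.
      destruct (Sg_bounded_formula n 0 (fun M rho => ~ R M (scons (nu k) zeros)))
        as (c & Hc & Hcb & Ec); [|tauto|].
      { apply (Pg_fixed_env n R); auto. tm. }
      assert (Hprov : proves T c).
      { apply (HC c); auto. apply proves_add_axiom, proves_models; auto.
        intros M HM rho H. apply Ec, HMb; auto. eapply sat_sentence; eauto. }
      intros M HM. apply (Ec M zeros). apply (proj1 (proves_models T _ HT T_PA) Hprov M HM). }
    apply proves_models; auto. intros M HM rho Hsat.
    apply sat_inst_numeral, Eq in Hsat as [H|H]; simpl in H; revert H.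
    (* The cases cross: a solution of [R1] makes [a] true and is excluded under [Neg a], while a
       solution of [R2] is excluded under [a]. *)
    + apply (HC (Neg a)); auto; [split; simpl; auto|]. intros M' HM' Hn Hr. apply Hn.
      apply (Fs M' (models_extends _ _ _ T_U HM') zeros), E1; eauto.
    + apply (HC a); auto. intros M' HM' Hn Hr.
      apply (Fp M' (models_extends _ _ _ T_U HM') zeros) in Hn. revert Hn. apply E2; eauto.
Qed.

(** * Reduction of Boolean combinations to implications *)

Definition Sg_sentence (n : nat) (P : model -> Prop) : Prop := Sg n (fun M rho => P M).

Definition decides (P Q : model -> Prop) (b : form) : Prop :=
  (forall M, P M -> ~ Q M -> sat (@zeros M) b) \/ (forall M, P M -> ~ Q M -> ~ sat (@zeros M) b).

(* [P] and [~ Q] are strengthened to [P'] and [~ Q'], consistently with the class [K]. *)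
Definition refines (n : nat) (K P Q P' Q' : model -> Prop) : Prop :=
  Sg_sentence n P' /\ Sg_sentence n Q' /\
  (forall M, P' M -> P M) /\ (forall M, Q M -> Q' M) /\ exists M, K M /\ P' M /\ ~ Q' M.

Lemma refines_refl n (K P Q P' Q' : model -> Prop) :
  refines n K P Q P' Q' -> refines n K P' Q' P' Q'.
Proof. intros (H1 & H2 & _ & _ & H3); split; [|split]; auto. Qed.

Lemma refines_trans n (K P Q P' Q' P'' Q'' : model -> Prop) :
  refines n K P Q P' Q' -> refines n K P' Q' P'' Q'' -> refines n K P Q P'' Q''.
Proof. intros (_ & _ & H1 & H2 & _) (H3 & H4 & H5 & H6 & H7); repeat (split; auto). Qed.

Lemma refines_decides n (K P Q P' Q' : model -> Prop) b :
  refines n K P Q P' Q' -> decides P Q b -> decides P' Q' b.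
Proof. intros (_ & _ & H1 & H2 & _) [H|H]; [left|right]; intros M HP HQ; apply H; auto. Qed.

(** Replaces a normal form for [b]. A model in [K] of [P] and not [Q] settles each basic sentence: a
    true one is conjoined to [P], a false one is disjoined to [Q]. After finitely many such steps
    all models of [P'] and not [Q'] agree on [b]. *)
Lemma BoolComb_decide n (K : model -> Prop) b : BoolComb (Sigma n) b ->
  forall P Q, refines n K P Q P Q -> exists P' Q', refines n K P Q P' Q' /\ decides P' Q' b.
Proof.
  assert (Htwo : forall a b,
    (forall P Q, refines n K P Q P Q -> exists P' Q', refines n K P Q P' Q' /\ decides P' Q' a) ->
    (forall P Q, refines n K P Q P Q -> exists P' Q', refines n K P Q P' Q' /\ decides P' Q' b) ->
    forall P Q, refines n K P Q P Q ->
      exists P' Q', refines n K P Q P' Q' /\ decides P' Q' a /\ decides P' Q' b).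
  { intros a c IHa IHc P Q H. destruct (IHa P Q H) as (P1 & Q1 & H1 & D1).
    destruct (IHc P1 Q1 (refines_refl _ _ _ _ _ _ H1)) as (P2 & Q2 & H2 & D2).
    exists P2, Q2; eauto using refines_trans, refines_decides. }
  induction 1 as [a Ha Hs| |a b _ IHa _ IHb|a b _ IHa _ IHb|a b _ IHa _ IHb]; intros P Q H.
  - destruct H as (HP & HQ & _ & _ & M & HM & H1 & H2).
    assert (Hsat : Sg_sentence n (fun M => sat (@zeros M) a)).
    { eapply Sg_iff; [|exact (proj1 Sigma_Pi_rel _ _ Ha)].
      intros M' rho; split; apply sat_sentence; auto. }
    destruct (classic (sat (@zeros M) a)) as [Hz|Hz].
    + exists (fun M => P M /\ sat (@zeros M) a), Q. split; [|left; tauto].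
      split; [apply Sg_and; auto|]. repeat (split; [tauto || auto|]). eauto.
    + exists P, (fun M => Q M \/ sat (@zeros M) a). split; [|right; tauto].
      split; auto. split; [apply Sg_or; auto|]. repeat (split; [tauto || auto|]).
      exists M; tauto.
  - exists P, Q; split; auto. right; auto.
  - destruct (Htwo a b IHa IHb P Q H) as (P' & Q' & H' & Da & Db).
    exists P', Q'; split; auto. unfold decides; simpl.
    destruct Da as [Da|Da]; [destruct Db as [Db|Db]|]; [left|right|left]; intros M X Y;
      specialize (Da M X Y); try specialize (Db M X Y); tauto.
  - destruct (Htwo a b IHa IHb P Q H) as (P' & Q' & H' & Da & Db).
    exists P', Q'; split; auto. unfold decides; simpl.
    destruct Da as [Da|Da]; [destruct Db as [Db|Db]|]; [left|right|right]; intros M X Y;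
      specialize (Da M X Y); try specialize (Db M X Y); tauto.
  - destruct (Htwo a b IHa IHb P Q H) as (P' & Q' & H' & Da & Db).
    exists P', Q'; split; auto. unfold decides; simpl.
    destruct Da as [Da|Da]; [|destruct Db as [Db|Db]]; [left|left|right]; intros M X Y;
      specialize (Da M X Y); try specialize (Db M X Y); tauto.
Qed.

(** In a model of [T] where [b] fails, the refined [P] holds and [Q] does not. If models of [P] and
    not [Q] all refuted [b], then [P] would imply [Q] under [a], since [a] yields [b] over [T]; by
    hypothesis it would then do so in all models of [T]. *)
Lemma BoolComb_conservative n a : sentence a ->
  (forall P Q, Sg_sentence n P -> Sg_sentence n Q ->
    (forall M : model, models M T -> sat (@zeros M) a -> P M -> Q M) ->
    forall M : model, models M T -> P M -> Q M) ->
  conservative (BoolComb (Sigma n)) T a.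
Proof.
  intros Ha HC b Hb Hbs Hp. apply proves_models; auto. intros M0 HM0 rho.
  apply NNPP; intros Hn.
  assert (Hn' : ~ sat (@zeros M0) b) by (intros H; apply Hn; eapply sat_sentence; eauto).
  destruct (BoolComb_decide n (fun M => models M T /\ ~ sat (@zeros M) b) b Hb
    (fun _ => True) (fun _ => False))
    as (P & Q & (HP & HQ & _ & _ & (M & [HM HMb] & HMP & HMQ)) & HD).
  - split; [|split; [|split; [|split]]]; auto.
    + apply D0_Sg. apply (D0_iff (fun M rho => ~ False)); [tauto|d0].
    + apply D0_Sg; d0.
    + exists M0; tauto.
  - destruct HD as [HD|HD]; [apply HMb, HD; auto|].
    apply HMQ, (HC P Q); auto. intros M' HM' Hsat HP'. apply NNPP; intros HQ'.
    apply (HD M' HP' HQ').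
    apply proves_add_axiom in Hp.
    apply (proj1 (proves_models T _ HT T_PA) Hp M' HM'); auto.
Qed.

(** * The doubly conservative sentence *)

(** Transports a Sigma_1 relation from the standard numbers to all models by means of its Delta0
    matrix. Absoluteness at standard arguments is the only fact about provability that the race
    uses. *)
Lemma S1_matrix (P : nat -> nat -> nat -> Prop) : S1 (fun rho => P (rho 0) (rho 1) (rho 2)) ->
  exists D : forall M : model, M -> M -> M -> M -> Prop,
    D0 (fun M rho => D M (rho 0) (rho 1) (rho 2) (rho 3)) /\
    (forall x y z, P x y z <-> exists w, D N w x y z) /\
    (forall (M : model) w x y z, D N w x y z <-> D M (nu w) (nu x) (nu y) (nu z)).
Proof.
  intros (R & (Q & HQ & EQ) & ER).
  pose (D := fun (M : model) (w x y z : M) =>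
    ~ Q M (scons w (scons x (scons y (scons z zeros))))).
  assert (HD : D0 (fun M rho => D M (rho 0) (rho 1) (rho 2) (rho 3))).
  { apply D0_not. eapply D0_iff; [|apply (D0_comp Q (fun i M rho =>
      match i with 0 => rho 0 | 1 => rho 1 | 2 => rho 2 | 3 => rho 3 | _ => i0 end)); auto].
    - intros M rho; simpl. replace (scons (rho 0) (scons (rho 1) (scons (rho 2) (scons (rho 3) zeros))))
        with (fun i => match i with 0 => rho 0 | 1 => rho 1 | 2 => rho 2 | 3 => rho 3 | _ => i0 end);
        [tauto|extensionality i; destruct i as [|[|[|[|]]]]; auto].
    - intros [|[|[|[|i]]]]; tm. }
  exists D; repeat split; auto.
  - intros Hp. apply (ER (scons x (scons y (scons z (fun _ => 0))))), EQ in Hp. exact Hp.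
  - intros Hw. apply (ER (scons x (scons y (scons z (fun _ => 0))))), EQ. exact Hw.
  - apply (D0_absolute M _ HD (fun i => nth i [w; x; y; z] 0)).
  - apply (D0_absolute M _ HD (fun i => nth i [w; x; y; z] 0)).
Qed.

Section Construction.
Variables (k : nat) (p : form).
Hypothesis Hp : Pi (S k) p.
Hypothesis Hpb : bounded 1 p.
Hypothesis U_ex : proves U (Ex p).
Hypothesis T_not : forall j, proves T (Neg (inst (numeral j) p)).

(** Truth for Sigma_(k+1) sentences as a formula in the index; a sentence has the empty environment,
    coded by 0. *)
Lemma Univ_formula : exists s, forall (M : model) (rho : nat -> M),
  sat rho s <-> Univ k M (rho 0) i0.
Proof.
  destruct (Sg_Def _ _ (Sg_Univ k (fun M rho => rho 0) (fun M rho => i0) (Tm_var 0) Tm_zero)) as [s Hs].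
  exists s; intros; symmetry; apply Hs.
Qed.

Definition implication (s a : form) (e1 e2 : nat) : form :=
  Imp a (Imp (inst (numeral e1) s) (inst (numeral e2) s)).

(* Self-reference enters through the diagonal: [P1 m] speaks about the formula with code
   [m] instantiated at its own code, so no fixed point theorem inside PA is needed. *)
Lemma provable_implication_S1 s : exists P1 P2 : nat -> nat -> nat -> Prop,
  S1 (fun rho => P1 (rho 0) (rho 1) (rho 2)) /\ S1 (fun rho => P2 (rho 0) (rho 1) (rho 2)) /\
  forall a e1 e2, let d := inst (numeral (code a)) a in
    (P1 (code a) e1 e2 <-> proves T (implication s d e1 e2)) /\
    (P2 (code a) e1 e2 <-> proves T (implication s (Neg d) e1 e2)).
Proof.
  destruct (provability_S1 T HT T_ce) as (Thm & HS & Hsound & Hcomp).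
  pose (diag := fun (m e1 e2 a b1 b2 : nat) => Inst (code_term (numeral m)) m a /\
    Inst (code_term (numeral e1)) (code s) b1 /\ Inst (code_term (numeral e2)) (code s) b2).
  exists (fun m e1 e2 => exists a b1 b2, diag m e1 e2 a b1 b2 /\ Thm ⟨3, ⟨a, ⟨3, ⟨b1, b2⟩⟩⟩⟩),
    (fun m e1 e2 => exists a b1 b2, diag m e1 e2 a b1 b2 /\
       Thm ⟨3, ⟨⟨3, ⟨a, ⟨2, 0⟩⟩⟩, ⟨3, ⟨b1, b2⟩⟩⟩⟩).
  assert (HI : forall f g h, Sfn f -> Sfn g -> Sfn h ->
    S1 (fun rho => Inst (code_term (numeral (f rho))) (g rho) (h rho))).
  { intros f g h Hf Hg Hh. unfold Inst, sub_code. apply S1_Sub.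
    apply Sfn_numeral in Hf. sfn. }
  assert (Hdiag : forall m e1 e2 a b1 b2, diag m e1 e2 a b1 b2 ->
    dec a = inst (numeral m) (dec m) /\ dec b1 = inst (numeral e1) s /\ dec b2 = inst (numeral e2) s).
  { intros m e1 e2 a b1 b2 (H1 & H2 & H3). apply Inst_sound in H1, H2, H3.
    rewrite dect_code, ?dec_code in *; auto. }
  assert (Hd : forall a e1 e2, diag (code a) e1 e2 (code (inst (numeral (code a)) a))
    (code (inst (numeral e1) s)) (code (inst (numeral e2) s))).
  { intros; repeat split; apply Inst_complete. }
  repeat split.
  - do 3 apply S1_ex; cbn beta. apply S1_and; [|apply HS; sfn]. unfold diag.
    apply S1_and; [apply HI; sfn|]. apply S1_and; apply HI; sfn.
  - do 3 apply S1_ex; cbn beta. apply S1_and; [|apply HS; sfn]. unfold diag.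
    apply S1_and; [apply HI; sfn|]. apply S1_and; apply HI; sfn.
  - intros (x & b1 & b2 & H1 & H2). apply Hdiag in H1 as (E1 & E2 & E3).
    apply Hsound in H2. rewrite !dec_imp, E1, E2, E3, dec_code in H2. exact H2.
  - intros H. do 3 eexists; split; [apply Hd|]. apply (Hcomp _ H).
  - intros (x & b1 & b2 & H1 & H2). apply Hdiag in H1 as (E1 & E2 & E3).
    apply Hsound in H2. rewrite !dec_imp, dec_bot, E1, E2, E3, dec_code in H2. exact H2.
  - intros H. do 3 eexists; split; [apply Hd|]. apply (Hcomp _ H).
Qed.

Lemma doubly_conservative : exists a, Delta (S (S k)) U a /\
  DCons (BoolComb (Sigma (S k))) (BoolComb (Sigma (S k))) T a.
Proof.
  destruct Univ_formula as [s Hs].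
  destruct (provable_implication_S1 s) as (P1 & P2 & HP1 & HP2 & HP).
  destruct (S1_matrix P1 HP1) as (D1 & HD1 & E1 & A1).
  destruct (S1_matrix P2 HP2) as (D2 & HD2 & E2 & A2).
  (* [W D1 M x m]: below [x] there is a proof of [d -> (u -> v)], [d] being the formula [m] at
     [m], whose conclusion is false; [W D2] is the same for [~ d].  The sentence says that
     the first such counterexample for [d] precedes every one for [~ d] and every solution
     of [p]; it is Pi_(n+1) over [U] because [U] proves that the race ends. *)
  pose (W := fun (D : forall M : model, M -> M -> M -> M -> Prop) (M : model) (x m : M) =>
    exists w, ilt w x /\ exists u, ilt u x /\ exists v, ilt v x /\
      D M w m u v /\ Univ k M u i0 /\ ~ Univ k M v i0).
  pose (B := fun (M : model) (x m : M) => W D2 M x m \/ sat (scons x zeros) p).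
  (* With n = k + 1, a Sigma_n and a Pi_n condition stand under bounded quantifiers, so the closure
     properties place [W] in both classes at level n + 1. *)
  assert (HW : forall D : forall M : model, M -> M -> M -> M -> Prop,
    D0 (fun M rho => D M (rho 0) (rho 1) (rho 2) (rho 3)) -> forall i j,
    Sg (S (S k)) (fun M rho => W D M (rho i) (rho j)) /\
    Pg (S (S k)) (fun M rho => W D M (rho i) (rho j))).
  { intros D HD i j; unfold W.
    assert (HDc : D0 (fun M rho => D M (rho 2) (rho (S (S (S j)))) (rho 1) (rho 0))).
    { apply (D0_comp _ (fun l M rho => match l with
        0 => rho 2 | 1 => rho (S (S (S j))) | 2 => rho 1 | _ => rho 0 end) HD).
      intros [|[|[|]]]; apply Tm_var. }
    assert (HU' : forall l, Sg (S k) (fun M rho => Univ k M (rho l) i0))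
      by (intros l; apply (Sg_Univ k (fun M rho => rho l) (fun M rho => i0)); tm).
    split.
    - do 3 (apply Sg_bex; [tm|]). apply Sg_and; [apply D0_Sg; exact HDc|].
      apply Sg_and; [apply Sg_Sg_S, HU'|]. apply Sg_not, Sg_Pg_S, HU'.
    - do 3 (apply Pg_bex; [tm|]). apply Pg_and; [apply D0_Pg; exact HDc|].
      apply Pg_and; [apply Sg_Pg_S, HU'|]. apply Pg_not, Sg_Sg_S, HU'. }
  assert (HB : forall i j, Sg (S (S k)) (fun M rho => B M (rho i) (rho j)) /\
    Pg (S (S k)) (fun M rho => B M (rho i) (rho j))).
  { intros i j; unfold B. destruct (HW D2 HD2 i j) as [H1 H2].
    assert (H3 : Pg (S k) (fun M rho => sat (scons (rho i) zeros) p)).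
    { apply (Pg_fixed_env (S k) (fun M rho => sat rho p)); [|tm]. apply Sigma_Pi_rel; auto. }
    split; [apply Sg_or|apply Pg_or]; auto; [apply Pg_Sg_S; auto|].
    apply (Pg_le (S k)); auto. }
  assert (HA : forall i j, Sg (S (S k)) (fun M rho => W D1 M (rho i) (rho j)) /\
    Pg (S (S k)) (fun M rho => W D1 M (rho i) (rho j))) by (apply HW; auto).
  (* [F] forbids opposing events strictly below its stage, [G] also at its stage. Ties thus go to
     [F], which makes the two outcomes exclusive and, once the race ends, exhaustive. *)
  pose (F := fun (M : model) (m : M) => exists x, W D1 M x m /\ forall y, ilt y x -> ~ B M y m).
  pose (G := fun (M : model) (m : M) => exists x, B M x m /\ forall y, ilt y (iS x) -> ~ W D1 M y m).
  destruct (Sg_bounded_formula (S (S k)) 1 (fun M rho => F M (rho 0))) as (f & Hf & Hfb & Ef).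
  { unfold F. apply Sg_ex, Sg_and; [apply HA|]. apply Sg_ball; [tm|]. apply Sg_not, HB. }
  { intros M rho rho' Hr; rewrite (Hr 0) by lia; tauto. }
  destruct (Pg_bounded_formula (S (S k)) 1 (fun M rho => ~ G M (rho 0))) as (g & Hg & Hgb & Eg).
  { apply Pg_not. unfold G. apply Sg_ex, Sg_and; [apply HB|]. apply Sg_ball; [tm|].
    apply Sg_not, HA. }
  { intros M rho rho' Hr; rewrite (Hr 0) by lia; tauto. }
  (* Diagonalization: at [m = c] the formula [f] speaks of proofs about [f] instantiated at its own
     code, which is [a]. *)
  pose (c := code f). pose (a := inst (numeral c) f).
  assert (Ha : forall (M : model) (rho : nat -> M), sat rho a <-> F M (nu c))
    by (intros; unfold a; rewrite sat_inst_numeral, <- Ef; reflexivity).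
  assert (Hsa : sentence a) by (apply sentence_inst_numeral; auto).
  assert (FG : forall M : model, models M U -> F M (nu c) <-> ~ G M (nu c)).
  { intros M HM; split.
    - intros (x & Hx & Hxm) (y & Hy & Hym). destruct (le_total M x y) as [L|L].
      + apply (Hym x L Hx).
      + apply (Hxm y L Hy).
    - intros Hn.
      (* A solution of [p] ends the race, even if the matrices behave wildly at nonstandard
         arguments. *)
      destruct (proj1 (proves_models U _ HU U_PA) U_ex M HM zeros) as [z Hz].
      destruct (least M (fun M rho => W D1 M (rho 0) (rho 1) \/ B M (rho 0) (rho 1))) with
        (rho := scons (@nu M c) zeros) (x := z) as (x & Hx & Hmin).
      { apply Def_or; [apply (Sg_Def (S (S k))), HA|apply (Sg_Def (S (S k))), HB]. }
      { right; right; exact Hz. }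
      destruct (classic (W D1 M x (nu c))) as [Hxa|Hxa].
      + exists x; split; auto. intros y Hy Hyb. apply (Hmin y Hy); right; auto.
      + exfalso; apply Hn; exists x. split; [destruct Hx; [tauto|auto]|].
        intros y Hy Hya. apply (lt_S_iff M), le_lt_or_eq in Hy as [Hy| ->]; [|tauto].
        apply (Hmin y Hy); left; auto. }
  (* At a standard stage the proof and both indices are bounded by a standard number, so the event
     comes from a genuine proof. *)
  assert (Wstd : forall (D : forall M : model, M -> M -> M -> M -> Prop)
      (HDa : forall (M : model) (w x y z : nat), D N w x y z <-> D M (nu w) (nu x) (nu y) (nu z)) (M : model) j,
    W D M (nu j) (nu c) -> exists w u v : nat, D N w c u v /\ Univ k M (nu u) i0 /\ ~ Univ k M (nu v) i0).
  { intros D HDa M j (w & Hw & u & Hu & v & Hv & H).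
    apply lt_nu in Hw as (w' & _ & ->); apply lt_nu in Hu as (u' & _ & ->);
      apply lt_nu in Hv as (v' & _ & ->).
    exists w', u', v'. rewrite (HDa M); auto. }
  (* The stage S (w + u + v) lies strictly above all three witnesses. *)
  assert (Wnu : forall (D : forall M : model, M -> M -> M -> M -> Prop)
      (HDa : forall (M : model) (w x y z : nat), D N w x y z <-> D M (nu w) (nu x) (nu y) (nu z)) (M : model) (w u v : nat),
    D N w c u v -> Univ k M (nu u) i0 -> ~ Univ k M (nu v) i0 -> W D M (nu (S (w + u + v))) (nu c)).
  { intros D HDa M w u v H1 H2 H3. exists (nu w); split; [apply nu_lt; lia|].
    exists (nu u); split; [apply nu_lt; lia|]. exists (nu v); split; [apply nu_lt; lia|].
    rewrite <- (HDa M); auto. }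
  assert (Himp : forall (M : model) d u v, models M T -> proves T (implication s d u v) ->
    sat (@zeros M) d -> Univ k M (nu u) i0 -> Univ k M (nu v) i0).
  { intros M d u v HM Hpr Hd Hu.
    pose proof (proj1 (proves_models T _ HT T_PA) Hpr M HM zeros Hd) as H.
    cbn [sat] in H. rewrite !sat_inst_numeral, !Hs in H; auto. }
  assert (Hpr : forall d u v, (forall M : model, models M T -> sat (@zeros M) d ->
      Univ k M (nu u) i0 -> Univ k M (nu v) i0) -> sentence d -> proves T (implication s d u v)).
  { intros d u v H Hd; apply proves_models; auto. intros M HM rho Hsat.
    cbn [sat]. rewrite !sat_inst_numeral, !Hs. apply H; auto. eapply sat_sentence; eauto. }
  assert (Hidx : forall P, Sg_sentence (S k) P ->
    exists e, forall M : model, P M <-> Univ k M (nu e) i0).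
  { intros P HP'. destruct (universal k 0 _ HP') as [e He]; [intros M rho; tauto|].
    exists e; intros M; apply (He M zeros). }
  assert (Hpn : forall (M : model) j, models M T -> ~ sat (scons (nu j) (@zeros M)) p).
  { intros M j HM H. apply (proj1 (proves_models T _ HT T_PA) (T_not j) M HM zeros).
    apply sat_inst_numeral; auto. }
  exists a; split; [split|split; [auto|split]].
  - exists a; split; [apply Sigma_Pi_subst; auto|].
    apply proves_models; auto. intros; simpl; tauto.
  - exists (inst (numeral c) g); split; [apply Sigma_Pi_subst; auto|].
    apply proves_models; auto. intros M HM rho.
    assert (H : sat rho a <-> sat rho (inst (numeral c) g)); [|simpl; tauto].
    rewrite Ha, sat_inst_numeral, <- Eg. apply FG; auto.
  - apply BoolComb_conservative; auto. intros P Q HP' HQ' H M HM HPM. apply NNPP; intros HQM.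
    destruct (Hidx P HP') as [u Hu]; destruct (Hidx Q HQ') as [v Hv].
    assert (HP1' : P1 c u v).
    { apply HP, Hpr; auto. intros M' HM' Hd. rewrite <- Hu, <- Hv; auto. }
    apply E1 in HP1' as [w Hw].
    assert (HWM : W D1 M (nu (1 + (w + u + v))) (nu c))
      by (apply Wnu; auto; [apply Hu|rewrite <- Hv]; auto).
    (* Under [a] the implication from [P] to [Q] would hold in [M], where it fails. *)
    assert (Hna : ~ sat (@zeros M) a) by auto.
    apply Hna, Ha. exists (nu (1 + (w + u + v))); split; auto.
    intros y Hy Hyb. apply lt_nu in Hy as (j & _ & ->).
    destruct Hyb as [Hyb|Hyb]; [|exact (Hpn M j HM Hyb)].
    apply (Wstd D2 A2) in Hyb as (w' & u' & v' & H1 & H2 & H3).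
    (* An earlier event for the other side comes from a genuine proof from [Neg a]. As [Neg a] is
       true in [M], the implication proved cannot fail there. *)
    apply H3. apply (Himp M (Neg a) u' v'); auto. apply HP, E2; eauto.
  - apply BoolComb_conservative; [split; simpl; auto|].
    intros P Q HP' HQ' H M HM HPM. apply NNPP; intros HQM.
    destruct (Hidx P HP') as [u Hu]; destruct (Hidx Q HQ') as [v Hv].
    assert (HP2' : P2 c u v).
    { apply HP, Hpr; [|split; simpl; auto]. intros M' HM' Hd. rewrite <- Hu, <- Hv; auto. }
    apply E2 in HP2' as [w Hw].
    assert (HWM : W D2 M (nu (1 + (w + u + v))) (nu c))
      by (apply Wnu; auto; [apply Hu|rewrite <- Hv]; auto).
    assert (Hsat : sat (@zeros M) a) by (apply NNPP; intros Hn; apply HQM, H; auto).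
    apply Ha in Hsat as (x & Hx & Hmin).
    (* The event for [Neg a] at this standard stage would block any win of [a] at a later one, so
       the winning stage [x] is itself standard. *)
    assert (Hxl : ile x (nu (1 + (w + u + v)))).
    { destruct (le_total M x (nu (1 + (w + u + v)))) as [|L]; auto.
      destruct (Hmin _ L); left; auto. }
    change (ilt x (nu (1 + (1 + (w + u + v))))) in Hxl.
    apply lt_nu in Hxl as (j & _ & ->).
    apply (Wstd D1 A1) in Hx as (w' & u' & v' & H1 & H2 & H3).
    apply H3. apply (Himp M a u' v'); auto.
    + apply HP, E1; eauto.
    + apply NNPP; intros Hn; apply HQM, H; auto.
Qed.

End Construction.
End Main.

(** * Equivalence of the four conditions *)

Theorem theorem3p6 (n : nat) (hn : 1 <= n) (T U : theory)
    (hT : is_theory T) (hU : is_theory U)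
    (T_consistent : consistent T) (T_ce : ce_theory T) (T_PA : extends T PA)
    (T_U : extends T U) (U_PA : extends U PA) :
  (consistent_over (Sigma (n + 1)) T U <-> consistent_over (Pi n) T U) /\
  (consistent_over (Pi n) T U <->
     (forall a, ~ (Delta (n + 1) U a /\ DCons (Sigma n) (Sigma n) T a))) /\
  ((forall a, ~ (Delta (n + 1) U a /\ DCons (Sigma n) (Sigma n) T a)) <->
     (forall a, ~ (Delta (n + 1) U a /\
        DCons (BoolComb (Sigma n)) (BoolComb (Sigma n)) T a))).
Proof.
  replace (n + 1) with (S n) by lia.
  assert (H23 : consistent_over (Pi n) T U ->
    forall a, ~ (Delta (S n) U a /\ DCons (Sigma n) (Sigma n) T a))
    by (apply Pi_consistent_no_DCons; auto).
  assert (H34 : (forall a, ~ (Delta (S n) U a /\ DCons (Sigma n) (Sigma n) T a)) ->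
    forall a, ~ (Delta (S n) U a /\ DCons (BoolComb (Sigma n)) (BoolComb (Sigma n)) T a)).
  { intros H a (Hd & Hs & H1 & H2); apply (H a); split; auto. split; auto.
    split; intros b Hb Hbs Hp; [apply H1|apply H2]; auto; constructor; auto. }
  assert (H42 : (forall a, ~ (Delta (S n) U a /\
      DCons (BoolComb (Sigma n)) (BoolComb (Sigma n)) T a)) -> consistent_over (Pi n) T U).
  { intros H (p & Hp & Hb & H1 & H2). destruct n as [|k]; [lia|].
    destruct (doubly_conservative T U hT hU T_ce T_PA U_PA k p) as (a & Ha & Hc); auto.
    apply (H a); auto. }
  split; [split|split; split; auto].
  - apply Pi_consistent_of_Sigma.
  - apply Sigma_consistent_of_Pi; auto.
Qed.
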